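(* Let $B\in\mathbb Z_{\ge 1}$ and let $r=r(t)>1$ be such that for all $t$ sufficiently large, $$\frac{r-1}{r+1}\log(t)\ge 4\log\log(t).$$ For each $t$ let $H^*$ be a minimizer of the functional $G$ associated with $(r(t),t)$. Then $$\mathcal R_B(\hat S^{(H^* )}_{t,T},S_{t,T})\lesssim B^2\min\Big\{1,\frac{(1+r)^2}{r\log(t)}\Big\}^2K^{\frac{2}{1+r}}\,t^{-\frac{2}{1+r}},\qquad K:=(r+1)(r+3)\sqrt{\log(t)}\,\min\Big\{\frac1{r-1},\log(t)\Big\},$$ where the implicit constant is independent of $r$.
   Context: Setting (Poissonized generalized unseen species problem). $\mathcal{S}$ is an at most countable set of species and $\mu$ is a probability measure on $2^{\mathcal S}$ supported on finite sets. $t,t'>0$, $r=t'/t$, $T=t+t'=(1+r)t$. Let $X_1,X_2,\dots$ be i.i.d. from $\mu$, and let $n\sim\mathrm{Poisson}(t)$, $m\sim\mathrm{Poisson}(t')$ be independent of each other and of the $X_i$. The first expedition observes $X_1,\dots,X_n$, the second $X_{n+1},\dots,X_{n+m}$. For $s\in\mathcal S$, $N_s$ (resp. $N_s'$) is the number of sets observed in the first (resp. second) expedition that contain $s$. $S_t=|\{s:N_s>0\}|$, $S_T=|\{s:N_s+N_s'>0\}|$, $S_{t,T}=S_T-S_t$. $\mu\prec B$ means $\mu(A)=0$ whenever $|A|>B$. The normalized risk is $$\mathcal R_B(\hat S_{t,T},S_{t,T})=\sup_{\mu\prec B}\frac{\mathbb E[|\hat S_{t,T}-S_{t,T}|^2]}{r^2t^2},$$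 the supremum ranging over all such $\mu$ on all at most countable $\mathcal S$. A linear estimator is one of the form $\hat S^{(H)}_{t,T}=\sum_{s\in\mathcal S}H(N_s)$ for a function $H:\mathbb Z_{\ge0}\to\mathbb R$ with $H(0)=0$ (which may depend on $r$ and $t$); write $H_i=H(i)$. Let $g_H(x)=\sum_{i=1}^\infty\frac{H_i}{i!}x^i$, and let $H^2$ be the element-wise square of $H$. Define $$Y_b=\Big(\max_{p\in[0,1]}\frac{e^{-pt}}{p}\big|1-e^{-rpt}-g_H(pt)\big|\Big)^2,\qquad Y_v=\max_{q\in[0,1]}\frac{e^{-qt}}{q}\big(1-e^{-rqt}+g_{H^2}(qt)\big),\qquad G(H)=Y_b+Y_v,$$ where both expressions are extended continuously at zero (values $t|r-H_1|$ at $p=0$ and $t(r+H_1^2)$ at $q=0$), and $G(H)=+\infty$ if $\sum_{i\ge1}H_i^2t^i/i!=\infty$. A minimizer of $G$ over all real sequences exists for all $r,t>0$. $a(t)\lesssim b(t)$ means there is a constant $C$ with $a(t)\le C\,b(t)$ for all sufficiently large $t$; ''independent of $r$'' means the same $C$ works for every admissible function $r(\cdot)$ (and every $B$, the $B$-dependence being explicit). *)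

(* Defs.v *)
From HB Require Import structures.
From mathcomp Require Import all_boot all_order all_algebra finmap.
From mathcomp Require Import all_classical all_reals all_analysis.

Set Implicit Arguments.
Unset Strict Implicit.
Unset Printing Implicit Defensive.

Import Order.TTheory GRing.Theory Num.Theory.
Import numFieldNormedType.Exports.

Local Open Scope classical_set_scope.
Local Open Scope ring_scope.

(* The finite subsets of an at most countable set S form a countable set, so a
   probability measure on 2^S supported on finite sets is a probability on
   {fset S} with the discrete sigma-algebra. *)
HB.instance Definition _ (S : countType) :=
  @isMeasurable.Build default_measure_display {fset S}
    discrete_measurable discrete_measurable0
    discrete_measurableC discrete_measurableU.

(* mu ≺ B *)
Definition size_bounded (R : realType) (S : countType)
    (mu : probability {fset S} R) (B : nat) : Prop :=
  forall A : {fset S}, (B < #|` A|)%N -> mu [set A] = 0%E.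

(* N_s : number of sets in the sample xs that contain s *)
Definition occ (S : countType) (xs : seq {fset S}) (s : S) : nat :=
  count (fun A : {fset S} => s \in A) xs.

(* The set below is finite, being included in the union of xs. *)
Definition nspecies (S : countType) (xs : seq {fset S}) : nat :=
  #|` fset_set [set s : S | (0 < occ xs s)%N]|.

Definition estimator (R : realType) : Type :=
  forall S : countType, seq {fset S} -> R.

(* The sum has finite support whenever H 0 = 0. *)
Definition linear_estimator (R : realType) (H : nat -> R) : estimator R :=
  fun S xs => \sum_(s \in [set: S]) H (occ xs s).

Record expeditions (R : realType) (S : countType) (mu : probability {fset S} R)
    (t t' : R) (d : measure_display) (Omega : measurableType d)
    (P : probability Omega R)
    (X : nat -> {RV P >-> {fset S}}) (n m : {RV P >-> nat}) : Prop := {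
  law_X : forall i (E : set {fset S}), P (X i @^-1` E) = mu E ;
  law_n : forall k, P (n @^-1` [set k]) = (poisson_pmf t k)%:E ;
  law_m : forall k, P (m @^-1` [set k]) = (poisson_pmf t' k)%:E ;
  (* Mutual independence of n, m, X_0, X_1, ...; the product rule for an
     arbitrary finite subfamily is the case where the other events are setT. *)
  indep : forall k (E : nat -> set {fset S}) (F F' : set nat),
    P (n @^-1` F `&` m @^-1` F' `&` \bigcap_(i in `I_k) (X i @^-1` E i)) =
    (P (n @^-1` F) * P (m @^-1` F') * \prod_(i < k) P (X i @^-1` E i))%E }.

Definition first_sample (S : Type) (T : Type) (X : nat -> T -> S)
    (n : T -> nat) (w : T) : seq S :=
  [seq X i w | i <- iota 0 (n w)].

Definition second_sample (S : Type) (T : Type) (X : nat -> T -> S)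
    (n m : T -> nat) (w : T) : seq S :=
  [seq X i w | i <- iota (n w) (m w)].

(* E |Shat - S_{t,T}|^2, in \bar R *)
Definition mean_square_error (R : realType) (S : countType)
    (d : measure_display) (Omega : measurableType d) (P : probability Omega R)
    (X : nat -> {RV P >-> {fset S}}) (n m : {RV P >-> nat})
    (Shat : estimator R) : \bar R :=
  'E_P[fun w =>
    let first := first_sample X n w in
    let second := second_sample X n m w in
    `| Shat S first
       - ((nspecies (first ++ second))%:R - (nspecies first)%:R) | ^+ 2].

(* The error depends on mu only, not on the probability space carrying the
   sample, so the supremum over mu is taken over all pairs of mu and a
   realization of the two expeditions. *)
Definition risk (R : realType) (B : nat) (r t : R) (Shat : estimator R) :
    \bar R :=
  ereal_sup [set x | exists (S : countType) (mu : probability {fset S} R)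
      (d : measure_display) (Omega : measurableType d)
      (P : probability Omega R)
      (X : nat -> {RV P >-> {fset S}}) (n m : {RV P >-> nat}),
    [/\ size_bounded mu B, expeditions mu t (r * t) X n m &
        x = (mean_square_error X n m Shat * ((r ^+ 2 * t ^+ 2)^-1)%:E)%E]].

Definition egf (R : realType) (H : nat -> R) (x : R) : R :=
  limn (fun N => \sum_(1 <= i < N) H i / i`!%:R * x ^+ i).

(* The values of bias_fun and variance_fun at 0 are their limits there. *)
Definition bias_fun (R : realType) (r t : R) (H : nat -> R) (p : R) : R :=
  if p == 0 then t * `|r - H 1%N|
  else expR (- (p * t)) / p * `|1 - expR (- (r * p * t)) - egf H (p * t)|.

Definition variance_fun (R : realType) (r t : R) (H : nat -> R) (q : R) : R :=
  if q == 0 then t * (r + H 1%N ^+ 2)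
  else expR (- (q * t)) / q *
       (1 - expR (- (r * q * t)) + egf (fun i => H i ^+ 2) (q * t)).

(* When \sum_i H_i^2 t^i / i! is finite, the suprema below are maxima of
   continuous functions on [0, 1]. *)
Definition Yb (R : realType) (r t : R) (H : nat -> R) : \bar R :=
  let M := ereal_sup [set (bias_fun r t H p)%:E | p in `[0, 1]] in (M * M)%E.

Definition Yv (R : realType) (r t : R) (H : nat -> R) : \bar R :=
  ereal_sup [set (variance_fun r t H q)%:E | q in `[0, 1]].

Definition G (R : realType) (r t : R) (H : nat -> R) : \bar R :=
  if (\sum_(1 <= i <oo) (H i ^+ 2 * t ^+ i / i`!%:R)%:E == +oo)%E then +oo%E
  else (Yb r t H + Yv r t H)%E.

(* G ignores the value at 0; H 0 = 0 is the normalization of the coefficients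
   of a linear estimator. *)
Definition minimizer (R : realType) (r t : R) (H : nat -> R) : Prop :=
  H 0%N = 0 /\ forall H' : nat -> R, (G r t H <= G r t H')%E.

Definition Kfactor (R : realType) (r t : R) : R :=
  (r + 1) * (r + 3) * Num.sqrt (ln t) * Num.min (r - 1)^-1 (ln t).

(* Main.v *)
Require Import Defs.
From mathcomp Require Import all_boot all_order all_algebra finmap.
From mathcomp Require Import all_classical all_reals all_analysis.
From mathcomp Require Import measurable_realfun.
From mathcomp Require Import ring lra.

Import Order.TTheory GRing.Theory Num.Theory.
Import numFieldNormedType.Exports.

Local Open Scope classical_set_scope.
Local Open Scope ring_scope.

Set Implicit Arguments.
Unset Strict Implicit.
Unset Printing Implicit Defensive.

(** The risk of the minimizer H* is compared with its functional G, and the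
minimum of G with the value of G at one explicit sequence.

The first comparison is that the mean square error of the estimator with
coefficients H is at most B^2 G(H) (risk_le).  Write D_s for
H(N_s) - 1{N_s = 0 < N'_s}; the error of the estimator is the sum of the D_s
over the species.  Classify the observed sets by the species, among the first
j, that they contain.  By Poisson splitting (joint_counts) the numbers of sets
of each type are independent Poisson variables, and each of them influences at
most B of the D_s, since a set has at most B elements.  The Efron-Stein
argument then gives Var (sum D_s) <= B sum Var D_s (prod_int_variance), so
E (sum D_s)^2 <= B sum E D_s^2 + (sum E D_s)^2 (second_moment_le).  With p_s
the probability that a set contains s, E D_s^2 is p_s times variance_fun at
p_s, and |E D_s| is p_s times bias_fun at p_s (species_moments), while the p_s
sum to at most B (sum_contains_prob).  This bounds the error by
B^2 (Yv + Yb).  Fatou's lemma lets j tend to infinity.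

For the second comparison a sequence must have Poisson mean close to
e^-x - e^-(1+r)x and a small second moment.  The exact solution -(-r)^i has
geometrically growing coefficients.  It is regularized through Laguerre
polynomials.  The Laplace transform over s > 0 of L_i''(s) at u has Poisson
mean x - u + u e^(-x/u), a multiple of e^-(1+r)x for u = 1/(1+r) up to an affine
function of x.  Cutting the integral at s = k changes the mean by
O(x e^(-uk) / (uk)) only (pois_laplag2).  This rests on an energy estimate for
the Poisson mean theta of L_i''(k), which solves
x theta'' - theta' + k theta = 0 and therefore satisfies |theta| <= x / k
(pois_lag2_bound).  Combining the transforms at u = 1/(1+r), 1, 2 makes the
affine parts cancel and gives a profile that vanishes to second order at s = 0.
Joining the profile to 0 by a ramp on [k, k + 1] costs no more than
the cut (smoothed_bias).

The second moment is controlled by orthogonality: the L_i'' are orthogonal for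
s^2 e^-s and the L_i' for s e^-s, so Bessel's inequality (bessel_moment) bounds
the sums of tail_i^2 / (i (i - 1)) and of tail_i^2 / i by weighted L^2 norms of
the profile and of its derivative, both at most r^2 e^(rho k) with
rho = (r - 1) / (r + 1), up to growth_time and powers of k.  The
Poisson weights gain a factor 1 / sqrt i (poisson_mass_le); using the first sum
for i <= k and the second for i > k, the result is smoothed_second_moment.
The choice k = ln (t / K) balances squared bias and variance and yields
exists_good_estimator when r <= ln t.  When r > ln t the rate is bounded below
by a constant and H = 0 suffices. *)

(** * Laguerre polynomials and factorial moments *)

Section Laguerre.
Variable R : realType.
Implicit Types (p q : {poly R}) (i j k : nat).

(** The Laguerre polynomials, which are orthonormal for the weight e^-x on the
half-line. *)
Definition laguerre i : {poly R} :=
  \poly_(k < i.+1) ((-1) ^+ k * 'C(i, k)%:R / k`!%:R).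

Lemma coef_laguerre i k :
  (laguerre i)`_k = (-1) ^+ k * 'C(i, k)%:R / k`!%:R.
Proof.
rewrite coef_poly; case: ltnP => // ki.
by rewrite bin_small// mulr0 mul0r.
Qed.

Lemma factS_neq0 k : k`!%:R != 0 :> R.
Proof. by rewrite pnatr_eq0 -lt0n fact_gt0. Qed.

Lemma laguerre0 : laguerre 0 = 1.
Proof.
apply/polyP => k; rewrite coef_laguerre coef1 bin0n eq_sym.
by case: k => [|k] /=; rewrite ?fact0 ?expr0 ?mulr0 ?mul0r// mul1r divr1.
Qed.

Lemma deriv_laguerreS i :
  (laguerre i.+1)^`() = (laguerre i)^`() - laguerre i.
Proof.
apply/polyP => k; rewrite coefB !coef_deriv !coef_laguerre (binS i k) (natrD _ 'C(i, k.+1)) (factS k) (natrM _ k.+1).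
rewrite -(mulr_natr (_ / _)) -(mulr_natr (_ / _)) (exprS _ k); have := factS_neq0 k => k0.
have k1 : k.+1%:R != 0 :> R by rewrite pnatr_eq0.
by field; rewrite k0 nat1r.
Qed.

Lemma bin_mul_nat i k :
  k.+1%:R * 'C(i, k.+1)%:R = (i%:R - k%:R) * 'C(i, k)%:R :> R.
Proof.
case: (leqP k i) => ki; first by rewrite -natrM mul_bin_left natrM natrB.
by rewrite !bin_small ?mulr0// ltnS ltnW.
Qed.

(** The Laguerre equation, for the operator symmetric with respect to e^-x. *)
Lemma laguerre_ode i :
  'X * (laguerre i)^`() - (laguerre i)^`() - 'X * (laguerre i)^`()^`()
  = i%:R *: laguerre i.
Proof.
apply/polyP => k; rewrite !coefB coefZ -!['X * _]commr_polyX !coefMX.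
rewrite !coef_deriv !coef_laguerre.
have e : (-1) ^+ k.+1 * 'C(i, k.+1)%:R / (k.+1)`!%:R *+ k.+1 =
   - ((-1) ^+ k * ((i%:R - k%:R) * 'C(i, k)%:R) / (k`!%:R * k.+1%:R)) :> R.
  rewrite -bin_mul_nat factS natrM -mulr_natr exprS.
  have := factS_neq0 k => k0.
  have k1 : k.+1%:R != 0 :> R by rewrite pnatr_eq0.
  by field; rewrite nat1r k1 k0.
case: k e => [|k] /= e.
  rewrite !e !subr0 ?add0r expr0 bin0 fact0; by rewrite opprK !(mulr1, mul1r, invr1).
rewrite !e.
rewrite -(mulr_natr (- (_ / _)) k.+1) -(mulr_natr (_ / _)).
have := factS_neq0 k.+1.
have : k.+2%:R != 0 :> R by rewrite pnatr_eq0.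
rewrite -[k.+2]addn1 natrD.
move: (k.+1)`!%:R k.+1%:R => a b ab a0.
by field; rewrite ab a0.
Qed.

Lemma laguerre_pred i :
  'X * (laguerre i)^`()^`() + (laguerre i)^`() = - (i%:R *: laguerre i.-1).
Proof.
apply/polyP => k; rewrite coefN !coefD coefZ -!['X * _]commr_polyX !coefMX.
rewrite !coef_deriv !coef_laguerre.
case: i => [|i] /=.
  rewrite !bin0n /= !mul0r oppr0.
  by case: k => [|k] /=; rewrite ?coef_deriv ?coef_laguerre ?bin0n /= !(mulr0, mul0r, mul0rn, addr0).
have e : 'C(i.+1, k.+1)%:R * k.+1%:R = i.+1%:R * 'C(i, k)%:R :> R.
  by rewrite -!natrM mulnC -mul_bin_diag.
have := factS_neq0 k => k0.
have k1 : k.+1%:R != 0 :> R by rewrite pnatr_eq0.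
case: k e k0 k1 => [|k] /= e k0 k1.
  move: e; rewrite add0r !bin0 !mulr1 => e.
  rewrite -e.
  by rewrite fact0 expr1 expr0 !(mulr1, mul1r, invr1) mulN1r.
rewrite -(mulr_natr (_ *+ k.+2) k.+1) -(mulr_natr (_ / _) k.+2).
rewrite (_ : i.+1%:R * _ = (-1) ^+ k.+1 * (i.+1%:R * 'C(i, k.+1)%:R) / (k.+1)`!%:R); last by ring.
rewrite -e (factS k.+1) (natrM _ k.+2) (exprS _ k.+1) -[in k.+2%:R]addn1 natrD.
move: k0 k1; rewrite -[k.+2]addn1 natrD.
move: (k.+1)`!%:R k.+1%:R => a b a0 ab.
by field; rewrite ab a0.
Qed.

Lemma laguerre_diff i :
  'X * (laguerre i)^`() = i%:R *: laguerre i - i%:R *: laguerre i.-1.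
Proof. by rewrite -laguerre_ode -laguerre_pred; ring. Qed.

(** The integral of p e^-x over the half-line, since 'X^k has integral k!; working
with the coefficients avoids improper integrals. *)
Definition moment p : R := \sum_(k < size p) p`_k * k`!%:R.

Lemma momentE n p : (size p <= n)%N -> moment p = \sum_(k < n) p`_k * k`!%:R.
Proof.
move=> pn; rewrite /moment (big_ord_widen n (fun k => p`_k * k`!%:R))//.
rewrite big_mkcond/=; apply: eq_bigr => k _; case: ltnP => // pk.
by rewrite nth_default// mul0r.
Qed.

Arguments momentE : clear implicits.

Lemma momentD p q : moment (p + q) = moment p + moment q.
Proof.
have h := size_polyD p q.
rewrite !(momentE (maxn (size p) (size q)))// ?leq_maxl ?leq_maxr//.
by rewrite -big_split; apply: eq_bigr => k _; rewrite coefD mulrDl.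
Qed.

Lemma momentZ c p : moment (c *: p) = c * moment p.
Proof.
rewrite (momentE (size p)) ?size_scale_leq// /moment mulr_sumr.
by apply: eq_bigr => k _; rewrite coefZ mulrA.
Qed.

Lemma momentN p : moment (- p) = - moment p.
Proof. by rewrite -scaleN1r momentZ mulN1r. Qed.

Lemma momentB p q : moment (p - q) = moment p - moment q.
Proof. by rewrite momentD momentN. Qed.

Lemma moment0 : moment 0 = 0.
Proof. by rewrite /moment size_poly0 big_ord0. Qed.

Lemma moment1 : moment 1 = 1.
Proof. by rewrite /moment size_poly1 big_ord1 coef1 mul1r. Qed.

Lemma moment_sum (I : Type) (s : seq I) (P : pred I) (F : I -> {poly R}) :
  moment (\sum_(i <- s | P i) F i) = \sum_(i <- s | P i) moment (F i).
Proof.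
by elim/big_rec2: _ => [|i x y _ <-]; [exact: moment0 | rewrite momentD].
Qed.

(** Integration by parts against e^-x. *)
Lemma moment_deriv p : moment p = p`_0 + moment p^`().
Proof.
rewrite (momentE (size p).+1)// big_ord_recl fact0 mulr1; congr (_ + _).
rewrite (momentE (size p)); last first.
  by have [->|/lt_size_deriv/ltnW//] := eqVneq p 0; rewrite deriv0.
apply: eq_bigr => k _; rewrite coef_deriv /= /bump /= add1n.
by rewrite (factS k) (natrM _ k.+1) mulrA -(mulr_natr p`_k.+1).
Qed.

Lemma moment_parts p q :
  moment ('X * p * q^`()) = moment (('X * p - ('X * p)^`()) * q).
Proof.
have := moment_deriv ('X * p * q).
rewrite -{2}mulrA coefXM eqxx add0r derivM momentD mulrBl momentB => ->.
by rewrite addrAC subrr add0r.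
Qed.

(** The symmetry of the Laguerre operator for the weight e^-x.  The eigenvalues
being distinct, it gives the orthogonality below. *)
Lemma moment_laguerre_deriv i q :
  moment ('X * (laguerre i)^`() * q^`()) = i%:R * moment (laguerre i * q).
Proof.
rewrite moment_parts -momentZ scalerAl -laguerre_ode derivM derivX mul1r.
by congr (moment (_ * _)); rewrite opprD addrA.
Qed.

Lemma moment_laguerre_orth i j :
  (i != j)%N -> moment (laguerre i * laguerre j) = 0.
Proof.
move=> ij; have h := moment_laguerre_deriv i (laguerre j).
have h' := moment_laguerre_deriv j (laguerre i).
have : i%:R * moment (laguerre i * laguerre j) = j%:R * moment (laguerre i * laguerre j).
  by rewrite -h (mulrC (laguerre i)) -h'; congr moment; ring.
move/eqP; rewrite -subr_eq0 -mulrBl mulf_eq0 subr_eq0 eqr_nat (negbTE ij) /=.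
by move/eqP.
Qed.

Lemma deriv_laguerre_sum i : (laguerre i)^`() = - \sum_(j < i) laguerre j.
Proof.
elim: i => [|i IH]; first by rewrite big_ord0 oppr0 laguerre0 derivC.
by rewrite deriv_laguerreS IH big_ord_recr /= opprD.
Qed.

(** Expanding (L_(i+1))' as - (L_0 + ... + L_i), only the term L_i survives in the
moment of x (L_(i+1)')^2, which the symmetry also evaluates. *)
Lemma moment_laguerre_sqr i : moment (laguerre i * laguerre i) = 1.
Proof.
elim: i => [|i IH]; first by rewrite laguerre0 mulr1 moment1.
have h := moment_laguerre_deriv i.+1 (laguerre i.+1).
have : moment ('X * (laguerre i.+1)^`() * (laguerre i.+1)^`()) = i.+1%:R.
  rewrite laguerre_diff /= -scalerBr -scalerAl momentZ {1}deriv_laguerre_sum.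
  rewrite mulrN momentN mulr_sumr moment_sum big_ord_recr /= big1 ?add0r => [|j _].
    by rewrite mulrBl momentB IH moment_laguerre_orth ?neq_ltn ?ltnSn ?orbT// sub0r opprK mulr1.
  rewrite mulrBl momentB !moment_laguerre_orth ?subrr// neq_ltn ?ltn_ord ?orbT//.
  by rewrite (ltn_trans (ltn_ord j)) ?orbT.
move=> e; apply: (mulfI (_ : i.+1%:R != 0)); first by rewrite pnatr_eq0.
by rewrite mulr1 -[RHS]e h.
Qed.

Lemma moment_laguerre i j : moment (laguerre i * laguerre j) = (i == j)%:R.
Proof.
by case: eqVneq => [->|/moment_laguerre_orth//]; exact: moment_laguerre_sqr.
Qed.

Lemma moment_laguerre1 i j :
  moment ('X * (laguerre i)^`() * (laguerre j)^`()) = (i == j)%:R * i%:R.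
Proof. by rewrite moment_laguerre_deriv moment_laguerre mulrC. Qed.

(** The differentiated Laguerre equation makes the L_i' eigenfunctions of the
symmetric operator with weight x e^-x, and their derivatives orthogonal for
x^2 e^-x. *)
Lemma moment_laguerre2 i j :
  moment ('X ^+ 2 * (laguerre i)^`()^`() * (laguerre j)^`()^`())
  = (i == j)%:R * (i * i.-1)%:R.
Proof.
rewrite expr2 -(mulrA 'X) moment_parts.
have /(congr1 (@deriv R)) := laguerre_ode i.
rewrite !derivB !derivM derivX derivZ.
set D := (laguerre i)^`()^`() => e.
rewrite (_ : 'X * _ - _ = 'X * (i%:R *: (laguerre i)^`() - (laguerre i)^`())); last first.
  by rewrite -e; ring.
rewrite mulrBr mulrBl momentB -!scalerAr -!scalerAl momentZ !moment_laguerre1.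
case: eqVneq => [_|_]; last by rewrite !mul0r mulr0 subrr.
case: i {D e} => [|i] /=; first by rewrite muln0 !mulr0 subrr.
by rewrite !mul1r natrM -{2}[i.+1]addn1 natrD; ring.
Qed.
End Laguerre.

(** * Differentiation, integration and Bessel's inequality *)

Lemma le_of_eq d (T : porderType d) (x y : T) : x = y -> (x <= y)%O.
Proof. by move=> ->. Qed.

Section Derivatives.
Variable R : realType.
Implicit Types (f g : R -> R) (x a b c : R).

Lemma derE f x a b : is_derive x 1 f a -> a = b -> is_derive x 1 f b.
Proof. by move=> h <-. Qed.

Lemma derD f g x a b : is_derive x 1 f a -> is_derive x 1 g b ->
  is_derive x 1 (fun y => f y + g y) (a + b).
Proof. exact: is_deriveD. Qed.

Lemma derB f g x a b : is_derive x 1 f a -> is_derive x 1 g b ->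
  is_derive x 1 (fun y => f y - g y) (a - b).
Proof. exact: is_deriveB. Qed.

Lemma derN f x a : is_derive x 1 f a -> is_derive x 1 (fun y => - f y) (- a).
Proof. exact: is_deriveN. Qed.

Lemma derM f g x a b : is_derive x 1 f a -> is_derive x 1 g b ->
  is_derive x 1 (fun y => f y * g y) (a * g x + f x * b).
Proof.
move=> df dg; apply: (derE (is_deriveM df dg)).
by rewrite /GRing.scale/= addrC mulrC.
Qed.

Lemma derZ c f x a : is_derive x 1 f a ->
  is_derive x 1 (fun y => c * f y) (c * a).
Proof. exact: is_deriveZ. Qed.

Lemma der_cst c x : is_derive x 1 (fun=> c) 0.
Proof. exact: is_derive_cst. Qed.

Lemma der_id x : is_derive x 1 (fun y : R => y) 1.
Proof. exact: is_derive_id. Qed.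

Lemma der_exp c x : is_derive x 1 (fun y => expR (c * y)) (c * expR (c * x)).
Proof.
have h : is_derive x 1 (fun y : R => c * y) c.
  by apply: (derE (derZ c (der_id x))); rewrite mulr1.
by rewrite mulrC; exact: (@is_derive1_comp _ expR (fun y => c * y)).
Qed.

Lemma der_continuous f df : (forall x, is_derive x 1 f (df x)) -> continuous f.
Proof.
move=> h x; apply/differentiable_continuous/derivable1_diffP.
exact: (@ex_derive _ _ _ _ _ _ _ (h x)).
Qed.

Lemma derivative_ge0_le f df a b : a <= b ->
  (forall x, a <= x <= b -> is_derive x 1 f (df x)) ->
  (forall x, a <= x <= b -> 0 <= df x) -> f a <= f b.
Proof.
move=> ab h df0; have [||x] := @MVT_segment _ f df a b ab.
- by move=> x; rewrite in_itv/= => /andP[/ltW ax /ltW xb]; apply: h; rewrite ax.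
- apply/continuous_in_subspaceT => x; rewrite inE/= in_itv/= => xab.
  apply/differentiable_continuous/derivable1_diffP.
  exact: (@ex_derive _ _ _ _ _ _ _ (h x xab)).
rewrite in_itv/= => xab e.
by rewrite -subr_ge0 e mulr_ge0 ?df0// subr_ge0.
Qed.

(** 1 - 1/2 <= e^(-1/2), squared. *)
Lemma expR1_le : expR 1 <= 4 :> R.
Proof.
have h := @expR_ge1Dx R (- 2^-1).
have e : expR 1 * expR (- 2^-1) ^+ 2 = 1 :> R.
  by rewrite -expRM_natl -expRD (_ : 1 + _ = 0) ?expR0//; field.
have h1 : 2^-1 <= expR (- 2^-1) :> R by lra.
have h2 : (2^-1) ^+ 2 <= expR (- 2^-1) ^+ 2 :> R by rewrite lerXn2r// ?nnegrE ?expR_ge0.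
have := expR_ge0 (1 : R); nra.
Qed.
End Derivatives.

Section IntervalIntegral.
Variable R : realType.
Implicit Types (f g : R -> R) (a b c x : R) (p : {poly R}).

Definition itg a b f : R := \int[lebesgue_measure]_(x in `[a, b]) f x.

Lemma itg_integrable a b f : continuous f ->
  (@lebesgue_measure R).-integrable `[a, b] (EFin \o f).
Proof.
move=> cf; apply: continuous_compact_integrable; first exact: segment_compact.
exact: continuous_subspaceT.
Qed.

Lemma itgD a b f g : continuous f -> continuous g ->
  itg a b (fun x => f x + g x) = itg a b f + itg a b g.
Proof. by move=> cf cg; rewrite /itg RintegralD//; exact: itg_integrable. Qed.

Lemma itgZ a b c f : continuous f ->
  itg a b (fun x => c * f x) = c * itg a b f.
Proof. by move=> cf; rewrite /itg RintegralZl//; exact: itg_integrable. Qed.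

Lemma itgB a b f g : continuous f -> continuous g ->
  itg a b (fun x => f x - g x) = itg a b f - itg a b g.
Proof. by move=> cf cg; rewrite /itg RintegralB//; exact: itg_integrable. Qed.

Lemma continuous_sumf (I : Type) (s : seq I) (F : I -> R -> R) :
  (forall i, continuous (F i)) -> continuous (fun x => \sum_(i <- s) F i x).
Proof.
move=> cF; elim: s => [|i s IH].
  rewrite (_ : (fun _ => _) = cst 0); first exact: cst_continuous.
  by apply/funext => x; rewrite big_nil.
rewrite (_ : (fun _ => _) = (fun x => F i x + \sum_(j <- s) F j x)).
  by move=> x; apply: cvgD; [exact: cF | exact: IH].
by apply/funext => x; rewrite big_cons.
Qed.

Lemma itg_sum a b (I : Type) (s : seq I) (F : I -> R -> R) :
  (forall i, continuous (F i)) ->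
  itg a b (fun x => \sum_(i <- s) F i x) = \sum_(i <- s) itg a b (F i).
Proof.
move=> cF; elim: s => [|i s IH].
  rewrite big_nil /itg (_ : (fun _ => _) = cst 0).
    by rewrite Rintegral_cst ?mul0r//.
  by apply/funext => x; rewrite big_nil.
rewrite big_cons -IH -itgD//; last exact: continuous_sumf.
by congr itg; apply/funext => x; rewrite big_cons.
Qed.

Lemma itg_le a b f g : continuous f -> continuous g ->
  (forall x, a <= x <= b -> f x <= g x) -> itg a b f <= itg a b g.
Proof.
move=> cf cg fg; apply: le_Rintegral => //; try exact: itg_integrable.
Qed.

Lemma itg_ge0 a b f : (forall x, a <= x <= b -> 0 <= f x) -> 0 <= itg a b f.
Proof.
by move=> f0; apply: Rintegral_ge0 => x /=; rewrite in_itv/=; exact: f0.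
Qed.

Lemma itg_FTC a b f (F : R -> R) : a <= b -> continuous f ->
  (forall x, is_derive x 1 F (f x)) -> itg a b f = F b - F a.
Proof.
move=> ab cf dF.
have cF := der_continuous dF.
move: ab; rewrite le_eqVlt => /predU1P[<-|ab].
  by rewrite subrr /itg set_itv1 Rintegral_set1.
rewrite /itg /Rintegral (@continuous_FTC2 _ f F)//.
- exact: continuous_subspaceT.
- split.
  + by move=> x _; exact: (@ex_derive _ _ _ _ _ _ _ (dF x)).
  + exact/cvg_at_right_filter/cF.
  + exact/cvg_at_left_filter/cF.
- by move=> x _; rewrite derive1E; exact: (@derive_val _ _ _ _ _ _ _ (dF x)).
Qed.

Lemma itg_parts a b f g (df dg : R -> R) : a <= b ->
  (forall x, is_derive x 1 f (df x)) -> (forall x, is_derive x 1 g (dg x)) ->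
  continuous df -> continuous dg ->
  itg a b (fun x => f x * dg x) =
  f b * g b - f a * g a - itg a b (fun x => df x * g x).
Proof.
move=> ab hf hg cdf cdg.
have cf := der_continuous hf; have cg := der_continuous hg.
have c1 : continuous (fun x => f x * dg x).
  by move=> x; apply: cvgM; [exact: cf | exact: cdg].
have c2 : continuous (fun x => df x * g x).
  by move=> x; apply: cvgM; [exact: cdf | exact: cg].
have h x : is_derive x 1 (fun x => f x * g x) (df x * g x + f x * dg x).
  exact: derM.
rewrite -(itg_FTC ab _ h); last by move=> x; apply: cvgD; [exact: c2 | exact: c1].
by rewrite itgD// addrC addKr.
Qed.

Lemma continuous_expc c : continuous (fun x : R => expR (c * x)).
Proof. exact: (der_continuous (der_exp c)). Qed.

(** Chosen so that - expprim p * e^-x is a primitive of p e^-x. *)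
Definition expprim p : {poly R} := \sum_(j < size p) p^`(j).

Lemma expprimE p : expprim p - (expprim p)^`() = p.
Proof.
rewrite /expprim raddf_sum /=.
under [X in _ - X]eq_bigr do rewrite -derivnS.
case e : (size p) => [|n].
  by rewrite !big_ord0 subr0; apply/esym/eqP; rewrite -size_poly_eq0 e.
rewrite big_ord_recl [X in _ - X]big_ord_recr /=.
rewrite -(derivnS p n) (derivn_poly0 (p := p) (n := n.+1)) ?e//.
by rewrite addr0 addrK.
Qed.

Lemma expprim0 p : (expprim p).[0] = moment p.
Proof.
rewrite /expprim horner_sum /moment; apply: eq_bigr => j _.
by rewrite horner_coef0 coef_derivn addn0 ffactnn mulr_natr.
Qed.

Lemma der_expprim p x :
  is_derive x 1 (fun y => - ((expprim p).[y] * expR (- 1 * y)))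
    (p.[x] * expR (- 1 * x)).
Proof.
apply: (derE (derN (derM (is_derive_poly _ _) (der_exp (-1) x)))).
by rewrite -{3}(expprimE p) hornerD hornerN; ring.
Qed.

Lemma poly_bound p : exists C, 0 <= C /\ forall x, 1 <= x ->
  `|p.[x]| <= C * x ^+ (size p).
Proof.
exists (\sum_(i < size p) `|p`_i|); split; first exact: sumr_ge0.
move=> x x1; rewrite horner_coef (le_trans (ler_norm_sum _ _ _))// mulr_suml.
apply: ler_sum => i _; rewrite normrM ler_wpM2l// normrX ger0_norm ?(le_trans ler01)//.
by rewrite ler_weXn2l// ltnW.
Qed.

(** The primitive - (expprim p) e^-x increases on [a, +oo[ and tends to 0, so it
cannot be positive at a. *)
Lemma poly_exp_nneg p a : 0 <= a ->
  (forall x, a <= x -> 0 <= p.[x]) -> 0 <= (expprim p).[a].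
Proof.
move=> a0 p0; rewrite leNgt; apply/negP => qa.
set q := expprim p in qa.
pose d := - (q.[a] * expR (- 1 * a)).
have d0 : 0 < d by rewrite oppr_gt0 pmulr_llt0// expR_gt0.
have qb x : a <= x -> d <= - (q.[x] * expR (- 1 * x)).
  move=> ax.
  have := @derivative_ge0_le _ _ _ _ _ ax (fun y _ => der_expprim p y).
  by apply=> y /andP[ay _]; rewrite mulr_ge0 ?p0// expR_ge0.
have [C [C0 qC]] := poly_bound q.
set n := size q in qC.
(* beyond this x the bound C x^n on expprim is below d x^(n+2) / (n+2)! <= d e^x *)
pose x := Num.max (Num.max a 1) ((C + 1) * n.+2`!%:R / d).
have x1 : 1 <= x by rewrite !le_max lexx orbT.
have xa : a <= x by rewrite !le_max lexx.
have x0 : 0 < x := lt_le_trans ltr01 x1.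
have := qb x xa; rewrite leNgt => /negP; apply.
rewrite mulN1r expRN -mulNr ltr_pdivrMr ?expR_gt0//.
apply: (@le_lt_trans _ _ (C * x ^+ n)).
  by rewrite (le_trans (ler_norm _))// normrN qC.
apply: (@lt_le_trans _ _ (d * (x ^+ n.+2 / n.+2`!%:R))); last first.
  rewrite ler_pM2l//; have := @expR_ge1Dxn _ x n.+1 (ltW x0); lra.
have f0 : 0 < n.+2`!%:R :> R by rewrite ltr0n fact_gt0.
rewrite mulrA ltr_pdivlMr//.
have : (C + 1) * n.+2`!%:R / d <= x by rewrite le_max lexx orbT.
rewrite ler_pdivrMr// => h.
apply: (@lt_le_trans _ _ ((C + 1) * n.+2`!%:R * x ^+ n)).
  by rewrite mulrAC ltr_pM2r ?exprn_gt0// ltr_pM2r// ltrDl.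
apply: (le_trans (ler_wpM2r (exprn_ge0 n (ltW x0)) h)).
rewrite !exprSr (mulrC x) -(mulrA d) ler_pM2l// mulrC.
by rewrite ler_peMr// mulr_ge0 ?exprn_ge0// ltW.
Qed.

Lemma itg_poly_exp_le_moment p a b : 0 <= a <= b ->
  (forall x, 0 <= x -> 0 <= p.[x]) ->
  itg a b (fun x => p.[x] * expR (- 1 * x)) <= moment p.
Proof.
move=> /andP[a0 ab] p0.
have c : continuous (fun x => p.[x] * expR (- 1 * x)).
  by move=> x; apply: cvgM; [exact: continuous_horner | exact: continuous_expc].
rewrite (itg_FTC ab c (der_expprim p)) opprK.
have : (expprim p).[a] * expR (- 1 * a) <= (expprim p).[0] * expR (- 1 * 0).
  have := @derivative_ge0_le _ _ _ _ _ a0 (fun y _ => der_expprim p y).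
  rewrite lerN2; apply => y /andP[y0 _].
  by rewrite mulr_ge0 ?p0// expR_ge0.
rewrite mulr0 expR0 mulr1 expprim0.
have : 0 <= (expprim p).[b] * expR (- 1 * b).
  rewrite mulr_ge0 ?expR_ge0// poly_exp_nneg ?(le_trans a0)// => x bx.
  by rewrite p0// (le_trans a0)// (le_trans ab).
lra.
Qed.

(** Bessel's inequality for the P i, orthogonal for the weight w e^-s, and the
function f / (w e^-s).  The majorant m stands for f^2 / (w e^-s), so that no
division by a weight vanishing at 0 occurs. *)
Lemma bessel_moment (N : nat) (P : 'I_N -> {poly R}) (h : 'I_N -> R)
    (w : {poly R}) f (m : R -> R) a b :
  0 <= a <= b -> (forall i, 0 < h i) ->
  (forall x, 0 <= x -> 0 <= w.[x]) ->
  (forall i j, moment (w * P i * P j) = (i == j)%:R * h i) ->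
  continuous f -> continuous m ->
  (forall x, a <= x <= b -> 0 <= m x) ->
  (forall x, a <= x <= b -> f x ^+ 2 <= m x * (w.[x] * expR (- 1 * x))) ->
  \sum_i itg a b (fun x => f x * (P i).[x]) ^+ 2 / h i <= itg a b m.
Proof.
move=> /andP[a0 ab] h0 w0 orth cf cm m0 fm.
pose c i := itg a b (fun x => f x * (P i).[x]).
pose S := \sum_i c i ^+ 2 / h i.
pose Q : {poly R} := \sum_i (c i / h i) *: P i.
have QE x : Q.[x] = \sum_i c i / h i * (P i).[x].
  by rewrite horner_sum; apply: eq_bigr => i _; rewrite hornerZ.
have cfP i : continuous (fun x => f x * (P i).[x]).
  by move=> x; apply: cvgM; [exact: cf | exact: continuous_horner].
have cfQ : continuous (fun x => f x * Q.[x]).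
  by move=> x; apply: cvgM; [exact: cf | exact: continuous_horner].
have e1 : itg a b (fun x => f x * Q.[x]) = S.
  rewrite (_ : (fun _ => _) =
      (fun x => \sum_i (c i / h i) * (f x * (P i).[x]))).
    rewrite itg_sum; last first.
      move=> i; move=> x; apply: cvgM; [exact: cvg_cst | exact: cfP].
    apply: eq_bigr => i _; rewrite itgZ//.
    by rewrite -/(c i) expr2 mulrAC.
  apply/funext => x; rewrite QE mulr_sumr; apply: eq_bigr => i _.
  by rewrite mulrCA.
have E k i j : moment (w * (k *: P j) * P i) = k * ((j == i)%:R * h j).
  by rewrite -scalerAr -scalerAl momentZ orth.
have e2 : moment (w * Q * Q) = S.
  rewrite -[w * Q * Q]/(w * Q * \sum_i (c i / h i) *: P i) mulr_sumr moment_sum.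
  apply: eq_bigr => i _; rewrite -scalerAr momentZ /Q [w * _]mulr_sumr mulr_suml moment_sum (bigD1 i)//=.
  rewrite big1 ?addr0; last first.
    by move=> j ji; rewrite E (negbTE ji) mul0r mulr0.
  rewrite E eqxx mul1r divfK ?gt_eqF//.
  by rewrite expr2 mulrAC.
pose g x := m x - 2 * (f x * Q.[x]) + (w * Q * Q).[x] * expR (- 1 * x).
have cwQ : continuous (fun x => (w * Q * Q).[x] * expR (- 1 * x)).
  by move=> x; apply: cvgM; [exact: continuous_horner | exact: continuous_expc].
have c2 : continuous (fun x => 2 * (f x * Q.[x])).
  by move=> x; apply: cvgM; [exact: cvg_cst | exact: cfQ].
have c3 : continuous (fun x => m x - 2 * (f x * Q.[x])).
  by move=> x; apply: cvgB; [exact: cm | exact: c2].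
have : 0 <= itg a b g.
  apply: itg_ge0 => x xab; rewrite /g.
  rewrite !hornerM.
  set W := w.[x] * expR (- 1 * x).
  have W0 : 0 <= W.
    by case/andP: xab => ax _; rewrite mulr_ge0 ?w0 ?expR_ge0// (le_trans a0).
  have := fm x xab; rewrite -/W => fW; have := m0 x xab => mx.
  have [We|Wn] := eqVneq W 0.
    move: fW; rewrite We mulr0 => f0.
    have -> : f x = 0 by apply/eqP; rewrite -sqrf_eq0 eq_le f0 sqr_ge0.
    rewrite (_ : w.[x] * _ * _ * _ = W * Q.[x] ^+ 2); last by rewrite /W; ring.
    by rewrite We !mul0r mulr0 subr0 addr0.
  have Wp : 0 < W by rewrite lt_def Wn.
  rewrite -(pmulr_rge0 _ Wp).
  rewrite (_ : W * _ = (m x * W - f x ^+ 2) + (f x - Q.[x] * W) ^+ 2).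
    by rewrite addr_ge0 ?sqr_ge0// subr_ge0.
  by rewrite /W; ring.
rewrite itgD// itgB// itgZ// e1.
have := @itg_poly_exp_le_moment (w * Q * Q) a b.
rewrite a0 ab e2 => /(_ isT) H.
have := H _; rewrite -/S => {}H.
have : forall x, 0 <= x -> 0 <= (w * Q * Q).[x].
  by move=> x x0; rewrite !hornerM -mulrA mulr_ge0 ?w0// -expr2 sqr_ge0.
move=> /H; lra.
Qed.
End IntervalIntegral.

(** * Exponential generating series and Poisson means *)

Section ExponentialSeries.
Variable R : realType.
Implicit Types (c d : nat -> R) (x y k b : R).

(** The growth condition under which the exponential generating series is entire
and can be shifted and differentiated freely. *)
Definition geom_bounded c :=
  exists A B : R, [/\ 0 <= A, 0 <= B & forall i, `|c i| <= A * B ^+ i].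

Lemma geom_bounded_pow b : geom_bounded (fun i => b ^+ i).
Proof. by exists 1, `|b|; split => // i; rewrite mul1r normrX. Qed.

Lemma geom_bounded_cst b : geom_bounded (fun=> b).
Proof. by exists `|b|, 1; split => // i; rewrite expr1n mulr1. Qed.

Lemma geom_boundedD c d : geom_bounded c -> geom_bounded d ->
  geom_bounded (fun i => c i + d i).
Proof.
move=> [A [B [A0 B0 cAB]]] [A' [B' [A0' B0' dAB]]].
exists (A + A'), (B + B'); split; rewrite ?addr_ge0// => i.
rewrite mulrDl (le_trans (ler_normD _ _))// lerD//.
  by rewrite (le_trans (cAB i))// ler_wpM2l// lerXn2r// ?nnegrE ?addr_ge0// lerDl.
by rewrite (le_trans (dAB i))// ler_wpM2l// lerXn2r// ?nnegrE ?addr_ge0// lerDr.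
Qed.

Lemma geom_boundedZ k c : geom_bounded c -> geom_bounded (fun i => k * c i).
Proof.
move=> [A [B [A0 B0 cAB]]]; exists (`|k| * A), B; split; rewrite ?mulr_ge0// => i.
by rewrite normrM -mulrA ler_wpM2l.
Qed.

Lemma geom_boundedN c : geom_bounded c -> geom_bounded (fun i => - c i).
Proof.
by move=> [A [B [A0 B0 cAB]]]; exists A, B; split => // i; rewrite normrN.
Qed.

Lemma geom_boundedB c d : geom_bounded c -> geom_bounded d ->
  geom_bounded (fun i => c i - d i).
Proof. by move=> hc hd; apply: geom_boundedD => //; exact: geom_boundedN. Qed.

Lemma geom_boundedS c : geom_bounded c -> geom_bounded (fun i => c i.+1).
Proof.
move=> [A [B [A0 B0 cAB]]]; exists (A * B), B; split; rewrite ?mulr_ge0// => i.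
by rewrite -mulrA -exprS.
Qed.

Lemma geom_bounded_muln c : geom_bounded c ->
  geom_bounded (fun i => i%:R * c i).
Proof.
move=> [A [B [A0 B0 cAB]]]; exists A, (2 * B); split; rewrite ?mulr_ge0// => i.
rewrite normrM exprMn mulrCA ler_pM// ger0_norm// -natrX ler_nat.
exact: ltnW (ltn_expl _ _).
Qed.

Lemma geom_bounded_pred c : geom_bounded c -> geom_bounded (fun i => c i.-1).
Proof.
move=> [A [B [A0 B0 cAB]]]; exists A, (B + 1); split; rewrite ?addr_ge0// => i.
rewrite (le_trans (cAB _))// ler_wpM2l//.
apply: (@le_trans _ _ ((B + 1) ^+ i.-1)).
  by rewrite lerXn2r ?nnegrE ?addr_ge0// lerDl.
by rewrite ler_weXn2l ?leq_pred// lerDr.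
Qed.

Definition egs c x : R := limn (pseries (fun i => c i / i`!%:R) x).

Lemma cvg_egs c x : geom_bounded c -> cvgn (pseries (fun i => c i / i`!%:R) x).
Proof.
move=> [A [B [A0 B0 cAB]]]; apply: normed_cvg.
have h : cvgn (series (A *: exp_coeff (B * `|x|))).
  by apply: is_cvg_seriesZ; exact: is_cvg_series_exp_coeff.
apply: series_le_cvg h => n /=.
- exact: normr_ge0.
- by rewrite mulr_ge0// exp_coeff_ge0// mulr_ge0.
- rewrite !normrM normrX normfV [X in _ * X^-1 * _]ger0_norm//.
  rewrite -[(A *: _) n]/(A * ((B * `|x|) ^+ n / n`!%:R)) exprMn.
  rewrite [leRHS](_ : _ = A * B ^+ n / n`!%:R * `|x| ^+ n); last by ring.
  by rewrite ler_wpM2r ?exprn_ge0// ler_wpM2r// invr_ge0.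
Qed.

Lemma egs_diffs c :
  pseries_diffs (fun i => c i / i`!%:R) = (fun i => c i.+1 / i`!%:R).
Proof.
apply/funext => i; rewrite /pseries_diffs factS natrM.
have := @factS_neq0 R i => f0; have i0 : i.+1%:R != 0 :> R by rewrite pnatr_eq0.
by rewrite invfM [c _ * _]mulrCA mulVKf.
Qed.

Lemma der_egs c x : geom_bounded c ->
  is_derive x 1 (egs c) (egs (fun i => c i.+1) x).
Proof.
move=> hc; rewrite /egs -egs_diffs.
apply: (@pseries_snd_diffs _ _ (`|x| + 1)).
- exact: cvg_egs.
- by rewrite egs_diffs; apply: cvg_egs; exact: geom_boundedS.
- by rewrite !egs_diffs; apply: cvg_egs; exact: (geom_boundedS (geom_boundedS hc)).
- by rewrite [ltRHS]ger0_norm ?addr_ge0// ltrDl.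
Qed.

Lemma eq_egs c d x : (forall i, c i = d i) -> egs c x = egs d x.
Proof. by move=> cd; congr egs; apply/funext. Qed.

Lemma egsD c d x : geom_bounded c -> geom_bounded d ->
  egs (fun i => c i + d i) x = egs c x + egs d x.
Proof.
move=> hc hd; rewrite /egs /pseries -lim_seriesD; try exact: cvg_egs.
congr (limn (series _)); apply/funext => i; rewrite -[RHS]/(_ + _).
by rewrite -mulrDl -mulrDl.
Qed.

Lemma egsZ k c x : geom_bounded c -> egs (fun i => k * c i) x = k * egs c x.
Proof.
move=> hc; rewrite /egs /pseries -[RHS]lim_seriesZ; last exact: cvg_egs.
congr (limn (series _)); apply/funext => i.
by rewrite -[RHS]/(k * _) !mulrA.
Qed.

Lemma egsN c x : geom_bounded c -> egs (fun i => - c i) x = - egs c x.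
Proof.
move=> hc; rewrite -[RHS]mulN1r -egsZ//; apply: eq_egs => i.
by rewrite mulN1r.
Qed.

Lemma egsB c d x : geom_bounded c -> geom_bounded d ->
  egs (fun i => c i - d i) x = egs c x - egs d x.
Proof. by move=> hc hd; rewrite egsD ?egsN//; exact: geom_boundedN. Qed.

Lemma egs_muln c x : geom_bounded c ->
  egs (fun i => i%:R * c i) x = x * egs (fun i => c i.+1) x.
Proof.
move=> hc; rewrite /egs.
set u := fun i => _ : R; set v := fun i => _ : R.
have cv : cvgn (pseries v x) by apply: cvg_egs; exact: geom_boundedS.
apply/cvg_lim => //; rewrite -cvg_shiftS.
rewrite (_ : [sequence _]_n = (fun n => x * pseries v x n)).
  by apply: cvgM; [exact: cvg_cst | exact: cv].
apply/funext => n /=.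
rewrite /pseries /series /= big_nat_recl//= {1}/u !mul0r add0r.
rewrite mulr_sumr; apply: eq_bigr => i _.
have := congr1 (@^~ i) (egs_diffs c); rewrite /pseries_diffs /u /v => <-.
by rewrite exprS; ring.
Qed.

Lemma egs0 c : egs c 0 = c 0%N.
Proof.
apply/cvg_lim => //; rewrite -cvg_shiftS /=.
rewrite (_ : (fun n => _) = cst (c 0%N)); first exact: cvg_cst.
apply/funext => n; rewrite /pseries /series/= big_nat_recl//= big1.
  by rewrite addr0 expr0 mulr1 fact0 divr1.
by move=> i _; rewrite expr0n mulr0.
Qed.

Lemma egs_pow b x : egs (fun i => b ^+ i) x = expR (b * x).
Proof.
rewrite /egs expRE; congr (limn _); apply/funext => n.
by apply: eq_bigr => i _ /=; rewrite exprMn; ring.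
Qed.

Lemma egs_cst1 x : egs (fun=> 1) x = expR x.
Proof.
by rewrite -[in RHS](mul1r x) -egs_pow; apply: eq_egs => i; rewrite expr1n.
Qed.

(** E c(N) for a Poisson variable N with mean x. *)
Definition pois_mean c x : R := expR (- 1 * x) * egs c x.

(** Differentiating a Poisson mean replaces c by its forward difference.  With
pois_mean_muln, recurrences on c become differential equations in x. *)
Lemma der_pois_mean c x : geom_bounded c ->
  is_derive x 1 (pois_mean c) (pois_mean (fun i => c i.+1 - c i) x).
Proof.
move=> hc; apply: (derE (derM (der_exp (-1) x) (der_egs x hc))).
by rewrite /pois_mean egsB//; [ring | exact: geom_boundedS].
Qed.

Lemma eq_pois_mean c d x : (forall i, c i = d i) -> pois_mean c x = pois_mean d x.
Proof. by move=> cd; rewrite /pois_mean (eq_egs _ cd). Qed.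

Lemma pois_meanD c d x : geom_bounded c -> geom_bounded d ->
  pois_mean (fun i => c i + d i) x = pois_mean c x + pois_mean d x.
Proof. by move=> hc hd; rewrite /pois_mean egsD// mulrDr. Qed.

Lemma pois_meanB c d x : geom_bounded c -> geom_bounded d ->
  pois_mean (fun i => c i - d i) x = pois_mean c x - pois_mean d x.
Proof. by move=> hc hd; rewrite /pois_mean egsB// mulrBr. Qed.

Lemma pois_meanN c x : geom_bounded c ->
  pois_mean (fun i => - c i) x = - pois_mean c x.
Proof. by move=> hc; rewrite /pois_mean egsN// mulrN. Qed.

Lemma pois_meanZ k c x : geom_bounded c ->
  pois_mean (fun i => k * c i) x = k * pois_mean c x.
Proof. by move=> hc; rewrite /pois_mean egsZ// mulrCA. Qed.

Lemma pois_mean_muln c x : geom_bounded c ->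
  pois_mean (fun i => i%:R * c i) x = x * pois_mean (fun i => c i.+1) x.
Proof. by move=> hc; rewrite /pois_mean egs_muln// mulrCA. Qed.

Lemma pois_mean0 c : pois_mean c 0 = c 0%N.
Proof. by rewrite /pois_mean egs0 mulr0 expR0 mul1r. Qed.

Lemma pois_mean_pow b x : pois_mean (fun i => b ^+ i) x = expR ((b - 1) * x).
Proof. by rewrite /pois_mean egs_pow -expRD; congr expR; ring. Qed.

Lemma pois_mean_nat x : pois_mean (fun i => i%:R) x = x.
Proof.
rewrite (@eq_pois_mean _ (fun i => i%:R * 1)); last by move=> i; rewrite mulr1.
rewrite pois_mean_muln; last exact: geom_bounded_cst.
by rewrite /pois_mean egs_cst1 -expRD mulN1r addNr expR0 mulr1.
Qed.

End ExponentialSeries.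

(** * Poisson means of truncated Laplace transforms *)

Section LaguerrePoisson.
Variable R : realType.
Implicit Types (c : nat -> R) (u k x y m : R).

Notation L := (laguerre R).

Lemma geom_bounded_rec a c (f : nat -> R) : geom_bounded f ->
  (forall i, c i.+1 = a * c i + f i) -> geom_bounded c.
Proof.
move=> [A [B [A0 B0 fAB]]] crec.
exists (`|c 0%N| + A), (`|a| + 1 + B); split; rewrite ?addr_ge0// => i.
have D0 : 0 <= `|c 0%N| + A by rewrite addr_ge0.
elim: i => [|i IH]; first by rewrite expr0 mulr1 lerDl.
have E0 : 0 <= `|a| + 1 + B by rewrite !addr_ge0.
rewrite crec (le_trans (ler_normD _ _))// normrM.
apply: (@le_trans _ _ ((`|a| + 1) * ((`|c 0%N| + A) * (`|a| + 1 + B) ^+ i))).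
  rewrite mulrDl mul1r lerD ?ler_wpM2l// (le_trans (fAB i))//.
  rewrite ler_pM ?exprn_ge0 ?lerDr//.
  by rewrite lerXn2r// ?nnegrE// lerDr addr_ge0.
by rewrite exprS !mulrA ler_wpM2r ?exprn_ge0// mulrC ler_wpM2l// lerDl.
Qed.

Definition lag0 k i := (L i).[k].
Definition lag1 k i := (L i)^`().[k].
Definition lag2 k i := (L i)^`()^`().[k].

Lemma lag1S k i : lag1 k i.+1 = lag1 k i - lag0 k i.
Proof. by rewrite /lag1 deriv_laguerreS hornerD hornerN. Qed.

Lemma lag2S k i : lag2 k i.+1 = lag2 k i - lag1 k i.
Proof. by rewrite /lag2 deriv_laguerreS derivB hornerD hornerN. Qed.

Lemma geom_bounded_lag0 k : geom_bounded (lag0 k).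
Proof.
exists 1, (1 + `|k|); split; rewrite ?addr_ge0// => i; rewrite mul1r.
rewrite /lag0 horner_poly (le_trans (ler_norm_sum _ _ _))// exprDn.
apply: ler_sum => j _; rewrite expr1n mul1r -[leRHS]mulr_natl !normrM !normrX.
rewrite normrN1 expr1n mul1r ler_wpM2r ?exprn_ge0// ger0_norm// normfV.
by rewrite ler_piMr// invf_le1 ?normr_gt0 ?factS_neq0// ger0_norm// ler1n fact_gt0.
Qed.

Lemma geom_bounded_lag1 k : geom_bounded (lag1 k).
Proof.
apply: (@geom_bounded_rec 1 _ (fun i => - lag0 k i)).
  by apply: geom_boundedN; exact: geom_bounded_lag0.
by move=> i; rewrite lag1S mul1r.
Qed.

Lemma geom_bounded_lag2 k : geom_bounded (lag2 k).
Proof.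
apply: (@geom_bounded_rec 1 _ (fun i => - lag1 k i)).
  by apply: geom_boundedN; exact: geom_bounded_lag1.
by move=> i; rewrite lag2S mul1r.
Qed.

Let P0 k x := pois_mean (lag0 k) x.
Let P1 k x := pois_mean (lag1 k) x.
Let P2 k x := pois_mean (lag2 k) x.

Lemma der_P2 k x : is_derive x 1 (P2 k) (- P1 k x).
Proof.
apply: (derE (der_pois_mean x (geom_bounded_lag2 k))).
rewrite -pois_meanN; last exact: geom_bounded_lag1.
by apply: eq_pois_mean => i; rewrite lag2S addrAC subrr add0r.
Qed.

Lemma der_P1 k x : is_derive x 1 (P1 k) (- P0 k x).
Proof.
apply: (derE (der_pois_mean x (geom_bounded_lag1 k))).
rewrite -pois_meanN; last exact: geom_bounded_lag0.
by apply: eq_pois_mean => i; rewrite lag1S addrAC subrr add0r.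
Qed.

(** The relation laguerre_pred between L_i'', L_i' and L_(i-1), taken in Poisson
mean. *)
Lemma P_ode k x : k * P2 k x + P1 k x = - (x * P0 k x).
Proof.
have g2 := geom_bounded_lag2 k; have g1 := geom_bounded_lag1 k.
have g0 := geom_bounded_lag0 k.
rewrite /P2 -pois_meanZ// -pois_meanD//; last exact: geom_boundedZ.
rewrite (_ : P0 k x = pois_mean (fun i => lag0 k i.+1.-1) x)//.
rewrite -(@pois_mean_muln _ (fun i => lag0 k i.-1)); last exact: geom_bounded_pred.
rewrite -pois_meanN; last exact/geom_bounded_muln/geom_bounded_pred.
apply: eq_pois_mean => i; have := congr1 (horner^~ k) (laguerre_pred R i).
by rewrite /= hornerD hornerM hornerX hornerN hornerZ.
Qed.

Lemma P1_0 k : P1 k 0 = 0.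
Proof. by rewrite /P1 pois_mean0 /lag1 laguerre0 derivC horner0. Qed.

Lemma P2_0 k : P2 k 0 = 0.
Proof. by rewrite /P2 pois_mean0 /lag2 laguerre0 !derivC horner0. Qed.

Lemma P0_0 k : P0 k 0 = 1.
Proof. by rewrite /P0 pois_mean0 /lag0 laguerre0 hornerC. Qed.

(** An energy for the equation x y'' - y' + k y = 0 solved by P2: the combination
of squares for which M / x^2 has a derivative of constant sign. *)
Let M k x := k ^+ 2 * (P2 k x * P2 k x) + k * x * (P1 k x * P1 k x)
  + k * (P2 k x * P1 k x) + 2^-1 * (P1 k x * P1 k x).

Lemma der_M k x : is_derive x 1 (M k)
  (- 2 * k ^+ 2 * P2 k x * P1 k x + k * P1 k x ^+ 2 - 2 * k * x * P1 k x * P0 k x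
   - k * P1 k x ^+ 2 - k * P2 k x * P0 k x - P1 k x * P0 k x).
Proof.
have d2 := der_P2 k x; have d1 := der_P1 k x.
have h1 := derZ (k ^+ 2) (derM d2 d2).
have h2 := derM (derZ k (der_id x)) (derM d1 d1).
have h3 := derZ k (derM d2 d1).
have h4 := derZ (2^-1) (derM d1 d1).
by apply: (derE (derD (derD (derD h1 h2) h3) h4)); field.
Qed.

Lemma der_Mx2 k x : 0 < x -> is_derive x 1 (fun y => M k y * (y * y)^-1)
  (- (k ^+ 2 * P2 k x ^+ 2) / x ^+ 3).
Proof.
move=> x0.
have d := derM (der_id x) (der_id x).
have dV : is_derive x 1 (fun y : R => (y * y)^-1) (- 2 / x ^+ 3).
  have xx : x * x != 0 by rewrite mulf_neq0 ?gt_eqF.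
  have dV := @is_deriveV _ (fun y : R => y * y) x _ 1 xx d.
  apply: (derE dV); rewrite /GRing.scale /=.
  by field; rewrite gt_eqF.
apply: (derE (derM (der_M k x) dV)).
have e : P0 k x = - (k * P2 k x + P1 k x) / x.
  by rewrite P_ode opprK mulrC mulKf ?gt_eqF.
by rewrite e /M; field; rewrite gt_eqF.
Qed.

Lemma cvg_div_at0 (f : R -> R) (df : R) : is_derive (0 : R) 1 f df -> f 0 = 0 ->
  f y / y @[y --> (0:R)^'+] --> df.
Proof.
move=> [dfx <-] f0; apply: cvg_dnbhs_at_right.
have : (fun h => h^-1 *: ((f \o shift 0) (h *: 1) - f 0)) @ 0^' --> 'D_1 f 0
  by exact: dfx.
apply: cvg_trans; apply: near_eq_cvg; apply: nearW => y /=.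
by rewrite f0 subr0 addr0 /GRing.scale /= mulr1 mulrC.
Qed.

(** M / x^2 is nonincreasing and tends to 1/2 at 0, so M <= x^2 / 2, whereas
M - k^2 P2^2 / 2 is a sum of nonnegative terms. *)
Lemma pois_lag2_bound k x : 0 < k -> 0 <= x -> `|P2 k x| <= x / k.
Proof.
move=> k0; rewrite le_eqVlt => /predU1P[<-|x0].
  by rewrite P2_0 normr0 mul0r.
have MQ y : 0 < y <= x -> M k x * (x * x)^-1 <= M k y * (y * y)^-1.
  move=> /andP[y0 yx]; rewrite -lerN2.
  have d z : y <= z <= x -> is_derive z 1 (fun y => - (M k y * (y * y)^-1))
      (- (- (k ^+ 2 * P2 k z ^+ 2) / z ^+ 3)).
    by move=> /andP[yz _]; apply/derN/der_Mx2/(lt_le_trans y0).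
  apply: (derivative_ge0_le yx d) => z /andP[yz _].
  have z0 := lt_le_trans y0 yz.
  by rewrite mulNr opprK divr_ge0 ?exprn_ge0 ?(ltW z0)// mulr_ge0 ?sqr_ge0.
have lim : M k y * (y * y)^-1 @[y --> (0:R)^'+] --> (2^-1 : R).
  have h1 := cvg_div_at0 (der_P1 k 0) (P1_0 k); rewrite P0_0 in h1.
  have h2 := cvg_div_at0 (der_P2 k 0) (P2_0 k); rewrite P1_0 oppr0 in h2.
  have hid : (y : R) @[y --> (0:R)^'+] --> (0 : R).
    exact: (@cvg_at_right_filter _ _ (fun y : R => y) 0 0 cvg_id).
  pose g1 y := P1 k y / y; pose g2 y := P2 k y / y.
  have : k ^+ 2 * (g2 y * g2 y) + k * y * (g1 y * g1 y) + k * (g2 y * g1 y)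
      + 2^-1 * (g1 y * g1 y) @[y --> (0:R)^'+] -->
      k ^+ 2 * (0 * 0) + k * 0 * (- 1 * - 1) + k * (0 * - 1) + 2^-1 * (- 1 * - 1).
    apply: cvgD; first apply: cvgD; first apply: cvgD.
    - by apply: cvgM; [exact: cvg_cst | exact: cvgM].
    - apply: cvgM; last exact: cvgM.
      by apply: cvgM; [exact: cvg_cst | exact: hid].
    - by apply: cvgM; [exact: cvg_cst | exact: cvgM].
    - by apply: cvgM; [exact: cvg_cst | exact: cvgM].
  rewrite (_ : k ^+ 2 * _ + _ + _ + _ = 2^-1); last by ring.
  apply: cvg_trans; apply: near_eq_cvg; near=> y.
  have y0 : y != 0 by rewrite gt_eqF//; near: y; exact: nbhs_right_gt.
  by rewrite /g1 /g2 /M; field.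
have h : M k x * (x * x)^-1 <= 2^-1.
  apply: (cvgr_to_ge lim); near=> y; apply: MQ; apply/andP; split.
    by near: y; exact: nbhs_right_gt.
  by near: y; exact: nbhs_right_le.
have xx : 0 < x * x by rewrite mulr_gt0.
rewrite ler_pdivrMr// in h.
rewrite ler_pdivlMr// -(@ler_pXn2r _ 2)// ?nnegrE ?mulr_ge0 ?(ltW k0) ?(ltW x0)//.
rewrite exprMn real_normK ?num_real//.
have : 0 <= (k * P2 k x + P1 k x) ^+ 2 by exact: sqr_ge0.
have : 0 <= k * x * (P1 k x * P1 k x).
  by rewrite -(expr2 (P1 k x)) mulr_ge0 ?sqr_ge0// mulr_ge0// ltW.
move: h; rewrite /M !expr2 => h h1 h2.
have -> : P2 k x * P2 k x * (k * k) = k * k * (P2 k x * P2 k x) by ring.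
nra.
Unshelve. all: by end_near. Qed.

(** A solution of u f' + f = g inherits the bound m y on g: otherwise
e^(y/u) (m y - f) would have to decrease. *)
Lemma relax_bound (f df : R -> R) u m x : 0 < u -> 0 <= m -> f 0 = 0 ->
  (forall y, is_derive y 1 f (df y)) ->
  (forall y, 0 <= y -> `|u * df y + f y| <= m * y) -> 0 <= x ->
  `|f x| <= m * x.
Proof.
move=> u0 m0.
have one (g dg : R -> R) : g 0 = 0 -> (forall y, is_derive y 1 g (dg y)) ->
    (forall y, 0 <= y -> u * dg y + g y <= m * y) -> 0 <= x -> g x <= m * x.
  move=> g0 hg hm x0.
  have d y : is_derive y 1 (fun y => expR (u^-1 * y) * (m * y - g y))
      (u^-1 * expR (u^-1 * y) * (m * y - g y) + expR (u^-1 * y) * (m * 1 - dg y)).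
    exact: (derM (der_exp u^-1 y) (derB (derZ m (der_id y)) (hg y))).
  have := @derivative_ge0_le _ _ _ 0 x x0 (fun y _ => d y).
  rewrite g0 !mulr0 subr0 mulr0 => H.
  have {H} : 0 <= expR (u^-1 * x) * (m * x - g x).
    apply: H => y /andP[y0 _].
    have -> : u^-1 * expR (u^-1 * y) * (m * y - g y) + expR (u^-1 * y) * (m * 1 - dg y) =
       expR (u^-1 * y) / u * ((m * y - (u * dg y + g y)) + u * m).
      by field; rewrite gt_eqF.
    rewrite mulr_ge0// ?divr_ge0 ?expR_ge0 ?(ltW u0)//.
    by rewrite addr_ge0 ?mulr_ge0 ?(ltW u0)// subr_ge0 hm.
  by rewrite pmulr_rge0 ?expR_gt0// subr_ge0.
move=> f0 hf hm x0; rewrite ler_norml; apply/andP; split.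
  rewrite lerNl; apply: (one (fun y => - f y) (fun y => - df y)) => //.
  - by rewrite f0 oppr0.
  - move=> y y0; rewrite mulrN -opprD (le_trans (ler_norm _))// normrN.
    exact: hm.
apply: (one f df) => // y y0.
exact: le_trans (ler_norm _) (hm y y0).
Qed.

(** The Laplace transform of L_i'' at u, truncated at k. *)
Definition laplag2 k u i := itg 0 k (fun s => expR (- u * s) * lag2 s i).

Lemma laplag2_0 k u : laplag2 k u 0 = 0.
Proof.
rewrite /laplag2 (_ : (fun _ => _) = (fun=> 0)).
  by rewrite /itg Rintegral_cst ?mul0r.
by apply/funext => s; rewrite /lag2 laguerre0 !derivC horner0 mulr0.
Qed.

Lemma lag1_at0 i : lag1 0 i = - i%:R.
Proof.
elim: i => [|i IH]; first by rewrite /lag1 laguerre0 derivC horner0 oppr0.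
rewrite lag1S IH /lag0 horner_coef0 coef_laguerre fact0 expr0 bin0.
by rewrite mul1r divr1 -[i.+1]addn1 natrD opprD.
Qed.

Lemma continuous_expM u (p : {poly R}) :
  continuous (fun s => expR (- u * s) * p.[s]).
Proof.
move=> s; apply: cvgM; last exact: continuous_horner.
exact: continuous_expc.
Qed.

(** An integration by parts, followed by the recurrence lag2S. *)
Lemma laplag2_rec k u i : 0 <= k ->
  u * (laplag2 k u i.+1 - laplag2 k u i) + laplag2 k u i =
  expR (- u * k) * lag1 k i + i%:R.
Proof.
move=> k0.
have e1 : laplag2 k u i.+1 - laplag2 k u i =
    - itg 0 k (fun s => expR (- u * s) * lag1 s i).
  rewrite /laplag2 -itgB; try exact: continuous_expM.
  rewrite -[RHS]mulN1r -itgZ; last exact: continuous_expM.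
  by congr itg; apply/funext => s; rewrite lag2S; ring.
have e2 : laplag2 k u i = expR (- u * k) * lag1 k i + i%:R
     + u * itg 0 k (fun s => expR (- u * s) * lag1 s i).
  have d1 (s : R) : is_derive s 1 (fun s => expR (- u * s)) (- u * expR (- u * s)).
    exact: der_exp.
  have d2 (s : R) : is_derive s 1 (fun s => lag1 s i) (lag2 s i).
    exact: is_derive_poly.
  have c1 : continuous (fun s => - u * expR (- u * s)).
    by move=> s; apply: cvgM; [exact: cvg_cst | exact: continuous_expc].
  have c2 : continuous (fun s => lag2 s i) by exact: continuous_horner.
  rewrite /laplag2 (itg_parts k0 d1 d2 c1 c2).
  rewrite lag1_at0 mulr0 expR0 mul1r opprK.
  have -> : (fun s => - u * expR (- u * s) * lag1 s i) =
     (fun s => - u * (expR (- u * s) * lag1 s i)).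
    by apply/funext => s; rewrite mulrA.
  rewrite itgZ; last exact: continuous_expM.
  by rewrite [X in _ - X = _]mulNr opprK.
by rewrite e1 e2; ring.
Qed.

Lemma geom_bounded_laplag2 k u : 0 <= k -> 0 < u -> geom_bounded (laplag2 k u).
Proof.
move=> k0 u0.
apply: (@geom_bounded_rec (1 - u^-1) _
  (fun i => u^-1 * (expR (- u * k) * lag1 k i + i%:R))).
  apply: geom_boundedZ; apply: geom_boundedD.
    by apply: geom_boundedZ; exact: geom_bounded_lag1.
  exists 1, 2; split => // i; rewrite mul1r ger0_norm// -natrX ler_nat.
  exact: ltnW (ltn_expl _ _).
move=> i; have := laplag2_rec u i k0.
move: (laplag2 k u i.+1) (laplag2 k u i) => c1 c0 <-.
by field; rewrite gt_eqF.
Qed.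

(** By laplag2_rec the Poisson mean q solves u q' + q = x + e^(-uk) P1.  The
function x - u + u e^(-x/u) solves it without the last term.  After scaling by
e^(uk), adding P2 / u to the difference leaves a relaxation equation with
right-hand side P2 / u, which pois_lag2_bound controls. *)
Lemma pois_laplag2 k u x : 0 < k -> 0 < u -> 0 <= x ->
  `|pois_mean (laplag2 k u) x - (x - u + u * expR (- u^-1 * x))|
    <= 2 * (x / (u * k)) * expR (- u * k).
Proof.
move=> k0 u0 x0.
have gc := geom_bounded_laplag2 (ltW k0) u0.
have rec i := laplag2_rec u i (ltW k0).
have c0 := laplag2_0 k u.
move: (laplag2 k u) gc rec c0 => c gc rec c0.
pose q := pois_mean c.
pose q' := pois_mean (fun i => c i.+1 - c i).
have gn : geom_bounded (fun i => i%:R : R).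
  exists 1, 2; split => // i; rewrite mul1r ger0_norm// -natrX ler_nat.
  exact: ltnW (ltn_expl _ _).
have gd : geom_bounded (fun i => c i.+1 - c i).
  exact: (geom_boundedB (geom_boundedS gc) gc).
have qode y : u * q' y + q y = expR (- u * k) * P1 k y + y.
  rewrite -(pois_meanZ _ _ gd) -(pois_meanD _ (geom_boundedZ u gd) gc).
  rewrite (eq_pois_mean _ rec) (pois_meanD _ _ gn); last first.
    exact: (geom_boundedZ _ (geom_bounded_lag1 k)).
  by rewrite pois_mean_nat (pois_meanZ _ _ (geom_bounded_lag1 k)).
pose E := expR (u * k).
have EE : expR (- u * k) * E = 1 by rewrite /E -expRD mulNr addNr expR0.
pose b y := E * (q y - (y - u + u * expR (- u^-1 * y))) + u^-1 * P2 k y.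
pose b' y := E * (q' y - (1 - 0 + u * (- u^-1 * expR (- u^-1 * y))))
   + u^-1 * (- P1 k y).
have db y : is_derive y 1 b (b' y).
  exact: (derD (derZ E (derB (der_pois_mean y gc) (derD (derB (der_id y) (der_cst u y))
    (derZ u (der_exp (- u^-1) y))))) (derZ u^-1 (der_P2 k y))).
have b0 : b 0 = 0.
  by rewrite /b /q pois_mean0 c0 P2_0 mulr0 expR0; ring.
have bode y : u * b' y + b y = u^-1 * P2 k y.
  have -> : u * b' y + b y =
     E * (u * q' y + q y - y) - P1 k y + u^-1 * P2 k y.
    by rewrite /b /b'; field; rewrite gt_eqF.
  by rewrite qode addrK mulrA (mulrC E) EE mul1r subrr add0r.
have hb y : 0 <= y -> `|u * b' y + b y| <= (u * k)^-1 * y.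
  move=> y0; rewrite bode normrM gtr0_norm ?invr_gt0//.
  rewrite invfM -mulrA ler_pM2l ?invr_gt0// mulrC.
  exact: pois_lag2_bound.
have m0 : 0 <= (u * k)^-1 by rewrite invr_ge0 mulr_ge0// ltW.
have h1 := relax_bound u0 m0 b0 db hb x0.
have h2 := pois_lag2_bound k0 x0.
have -> : q x - (x - u + u * expR (- u^-1 * x)) =
    (b x - u^-1 * P2 k x) * expR (- u * k).
  by rewrite /b addrK mulrAC (mulrC E) EE mul1r.
rewrite normrM [X in _ * X]ger0_norm ?expR_ge0// ler_wpM2r ?expR_ge0//.
rewrite (le_trans (ler_normB _ _))// normrM gtr0_norm ?invr_gt0//.
have : u^-1 * `|P2 k x| <= u^-1 * (x / k) by rewrite ler_pM2l ?invr_gt0.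
have -> : u^-1 * (x / k) = (u * k)^-1 * x by field; rewrite !gt_eqF.
have -> : x / (u * k) = (u * k)^-1 * x by rewrite mulrC.
lra.
Qed.

End LaguerrePoisson.

(** * The smoothed coefficients and their bias *)

Section Coefficients.
Variable R : realType.
Variables (r k : R).
Implicit Types (x s : R) (i : nat).
Hypotheses (r1 : 1 <= r) (k1 : 1 <= k).

Let u0 : R := (1 + r)^-1.
Let k0 : 0 < k. Proof. exact: lt_le_trans ltr01 k1. Qed.
Let r0 : 0 < r. Proof. exact: lt_le_trans ltr01 r1. Qed.
Let rp : 0 < 1 + r. Proof. by rewrite addr_gt0. Qed.
Let u0p : 0 < u0. Proof. by rewrite invr_gt0. Qed.
Let u01 : u0 <= 2^-1.
Proof. by rewrite lef_pV2 ?posrE//; move: r1; lra. Qed.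

(** The weights make profile s = O(s^2) at 0 and make the affine parts of the
Poisson means in pois_laplag2 cancel. *)
Definition profile s : R :=
  (1 + r) * expR (- (1 + r)^-1 * s) - (1 + 2 * r) * expR (- 1 * s) + r * expR (- 2 * s).

(** The factor for which ramp meets profile at k; ramp vanishes at k + 1. *)
Definition ramp_height : R := profile k / (1 - expR (- 1)).

Definition ramp s : R :=
  ramp_height * expR (2 * k) * expR (- 2 * s)
  - ramp_height * expR (k - 1) * expR (- 1 * s).

(** The integral over [0, k + 1] of L_i'' against profile up to k and ramp after k,
written with truncated Laplace transforms. *)
Definition tail i : R :=
  ((1 + r) * laplag2 k (1 + r)^-1 i - (1 + 2 * r) * laplag2 k 1 i + r * laplag2 k 2 i)
  + (ramp_height * expR (2 * k) * (laplag2 (k + 1) 2 i - laplag2 k 2 i)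
     - ramp_height * expR (k - 1) * (laplag2 (k + 1) 1 i - laplag2 k 1 i)).

(** Without truncation, tail has Poisson mean
e^-(1+r)x - (1 + 2r) e^-x + 2r e^(-x/2), so the first two terms complete it to
the mean e^-x - e^-(1+r)x. *)
Definition smoothed i : R := 2 * r * (2^-1) ^+ i - 2 * r * 0 ^+ i - tail i.

Lemma tail0 : tail 0 = 0.
Proof. by rewrite /tail !laplag2_0; ring. Qed.

Lemma smoothed0 : smoothed 0 = 0.
Proof. by rewrite /smoothed tail0 !expr0; ring. Qed.

Lemma geom_bounded_tail : geom_bounded tail.
Proof.
have g1 := @geom_bounded_laplag2 R _ _ (ltW k0) (ltr01 : 0 < 1).
have g2 := @geom_bounded_laplag2 R _ _ (ltW k0) (ltr0Sn R 1).
have gu := @geom_bounded_laplag2 R _ _ (ltW k0) u0p.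
have k10 : 0 <= k + 1 by rewrite addr_ge0// ltW.
have g1' := @geom_bounded_laplag2 R _ _ k10 (ltr01 : 0 < 1).
have g2' := @geom_bounded_laplag2 R _ _ k10 (ltr0Sn R 1).
exact: (geom_boundedD (geom_boundedD (geom_boundedB (geom_boundedZ _ gu) (geom_boundedZ _ g1))
   (geom_boundedZ _ g2)) (geom_boundedB (geom_boundedZ _ (geom_boundedB g2' g2)) (geom_boundedZ _ (geom_boundedB g1' g1)))).
Qed.

Lemma geom_bounded_smoothed : geom_bounded smoothed.
Proof.
exact: (geom_boundedB (geom_boundedB (geom_boundedZ _ (geom_bounded_pow _))
  (geom_boundedZ _ (geom_bounded_pow _))) geom_bounded_tail).
Qed.

Lemma expR_N1_le : expR (- 1) <= 2^-1 :> R.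
Proof.
rewrite expRN lef_pV2 ?posrE ?expR_gt0//.
by have := @expR_ge1Dx R 1; lra.
Qed.

Lemma exp_decay_le a b s : a <= b -> 0 <= s -> expR (- b * s) <= expR (- a * s).
Proof. by move=> ab s0; rewrite ler_expR !mulNr lerN2 ler_wpM2r. Qed.

Lemma profile_le s : 0 <= s -> `|profile s| <= (1 + r) * expR (- (1 + r)^-1 * s).
Proof.
move=> s0; rewrite /profile.
have h1 : expR (- 1 * s) <= expR (- (1 + r)^-1 * s).
  by apply: exp_decay_le => //; apply: le_trans u01 _; lra.
have h2 : expR (- 2 * s) <= expR (- 1 * s) by apply: exp_decay_le => //; lra.
have h3 := expR_ge0 (- 2 * s).
move: r1 h1 h2 h3; move: (expR (- (1 + r)^-1 * s)) (expR (- 1 * s)) (expR (- 2 * s)).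
move=> a b c r1' h1 h2 h3; rewrite ler_norml; apply/andP; split; nra.
Qed.

Lemma ramp_height_le : `|ramp_height| <= 2 * ((1 + r) * expR (- (1 + r)^-1 * k)).
Proof.
have e1 := expR_N1_le.
have e0 : 0 < 1 - expR (- 1) :> R by lra.
rewrite /ramp_height normrM normfV (gtr0_norm e0) ler_pdivrMr//.
have := profile_le (ltW k0).
have : 0 <= (1 + r) * expR (- (1 + r)^-1 * k) by rewrite mulr_ge0 ?expR_ge0// ltW.
move: (_ * expR _) => A; nra.
Qed.

Let exact_part u x := x - u + u * expR (- u^-1 * x).

Lemma pois_laplag2_le v u x : k <= v -> 0 < u -> 0 <= x ->
  `|pois_mean (laplag2 v u) x - exact_part u x| <= 2 * (x / (u * k)) * expR (- u * k).
Proof.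
move=> kv up x0; have v0 := lt_le_trans k0 kv.
apply: (le_trans (pois_laplag2 v0 up x0)).
have uv : 0 <= x / (u * v) by rewrite divr_ge0// mulr_ge0// ltW.
have uv2 : 0 <= 2 * (x / (u * v)) by rewrite mulr_ge0.
rewrite ler_pM ?expR_ge0//.
  by rewrite ler_pM2l// ler_wpM2l// lef_pV2 ?posrE ?mulr_gt0// ler_pM2l.
by rewrite ler_expR !mulNr lerN2 ler_pM2l.
Qed.

(** The seven truncation errors, each a multiple of x (1+r)^2 e^(-k/(1+r)) / k, add up
once the exact parts have cancelled.  The transforms are kept abstract. *)
Let bias_algebra x eu e1 e2 pu p1 p2 p2' p1' : 0 <= x ->
  eu = x - u0 + u0 * expR (- (1 + r) * x) ->
  e1 = x - 1 + expR (- 1 * x) ->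
  e2 = x - 2 + 2 * expR (- 2^-1 * x) ->
  `|pu - eu| <= 2 * (x / (u0 * k)) * expR (- u0 * k) ->
  `|p1 - e1| <= 2 * (x / (1 * k)) * expR (- 1 * k) ->
  `|p2 - e2| <= 2 * (x / (2 * k)) * expR (- 2 * k) ->
  `|p2' - e2| <= 2 * (x / (2 * k)) * expR (- 2 * k) ->
  `|p1' - e1| <= 2 * (x / (1 * k)) * expR (- 1 * k) ->
  `|expR (-1 * x) - expR (- (1 + r) * x) -
     (2 * r * expR (- 2^-1 * x) - 2 * r * expR (-1 * x) -
      ((1 + r) * pu - (1 + 2 * r) * p1 + r * p2 +
       (ramp_height * expR (2 * k) * (p2' - p2) -
        ramp_height * expR (k - 1) * (p1' - p1))))|
  <= 10 * x * ((1 + r) ^+ 2 / k * expR (- (1 + r)^-1 * k)).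
Proof.
move=> x0 eue e1e e2e.
have -> : expR (-1 * x) - expR (- (1 + r) * x) -
     (2 * r * expR (- 2^-1 * x) - 2 * r * expR (-1 * x) -
      ((1 + r) * pu - (1 + 2 * r) * p1 + r * p2 +
       (ramp_height * expR (2 * k) * (p2' - p2) -
        ramp_height * expR (k - 1) * (p1' - p1))))
  = (1 + r) * (pu - eu) - (1 + 2 * r) * (p1 - e1) + r * (p2 - e2)
    + ramp_height * expR (2 * k) * (p2' - e2)
    - ramp_height * expR (2 * k) * (p2 - e2)
    - ramp_height * expR (k - 1) * (p1' - e1)
    + ramp_height * expR (k - 1) * (p1 - e1).
  rewrite eue e1e e2e /u0.
  move: (expR (-1 * x)) (expR (- (1 + r) * x)) (expR (- 2^-1 * x)) => y1 y2 y3.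
  by field; rewrite gt_eqF.
move: (pu - _) (p1 - _) (p2 - _) (p2' - _) (p1' - _) => du d1 d2 d2' d1' bu b1 b2 b2' b1'.
pose Y := x / k.
have Y0 : 0 <= Y by rewrite divr_ge0// ltW.
pose E := expR (- (1 + r)^-1 * k).
have E0 : 0 <= E by rewrite expR_ge0.
have E1 : expR (- 1 * k) <= E.
  by apply: exp_decay_le (ltW k0); apply: le_trans u01 _; lra.
have E2 : expR (- 2 * k) <= E.
  by apply: le_trans E1; apply: exp_decay_le (ltW k0); lra.
have hh := ramp_height_le; rewrite -/E in hh.
have nb (a d c : R) : `|d| <= c -> `|a * d| <= `|a| * c.
  by move=> dc; rewrite normrM ler_wpM2l.
have H1 : `|(1 + r) * du| <= 2 * (1 + r) ^+ 2 * Y * E.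
  apply: (le_trans (nb _ _ _ bu)); rewrite (gtr0_norm rp) /u0 -/E /Y.
  by apply: le_of_eq; field; rewrite !gt_eqF.
have H2 : `|(1 + 2 * r) * d1| <= 2 * (1 + 2 * r) * Y * E.
  apply: (le_trans (nb _ _ _ b1)); rewrite mul1r -/Y ger0_norm; last by move: r0; lra.
  rewrite (_ : 2 * (1 + 2 * r) * Y * E = (1 + 2 * r) * (2 * Y * E)); last by ring.
  rewrite ler_wpM2l//; first by move: r0; lra.
  by rewrite ler_wpM2l// mulr_ge0.
have H3 : `|r * d2| <= r * Y * E.
  apply: (le_trans (nb _ _ _ b2)); rewrite (gtr0_norm r0).
  rewrite (_ : 2 * (x / (2 * k)) = Y); last by rewrite /Y; field; rewrite gt_eqF.
  by rewrite -mulrA ler_pM2l// ler_wpM2l.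
have Hr2 d : `|d| <= 2 * (x / (2 * k)) * expR (- 2 * k) ->
    `|ramp_height * expR (2 * k) * d| <= 2 * (1 + r) * Y * E.
  move=> bd; apply: (le_trans (nb _ _ _ bd)); rewrite normrM (ger0_norm (expR_ge0 _)).
  have -> : `|ramp_height| * expR (2 * k) * (2 * (x / (2 * k)) * expR (- 2 * k)) =
     `|ramp_height| * Y * (expR (2 * k) * expR (- 2 * k)).
    by rewrite /Y; field; rewrite gt_eqF.
  rewrite -expRD mulNr subrr expR0 mulr1.
  rewrite (_ : 2 * (1 + r) * Y * E = 2 * ((1 + r) * E) * Y); last by ring.
  by rewrite ler_wpM2r.
have Hr1 d : `|d| <= 2 * (x / (1 * k)) * expR (- 1 * k) ->
    `|ramp_height * expR (k - 1) * d| <= 2 * (1 + r) * Y * E.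
  move=> bd; apply: (le_trans (nb _ _ _ bd)); rewrite normrM (ger0_norm (expR_ge0 _)).
  have -> : `|ramp_height| * expR (k - 1) * (2 * (x / (1 * k)) * expR (- 1 * k)) =
     `|ramp_height| * Y * (2 * (expR (k - 1) * expR (- 1 * k))).
    by rewrite /Y; field; rewrite gt_eqF.
  rewrite -expRD (_ : k - 1 + -1 * k = -1); last by ring.
  rewrite (_ : 2 * (1 + r) * Y * E = 2 * ((1 + r) * E) * Y * 1); last by ring.
  have hY : `|ramp_height| * Y <= 2 * ((1 + r) * E) * Y by rewrite ler_wpM2r.
  have hY0 : 0 <= `|ramp_height| * Y by rewrite mulr_ge0.
  have e0 : 0 <= 2 * expR (- 1) :> R by rewrite mulr_ge0 ?expR_ge0.
  rewrite ler_pM//.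
  by have := expR_N1_le; lra.
have Ht1 := Hr1 _ b1; have Ht1' := Hr1 _ b1'; have Ht2 := Hr2 _ b2; have Ht2' := Hr2 _ b2'.
have -> : 10 * x * ((1 + r) ^+ 2 / k * E) = 10 * (1 + r) ^+ 2 * (Y * E).
  by rewrite /Y; field; rewrite gt_eqF.
have YE : 0 <= Y * E by rewrite mulr_ge0.
have fin : (2 * (1 + r) ^+ 2 + 2 * (1 + 2 * r) + r + 8 * (1 + r)) * (Y * E)
   <= 10 * (1 + r) ^+ 2 * (Y * E).
  by rewrite ler_wpM2r//; move: r1; nra.
apply: le_trans fin.
rewrite (_ : _ * (Y * E) = 2 * (1 + r) ^+ 2 * Y * E + 2 * (1 + 2 * r) * Y * E + r * Y * E
   + 2 * (1 + r) * Y * E + 2 * (1 + r) * Y * E + 2 * (1 + r) * Y * E + 2 * (1 + r) * Y * E); last by ring.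
have nD (a b c d : R) : `|a| <= c -> `|b| <= d -> `|a + b| <= c + d.
  by move=> h h'; exact: le_trans (ler_normD _ _) (lerD h h').
have nB (a b c d : R) : `|a| <= c -> `|b| <= d -> `|a - b| <= c + d.
  by move=> h h'; exact: le_trans (ler_normB _ _) (lerD h h').
by apply: (nD) Ht1; apply: (nB) Ht1'; apply: (nB) Ht2; apply: (nD) Ht2'; apply: (nD) H3; exact: nB.
Qed.

Lemma smoothed_bias x : 0 <= x ->
  `|expR (- 1 * x) - expR (- (1 + r) * x) - pois_mean smoothed x|
  <= 10 * x * ((1 + r) ^+ 2 / k * expR (- (1 + r)^-1 * k)).
Proof.
move=> x0.
have g1 := @geom_bounded_laplag2 R _ _ (ltW k0) (ltr01 : 0 < 1).
have g2 := @geom_bounded_laplag2 R _ _ (ltW k0) (ltr0Sn R 1).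
have gu := @geom_bounded_laplag2 R _ _ (ltW k0) u0p.
have k10 : 0 <= k + 1 by rewrite addr_ge0// ltW.
have g1' := @geom_bounded_laplag2 R _ _ k10 (ltr01 : 0 < 1).
have g2' := @geom_bounded_laplag2 R _ _ k10 (ltr0Sn R 1).
have kk : k <= k + 1 by rewrite lerDl.
have b1 := @pois_laplag2_le k 1 x (lexx _) ltr01 x0.
have b2 := @pois_laplag2_le k 2 x (lexx _) (ltr0Sn R 1) x0.
have bu := @pois_laplag2_le k u0 x (lexx _) u0p x0.
have b1' := @pois_laplag2_le (k + 1) 1 x kk ltr01 x0.
have b2' := @pois_laplag2_le (k + 1) 2 x kk (ltr0Sn R 1) x0.
have pt : pois_mean tail x =
  ((1 + r) * pois_mean (laplag2 k u0) x - (1 + 2 * r) * pois_mean (laplag2 k 1) x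
   + r * pois_mean (laplag2 k 2) x)
  + (ramp_height * expR (2 * k) * (pois_mean (laplag2 (k + 1) 2) x - pois_mean (laplag2 k 2) x)
     - ramp_height * expR (k - 1) * (pois_mean (laplag2 (k + 1) 1) x - pois_mean (laplag2 k 1) x)).
  rewrite /tail.
  move: (laplag2 k u0) (laplag2 k 1) (laplag2 k 2) (laplag2 (k + 1) 2) (laplag2 (k + 1) 1) gu g1 g2 g1' g2'.
  move=> cu c1 c2 c2' c1' hu h1 h2 h1' h2'.
  have gz c (a : R) (h : geom_bounded c) := geom_boundedZ a h.
  have t1 := geom_boundedB (gz _ (1 + r) hu) (gz _ (1 + 2 * r) h1).
  have t2 := geom_boundedD t1 (gz _ r h2).
  have t3 := gz _ (ramp_height * expR (2 * k)) (geom_boundedB h2' h2).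
  have t4 := gz _ (ramp_height * expR (k - 1)) (geom_boundedB h1' h1).
  rewrite (pois_meanD _ t2 (geom_boundedB t3 t4)) (pois_meanD _ t1 (gz _ r h2)).
  rewrite (pois_meanB _ (gz _ (1 + r) hu) (gz _ (1 + 2 * r) h1)) (pois_meanB _ t3 t4).
  rewrite (pois_meanZ _ _ hu) (pois_meanZ _ _ h1) (pois_meanZ _ _ h2).
  rewrite (pois_meanZ _ _ (geom_boundedB h2' h2)) (pois_meanZ _ _ (geom_boundedB h1' h1)).
  by rewrite (pois_meanB _ h2' h2) (pois_meanB _ h1' h1).
have ps : pois_mean smoothed x = 2 * r * expR (- 2^-1 * x) - 2 * r * expR (- 1 * x) - pois_mean tail x.
  rewrite (pois_meanB _ (geom_boundedB (geom_boundedZ _ (geom_bounded_pow _))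
    (geom_boundedZ _ (geom_bounded_pow _))) geom_bounded_tail).
  rewrite (pois_meanB _ (geom_boundedZ _ (geom_bounded_pow _)) (geom_boundedZ _ (geom_bounded_pow _))).
  rewrite !(pois_meanZ _ _ (geom_bounded_pow _)) !pois_mean_pow.
  by rewrite sub0r (_ : 2^-1 - 1 = - 2^-1)//; field.
have eu : exact_part u0 x = x - u0 + u0 * expR (- (1 + r) * x).
  by rewrite /exact_part /u0 invrK.
have e1 : exact_part 1 x = x - 1 + expR (- 1 * x).
  by rewrite /exact_part invr1 mul1r.
have e2 : exact_part 2 x = x - 2 + 2 * expR (- 2^-1 * x) by [].
rewrite ps pt; exact (bias_algebra x0 eu e1 e2 bu b1 b2 b2' b1').
Qed.
End Coefficients.

(** * A uniform bound on Poisson probabilities *)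

Section PoissonMass.
Variable R : realType.
Implicit Types (w x y : R) (j : nat).

Lemma ln_le_sym w : 1 <= w -> ln w <= (w - w^-1) / 2.
Proof.
move=> w1; rewrite -subr_ge0.
pose f w := (w - w^-1) / 2 - ln w.
have f1 : f 1 = 0 by rewrite /f invr1 ln1; ring.
rewrite -/(f w) -f1.
apply: (@derivative_ge0_le _ f (fun z => (1 - z^-1) ^+ 2 / 2)) => // [z|z _]; last first.
  by rewrite divr_ge0 ?sqr_ge0.
move=> /andP[z1 _]; have z0 := lt_le_trans ltr01 z1.
have z0' : z != 0 by rewrite gt_eqF.
have d1 := @is_deriveV R (fun y => y) z 1 1 z0' (der_id z).
have d := derB (derM (derB (der_id z) d1) (der_cst 2^-1 z)) (is_derive1_ln z0).
apply: (derE d); rewrite /GRing.scale/=; by field.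
Qed.

Lemma le_expR_sym y : 0 <= y -> 1 + y <= expR (y * (2 + y) / (2 * (1 + y))).
Proof.
move=> y0; have y1 : 0 < 1 + y by rewrite ltr_pwDl.
rewrite -{1}(@lnK _ (1 + y)) ?posrE// ler_expR.
apply: (le_trans (ln_le_sym _)); first by rewrite lerDl.
by apply: le_of_eq; field; rewrite gt_eqF.
Qed.

Lemma stirling_step j : (0 < j)%N ->
  (j.+1%:R ^+ j) ^+ 2 * j.+2%:R <= expR 2 * ((j%:R ^+ j) ^+ 2 * j.+1%:R) :> R.
Proof.
move=> j0; set n : R := j%:R.
have n0 : 0 < n by rewrite ltr0n.
have e1 : j.+1%:R = n * (1 + n^-1) :> R.
  by rewrite mulrDr mulr1 mulfV ?gt_eqF// -natr1.
have e2 : j.+2%:R = j.+1%:R * (1 + j.+1%:R^-1) :> R.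
  by rewrite mulrDr mulr1 mulfV ?gt_eqF ?ltr0n// -natr1.
rewrite e2 {1}e1 exprMn exprMn.
have h1 : ((1 + n^-1) ^+ j) ^+ 2 <= expR ((2 * n + 1) / (n + 1)).
  have := @le_expR_sym n^-1; rewrite invr_ge0 (ltW n0) => /(_ isT) h.
  have h' : (1 + n^-1) ^+ (j * 2) <= expR (n^-1 * (2 + n^-1) / (2 * (1 + n^-1))) ^+ (j * 2).
    by rewrite lerXn2r// ?nnegrE ?expR_ge0// addr_ge0// invr_ge0 ltW.
  rewrite -exprM (le_trans h')// -expRM_natl natrM ler_expR.
by apply: le_of_eq; rewrite -/n; field; rewrite !gt_eqF// ltr_pwDl.
have h2 : 1 + j.+1%:R^-1 <= expR (n + 1)^-1.
  by rewrite -(natr1 j); exact: expR_ge1Dx.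
have h3 : expR ((2 * n + 1) / (n + 1)) * expR (n + 1)^-1 = expR 2.
  by rewrite -expRD; congr expR; field; rewrite gt_eqF// ltr_pwDl.
rewrite -h3.
rewrite (_ : (n ^+ j) ^+ 2 * _ * _ =
   ((1 + n^-1) ^+ j) ^+ 2 * (1 + j.+1%:R^-1) * ((n ^+ j) ^+ 2 * j.+1%:R)); last by ring.
apply: ler_wpM2r; first by rewrite mulr_ge0// !exprn_ge0// ltW.
by apply: ler_pM => //; rewrite ?exprn_ge0 ?addr_ge0 ?invr_ge0// ltW.
Qed.

(** j! >= sqrt (j + 1) (j/e)^j, by induction; the bound
ln w <= (w - 1/w) / 2 is sharp enough for the induction step. *)
Lemma stirling_lower j : (j%:R ^+ j) ^+ 2 * j.+1%:R <= j`!%:R ^+ 2 * expR (2 * j%:R) :> R.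
Proof.
case: j => [|j]; first by rewrite !expr0 !expr1n mulr0 expR0.
elim: j => [|j IH].
  rewrite !expr1n !mul1r mulr1.
  by apply: le_trans (expR_ge1Dx 2); lra.
have := @stirling_step j.+1 isT => h.
rewrite (exprS _ j.+1) exprMn -mulrA.
have := ler_wpM2l (sqr_ge0 (j.+2%:R : R)) h; move=> {}h; apply: (le_trans h).
rewrite (factS j.+1) (natrM _ j.+2) exprMn -[leRHS]mulrA.
apply: ler_wpM2l; first exact: sqr_ge0.
have -> : expR (2 * j.+2%:R) = expR 2 * expR (2 * j.+1%:R) :> R.
  by rewrite -expRD; congr expR; rewrite -[j.+2]addn1 natrD; ring.
by rewrite [leRHS]mulrCA ler_wpM2l ?expR_ge0.
Qed.

Lemma pow_le_exp x j : 0 <= x -> x ^+ j <= j%:R ^+ j * expR (x - j%:R).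
Proof.
move=> x0; case: j => [|j].
  by rewrite !expr0 mul1r subr0 -[1 in leLHS]expR0 ler_expR.
set n : R := j.+1%:R.
have n0 : 0 < n by rewrite ltr0n.
have h := @expR_ge1Dx R (x / n - 1); rewrite addrC subrK in h.
have : (x / n) ^+ j.+1 <= expR (x / n - 1) ^+ j.+1.
  by rewrite lerXn2r// ?nnegrE ?expR_ge0 ?divr_ge0// ltW.
rewrite -expRM_natl -/n (_ : n * _ = x - n); last by field; rewrite gt_eqF.
by rewrite expr_div_n ler_pdivrMr ?exprn_gt0// mulrC.
Qed.

(** x^j e^-x is largest at x = j, where stirling_lower applies. *)
Lemma poisson_mass_le x j : 0 <= x ->
  x ^+ j / j`!%:R <= expR x / Num.sqrt j.+1%:R.
Proof.
move=> x0.
have s0 : 0 < Num.sqrt j.+1%:R :> R by rewrite sqrtr_gt0 ltr0n.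
have f0 : 0 < j`!%:R :> R by rewrite ltr0n fact_gt0.
rewrite ler_pdivlMr// mulrAC ler_pdivrMr//.
rewrite -(@ler_pXn2r _ 2)// ?nnegrE ?mulr_ge0 ?exprn_ge0 ?expR_ge0 ?(ltW s0) ?(ltW f0)//.
rewrite !exprMn sqr_sqrtr//.
apply: (@le_trans _ _ ((j%:R ^+ j * expR (x - j%:R)) ^+ 2 * j.+1%:R)).
  apply: ler_wpM2r => //; have xj := pow_le_exp j x0.
  by rewrite lerXn2r// ?nnegrE ?(le_trans _ xj) ?exprn_ge0.
rewrite exprMn mulrAC.
apply: (le_trans (ler_wpM2r (exprn_ge0 2 (expR_ge0 _)) (stirling_lower j))).
rewrite -!expRM_natl -mulrA -expRD mulrC ler_wpM2r ?sqr_ge0//.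
by rewrite ler_expR; apply: le_of_eq; ring.
Qed.
End PoissonMass.

(** * The second moment of the smoothed coefficients *)

Section SecondMoment.
Variable R : realType.
Variables (r k : R).
Implicit Types (x s v : R) (i j N : nat).
Hypotheses (r1 : 1 < r) (k1 : 1 <= k).

Let u0 : R := (1 + r)^-1.
Let rho : R := (r - 1) / (r + 1).
Hypothesis rhok : k ^+ 2 * expR (rho * (k / 4)) <= expR (rho * k).

Let k0 : 0 < k. Proof. exact: lt_le_trans ltr01 k1. Qed.
Let r0 : 0 < r. Proof. exact: lt_trans ltr01 r1. Qed.
Let rp : 0 < 1 + r. Proof. by rewrite addr_gt0. Qed.
Let u0p : 0 < u0. Proof. by rewrite invr_gt0. Qed.
Let u01 : u0 <= 2^-1.
Proof. by rewrite lef_pV2 ?posrE//; move: r1; lra. Qed.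
Let rhoE : rho = 1 - 2 * u0.
Proof. by rewrite /rho /u0 (addrC r 1); field; rewrite gt_eqF. Qed.
Let rho0 : 0 < rho.
Proof. by rewrite divr_gt0 ?subr_gt0// addrC. Qed.

(** The integral of e^(rho s) over [0, k] is at most e^(rho k) times this. *)
Definition growth_time : R := Num.min k ((r + 1) / (r - 1)).
Let D := growth_time.
Let D1 : 1 <= D.
Proof.
rewrite /D /growth_time le_min k1 /= ler_pdivlMr ?subr_gt0//; lra.
Qed.

Lemma itg_cat a b c (f : R -> R) : a <= b -> b <= c -> continuous f ->
  itg a c f = itg a b f + itg b c f.
Proof.
move=> ab bc cf; apply/eqP; rewrite addrC -subr_eq; apply/eqP.
rewrite /itg Rintegral_itvB//; last exact: itg_integrable.
rewrite Rintegral_itv_obnd_cbnd//.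
apply: integrableS (itg_integrable b c cf) => //.
by apply: subset_itvr; rewrite bnd_simp.
Qed.

Lemma laplag2_cat v u i : 0 <= v -> v <= v + 1 ->
  laplag2 (v + 1) u i - laplag2 v u i = itg v (v + 1) (fun s => expR (- u * s) * lag2 s i).
Proof.
move=> v0 vv; rewrite /laplag2 (itg_cat v0 vv); first by rewrite addrC addKr.
exact: continuous_expM.
Qed.

Let c_lag2 i : continuous (fun s => lag2 s i). Proof. exact: continuous_horner. Qed.

Definition dprofile s : R :=
  - expR (- (1 + r)^-1 * s) + (1 + 2 * r) * expR (- 1 * s) - 2 * r * expR (- 2 * s).

Definition dramp s : R :=
  - 2 * (ramp_height r k * expR (2 * k)) * expR (- 2 * s)
  + ramp_height r k * expR (k - 1) * expR (- 1 * s).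

Lemma der_profile s : is_derive s 1 (profile r) (dprofile s).
Proof.
have d := derD (derB (derZ (1 + r) (der_exp (- (1 + r)^-1) s))
  (derZ (1 + 2 * r) (der_exp (- 1) s))) (derZ r (der_exp (- 2) s)).
by apply: (derE d); rewrite /dprofile; field; rewrite gt_eqF.
Qed.

Lemma der_ramp s : is_derive s 1 (ramp r k) (dramp s).
Proof.
have d := derB (derZ (ramp_height r k * expR (2 * k)) (der_exp (- 2) s))
  (derZ (ramp_height r k * expR (k - 1)) (der_exp (- 1) s)).
by apply: (derE d); rewrite /dramp; ring.
Qed.

Let c_exp c a : continuous (fun s : R => c * expR (a * s)).
Proof. by move=> s; apply: cvgM; [exact: cvg_cst | exact: continuous_expc]. Qed.

Lemma continuous_profile : continuous (profile r).
Proof. exact: der_continuous der_profile. Qed.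

Lemma continuous_ramp : continuous (ramp r k).
Proof. exact: der_continuous der_ramp. Qed.

Lemma continuous_dprofile : continuous dprofile.
Proof.
move=> s; apply: cvgB; last exact: c_exp.
apply: cvgD; last exact: c_exp.
by apply: cvgN; exact: continuous_expc.
Qed.

Lemma continuous_dramp : continuous dramp.
Proof. by move=> s; apply: cvgD; exact: c_exp. Qed.

Let c_M (f g : R -> R) : continuous f -> continuous g -> continuous (fun s => f s * g s).
Proof. by move=> cf cg s; apply: cvgM; [exact: cf | exact: cg]. Qed.

Lemma tail_itg i : tail r k i =
  itg 0 k (fun s => profile r s * lag2 s i) + itg k (k + 1) (fun s => ramp r k s * lag2 s i).
Proof.
have kk : k <= k + 1 by rewrite lerDl.
rewrite /tail (laplag2_cat 2 i (ltW k0) kk) (laplag2_cat 1 i (ltW k0) kk) /laplag2.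
have cE u : continuous (fun s => expR (- u * s) * lag2 s i) by exact: continuous_expM.
have cZ c u : continuous (fun s => c * (expR (- u * s) * lag2 s i)).
  by apply: c_M => // s; exact: cvg_cst.
congr (_ + _).
  rewrite -!itgZ//.
  have cB : continuous (fun s => (1 + r) * (expR (- (1 + r)^-1 * s) * lag2 s i)
     - (1 + 2 * r) * (expR (- 1 * s) * lag2 s i)).
    by move=> s; apply: cvgB; exact: cZ.
  rewrite -itgB// -itgD//; congr itg; apply/funext => s.
  by rewrite /profile; ring.
by rewrite -!itgZ// -itgB//; congr itg; apply/funext => s; rewrite /ramp; ring.
Qed.

Lemma profile0 : profile r 0 = 0.
Proof. by rewrite /profile !mulr0 expR0; ring. Qed.

Lemma ramp_left : ramp r k k = profile r k.
Proof.
have <- : ramp_height r k * (1 - expR (- 1)) = profile r k.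
  by rewrite /ramp_height divfK// gt_eqF//; have := expR_N1_le R; lra.
rewrite /ramp; move: (ramp_height r k) => h; rewrite -!mulrA -!expRD.
rewrite (_ : 2 * k + - 2 * k = 0); last by ring.
rewrite (_ : k - 1 + - 1 * k = - 1); last by ring.
by rewrite expR0 mulrBr.
Qed.

Lemma ramp_right : ramp r k (k + 1) = 0.
Proof.
rewrite /ramp; move: (ramp_height r k) => h; rewrite -!mulrA -!expRD.
rewrite (_ : 2 * k + - 2 * (k + 1) = - 2); last by ring.
rewrite (_ : k - 1 + - 1 * (k + 1) = - 2); last by ring.
by rewrite subrr.
Qed.

(** No boundary term remains: profile vanishes at 0, meets ramp at k, and ramp
vanishes at k + 1. *)
Lemma tail_parts i : tail r k i =
  - (itg 0 k (fun s => dprofile s * lag1 s i)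
     + itg k (k + 1) (fun s => dramp s * lag1 s i)).
Proof.
have kk : k <= k + 1 by rewrite lerDl.
have d1 s : is_derive s 1 (fun s => lag1 s i) (lag2 s i) by exact: is_derive_poly.
rewrite tail_itg.
rewrite (itg_parts (ltW k0) der_profile d1 continuous_dprofile (@c_lag2 i)).
rewrite (itg_parts kk der_ramp d1 continuous_dramp (@c_lag2 i)).
by rewrite ramp_left ramp_right profile0; ring.
Qed.

Let mu s : R := Num.min 1 s.

(** The differences of exponentials that make up profile and its derivative decay
like e^(-u0 s) and are linear in s near 0. *)
Let exp_gap a b s : a <= b -> b <= a + 1 -> u0 <= a -> 0 <= s ->
  0 <= expR (- a * s) - expR (- b * s) <= expR (- u0 * s) * mu s.
Proof.
move=> ab ba ua s0; rewrite subr_ge0 exp_decay_le//=.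
have ea : expR (- a * s) <= expR (- u0 * s) by exact: exp_decay_le.
rewrite /mu; case: (leP 1 s) => s1.
  by rewrite mulr1 (le_trans _ ea)// gerBl expR_ge0.
have -> : expR (- b * s) = expR (- a * s) * expR (- ((b - a) * s)).
  by rewrite -expRD; congr expR; ring.
rewrite -[X in X - _]mulr1 -mulrBr ler_pM ?expR_ge0//.
  by rewrite subr_ge0 -[leRHS]expR0 ler_expR oppr_le0 mulr_ge0// subr_ge0.
have := @expR_ge1Dx R (- ((b - a) * s)).
have : (b - a) * s <= 1 * s by rewrite ler_wpM2r//; lra.
by rewrite mul1r; lra.
Qed.

Let mu_ge0 s : 0 <= s -> 0 <= mu s. Proof. by move=> s0; rewrite le_min ler01. Qed.

Let gap1 s : 0 <= s ->
  0 <= expR (- u0 * s) - expR (- 1 * s) <= expR (- u0 * s) * mu s.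
Proof. by move=> s0; apply: exp_gap => //; move: u01 u0p; lra. Qed.

Let gap2 s : 0 <= s ->
  0 <= expR (- 1 * s) - expR (- 2 * s) <= expR (- u0 * s) * mu s.
Proof. by move=> s0; apply: exp_gap => //; move: u01 u0p; lra. Qed.

Lemma profile_min s : 0 <= s -> `|profile r s| <= 2 * r * (expR (- u0 * s) * mu s).
Proof.
move=> s0; have := gap1 s0; have := gap2 s0.
rewrite /profile -/u0.
move: (expR (- u0 * s) * mu s) (expR (- u0 * s)) (expR (- 1 * s)) (expR (- 2 * s)).
move=> M a b c /andP[h1 h2] /andP[h3 h4].
rewrite (_ : _ - _ + _ = (1 + r) * (a - b) - r * (b - c)); last by ring.
move: (a - b) (b - c) h1 h2 h3 h4 => d1 d2 h1 h2 h3 h4.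
rewrite ler_norml; apply/andP; split; move: r1; nra.
Qed.

Lemma dprofile_min s : 0 <= s -> `|dprofile s| <= 2 * r * (expR (- u0 * s) * mu s).
Proof.
move=> s0; have := gap1 s0; have := gap2 s0.
rewrite /dprofile -/u0.
move: (expR (- u0 * s) * mu s) (expR (- u0 * s)) (expR (- 1 * s)) (expR (- 2 * s)).
move=> M a b c /andP[h1 h2] /andP[h3 h4].
rewrite (_ : _ - _ = - (a - b) + 2 * r * (b - c)); last by ring.
move: (a - b) (b - c) h1 h2 h3 h4 => d1 d2 h1 h2 h3 h4.
rewrite ler_norml; apply/andP; split; move: r1; nra.
Qed.

Let rampE s : ramp r k s =
  ramp_height r k * (expR (- 2 * (s - k)) - expR (- 1 + - 1 * (s - k))).
Proof.
rewrite /ramp; move: (ramp_height r k) => h; rewrite mulrBr -!mulrA -!expRD.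
by congr (_ * expR _ - _ * expR _); ring.
Qed.

Let drampE s : dramp s =
  ramp_height r k * (- 2 * expR (- 2 * (s - k)) + expR (- 1 + - 1 * (s - k))).
Proof.
rewrite /dramp; move: (ramp_height r k) => h.
rewrite mulrDr -!mulrA -!expRD (mulrCA h); congr (_ * (_ * expR _) + _ * expR _); ring.
Qed.

Let ramp_exps s : k <= s ->
  (0 <= expR (- 2 * (s - k)) <= 1) && (0 <= expR (- 1 + - 1 * (s - k)) <= 1).
Proof.
move=> ks; rewrite !expR_ge0 /= -[1]expR0 !ler_expR expR0.
by apply/andP; split; lra.
Qed.

Lemma ramp_le s : k <= s -> `|ramp r k s| <= `|ramp_height r k|.
Proof.
move=> ks; rewrite rampE normrM ler_piMr//.
by have /andP[/andP[h1 h2] /andP[h3 h4]] := ramp_exps ks; rewrite ler_norml; lra.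
Qed.

Lemma dramp_le s : k <= s -> `|dramp s| <= `|ramp_height r k| * 2.
Proof.
move=> ks; rewrite drampE normrM ler_wpM2l//.
by have /andP[/andP[h1 h2] /andP[h3 h4]] := ramp_exps ks; rewrite ler_norml; lra.
Qed.

Lemma itg_exp_rho : itg 0 k (fun s => expR (rho * s)) <= expR (rho * k) * D.
Proof.
have c : continuous (fun s => expR (rho * s)) by exact: continuous_expc.
have h1 : itg 0 k (fun s => expR (rho * s)) <= expR (rho * k) * k.
  have d s : is_derive s 1 (fun s => expR (rho * k) * s) (expR (rho * k)).
    by apply: (derE (derZ _ (der_id s))); rewrite mulr1.
  have cc : continuous (fun _ : R => expR (rho * k)) by exact: cst_continuous.
  have e := itg_FTC (ltW k0) cc d.
  rewrite mulr0 subr0 in e; rewrite -e.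
  apply: itg_le => //.
  by move=> s /andP[s0 sk]; rewrite ler_expR ler_pM2l.
have h2 : itg 0 k (fun s => expR (rho * s)) <= expR (rho * k) * ((r + 1) / (r - 1)).
  have d s : is_derive s 1 (fun s => rho^-1 * expR (rho * s)) (expR (rho * s)).
    by apply: (derE (derZ _ (der_exp rho s))); rewrite mulKf ?gt_eqF.
  rewrite (itg_FTC (ltW k0) c d) mulr0 expR0 -invf_div -/rho mulr1 [leRHS]mulrC.
  by rewrite gerBl invr_ge0 ltW.
by rewrite /D /growth_time minEle; case: ifP.
Qed.

Let E := expR (rho * k).
Let E0 : 0 < E. Proof. exact: expR_gt0. Qed.
Let q := expR (rho * (k / 4)).
Let q0 : 0 <= q. Proof. exact: expR_ge0. Qed.
Let c_rho : continuous (fun s => expR (rho * s)). Proof. exact: continuous_expc. Qed.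
Let c_cst (c : R) : continuous (fun _ : R => c). Proof. exact: cst_continuous. Qed.
Let c_D (f g : R -> R) : continuous f -> continuous g -> continuous (fun s => f s + g s).
Proof. by move=> cf cg s; apply: cvgD; [exact: cf | exact: cg]. Qed.

(** A majorant of dprofile^2 / (s e^-s): the first term serves for s > k / 4, the
constant q for s <= k / 4. *)
Definition major1 s : R := 4 * r ^+ 2 * (4 / k * expR (rho * s) + q).
(** A majorant of profile^2 / (s^2 e^-s), split at k / 4 as major1; the factor
(1 + s^2)^-1 keeps the part below k / 4 integrable uniformly in k. *)
Definition major2 s : R :=
  4 * r ^+ 2 * (32 / k ^+ 2 * expR (rho * s) + 2 * q * (1 + s ^+ 2)^-1).

Let itg_cst a b (c : R) : a <= b -> itg a b (fun=> c) = c * (b - a).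
Proof.
move=> ab; have d s : is_derive s 1 (fun s => c * s) c.
  by apply: (derE (derZ _ (der_id s))); rewrite mulr1.
by rewrite (itg_FTC ab (@c_cst c) d) mulrBr.
Qed.

Lemma continuous_major1 : continuous major1.
Proof.
by apply: c_M => //; apply: c_D => //; apply: c_M.
Qed.

Let c_inv : continuous (fun s : R => (1 + s ^+ 2)^-1).
Proof.
have d (s : R) : is_derive s 1 (fun s => 1 + s * s) (0 + (1 * s + s * 1)).
  exact: (derD (der_cst 1 s) (derM (der_id s) (der_id s))).
have h : continuous (fun s : R => 1 + s ^+ 2).
  rewrite (_ : (fun s => _) = (fun s : R => 1 + s * s)); first exact: (@der_continuous _ _ _ d).
  by apply/funext => s; rewrite expr2.
by move=> s; apply: cvgV; [rewrite gt_eqF// ltr_pwDl// sqr_ge0 | exact: h].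
Qed.

Lemma continuous_major2 : continuous major2.
Proof. by apply: c_M => //; apply: c_D; apply: c_M. Qed.

Let ler_QE : q * k ^+ 2 <= E. Proof. by rewrite mulrC. Qed.

Lemma itg_major1 : itg 0 k major1 <= 20 * r ^+ 2 / k * (E * D).
Proof.
have cE : continuous (fun s => 4 / k * expR (rho * s)) by exact: c_M.
rewrite /major1 itgZ; last by apply: c_D.
rewrite itgD// itgZ// itg_cst ?(ltW k0)// subr0.
have h := itg_exp_rho; rewrite -/E in h.
have hq : q * k <= k^-1 * (E * D).
  rewrite ler_pdivlMl// mulrCA -expr2 (le_trans ler_QE)//.
  by rewrite ler_peMr// ltW.
have h' : 4 / k * itg 0 k (fun s => expR (rho * s)) <= 4 / k * (E * D).
  by rewrite ler_wpM2l// divr_ge0// ltW.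
rewrite (_ : 20 * r ^+ 2 / k * _ = 4 * r ^+ 2 * (4 / k * (E * D) + k^-1 * (E * D))); last by ring.
by apply: ler_wpM2l; [rewrite mulr_ge0// sqr_ge0 | exact: lerD].
Qed.

Lemma itg_major2 : itg 0 k major2 <= 144 * r ^+ 2 / k ^+ 2 * (E * D).
Proof.
have cE : continuous (fun s => 32 / k ^+ 2 * expR (rho * s)) by exact: c_M.
have cI : continuous (fun s : R => 2 * q * (1 + s ^+ 2)^-1) by exact: c_M.
rewrite /major2 itgZ; last by apply: c_D.
rewrite itgD// !itgZ//.
have h := itg_exp_rho; rewrite -/E in h.
have ha : itg 0 k (fun s => (1 + s ^+ 2)^-1) <= 2.
  rewrite (itg_FTC (ltW k0) c_inv (fun s => is_derive1_atan s)) atan0 subr0.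
  by rewrite (le_trans (ltW (atan_ltpi2 _)))// ltW// pihalf_lt2.
have hq : q <= (k ^+ 2)^-1 * (E * D).
  rewrite ler_pdivlMl ?exprn_gt0// mulrC (le_trans ler_QE)//.
  by rewrite ler_peMr// ltW.
have h' : 32 / k ^+ 2 * itg 0 k (fun s => expR (rho * s)) <= 32 / k ^+ 2 * (E * D).
  by rewrite ler_wpM2l// divr_ge0// exprn_ge0// ltW.
have hq' : 2 * q * itg 0 k (fun s => (1 + s ^+ 2)^-1) <= 2 * q * 2.
  by rewrite ler_wpM2l// mulr_ge0.
rewrite (_ : 144 * r ^+ 2 / k ^+ 2 * _ =
  4 * r ^+ 2 * (32 / k ^+ 2 * (E * D) + 4 * ((k ^+ 2)^-1 * (E * D)))); last by ring.
apply: ler_wpM2l; first by rewrite mulr_ge0// sqr_ge0.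
apply: lerD => //.
by rewrite (le_trans hq')//; lra.
Qed.

Let sq_le (x y : R) : `|x| <= y -> x ^+ 2 <= y ^+ 2.
Proof. by move=> xy; rewrite -real_normK ?num_real// lerXn2r// nnegrE (le_trans _ xy). Qed.

Let exp_u0 s : expR (- u0 * s) ^+ 2 = expR (rho * s) * expR (- 1 * s).
Proof. by rewrite -expRM_natl -expRD rhoE; congr expR; ring. Qed.

Let q_le s : s <= k / 4 -> expR (rho * s) <= q.
Proof. by move=> sk; rewrite /q ler_expR ler_pM2l. Qed.

Lemma dprofile_major s : 0 <= s <= k ->
  dprofile s ^+ 2 <= major1 s * (s * expR (- 1 * s)).
Proof.
move=> /andP[s0 sk]; apply: (le_trans (sq_le (dprofile_min s0))).
rewrite !exprMn exp_u0 /major1.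
rewrite [leLHS](_ : _ = 4 * r ^+ 2 * expR (- 1 * s) * (expR (rho * s) * mu s ^+ 2)); last by ring.
rewrite [leRHS](_ : _ = 4 * r ^+ 2 * expR (- 1 * s) * ((4 / k * expR (rho * s) + q) * s)); last by ring.
apply: ler_wpM2l; first by rewrite mulr_ge0 ?expR_ge0// mulr_ge0// sqr_ge0.
have mu1 : mu s <= 1 by rewrite ge_min lexx.
have mus : mu s <= s by rewrite ge_min lexx orbT.
have m0 := mu_ge0 s0.
have e0 := expR_ge0 (rho * s).
case: (leP s (k / 4)) => [/q_le sq|sk4].
  have m2 : mu s ^+ 2 <= s by rewrite expr2; nra.
  apply: (@le_trans _ _ (q * s)); first by rewrite ler_pM// sqr_ge0.
  by rewrite ler_wpM2r// lerDr mulr_ge0// divr_ge0// ltW.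
have m2 : mu s ^+ 2 <= 1 by rewrite expr2; nra.
apply: (@le_trans _ _ (expR (rho * s) * (4 / k * s))).
  rewrite ler_wpM2l// (le_trans m2)// mulrAC ler_pdivlMr// mul1r.
  by move: sk4; rewrite ltr_pdivrMr//; lra.
rewrite [leRHS]mulrDl (_ : _ * (4 / k * s) = 4 / k * expR (rho * s) * s); last by ring.
by rewrite lerDl mulr_ge0.
Qed.

Lemma profile_major s : 0 <= s <= k ->
  profile r s ^+ 2 <= major2 s * (s ^+ 2 * expR (- 1 * s)).
Proof.
move=> /andP[s0 sk]; apply: (le_trans (sq_le (profile_min s0))).
rewrite !exprMn exp_u0 /major2.
rewrite [leLHS](_ : _ = 4 * r ^+ 2 * expR (- 1 * s) * (expR (rho * s) * mu s ^+ 2)); last by ring.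
rewrite [leRHS](_ : _ = 4 * r ^+ 2 * expR (- 1 * s) *
   ((32 / k ^+ 2 * expR (rho * s) + 2 * q * (1 + s ^+ 2)^-1) * s ^+ 2)); last by ring.
apply: ler_wpM2l; first by rewrite mulr_ge0 ?expR_ge0// mulr_ge0// sqr_ge0.
have mu1 : mu s <= 1 by rewrite ge_min lexx.
have mus : mu s <= s by rewrite ge_min lexx orbT.
have m0 := mu_ge0 s0.
have e0 := expR_ge0 (rho * s).
have s2 : 0 < 1 + s ^+ 2 by rewrite ltr_pwDl// sqr_ge0.
case: (leP s (k / 4)) => [/q_le sq|sk4].
  have m2 : mu s ^+ 2 <= 2 * (1 + s ^+ 2)^-1 * s ^+ 2.
    rewrite mulrAC ler_pdivlMr//.
    have : mu s ^+ 2 <= 1 by rewrite expr2; nra.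
    have : mu s ^+ 2 <= s ^+ 2 by rewrite lerXn2r.
    have := sqr_ge0 (mu s); have := sqr_ge0 s; nra.
  apply: (@le_trans _ _ (q * (2 * (1 + s ^+ 2)^-1 * s ^+ 2))).
    by rewrite ler_pM// sqr_ge0.
  rewrite (_ : q * _ = 2 * q * (1 + s ^+ 2)^-1 * s ^+ 2); last by ring.
  rewrite ler_wpM2r ?sqr_ge0// lerDr mulr_ge0// divr_ge0// exprn_ge0// ltW//.
have m2 : mu s ^+ 2 <= 1 by rewrite expr2; nra.
apply: (@le_trans _ _ (expR (rho * s) * (32 / k ^+ 2 * s ^+ 2))).
  rewrite ler_wpM2l// (le_trans m2)// mulrAC ler_pdivlMr ?exprn_gt0// mul1r.
  move: sk4; rewrite ltr_pdivrMr// !expr2 => h; nra.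
rewrite [leRHS]mulrDl (_ : _ * (32 / k ^+ 2 * s ^+ 2) = 32 / k ^+ 2 * expR (rho * s) * s ^+ 2); last by ring.
rewrite lerDl; apply: mulr_ge0; last exact: sqr_ge0.
by rewrite mulr_ge0 ?mulr_ge0// invr_ge0 ltW.
Qed.

Let hh := ramp_height r k.
Let C := hh ^+ 2 * expR (k + 1).

Lemma ramp_const : C <= 64 * r ^+ 2 * E.
Proof.
have h := sq_le (ramp_height_le (ltW r1) k1); rewrite -/u0 -/hh in h.
have e4 := expR1_le R.
rewrite /C expRD.
apply: (@le_trans _ _ ((2 * ((1 + r) * expR (- u0 * k))) ^+ 2 * (expR k * 4))).
  by rewrite ler_pM ?sqr_ge0 ?mulr_ge0 ?expR_ge0// ler_wpM2l// expR_ge0.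
rewrite !exprMn exp_u0 (_ : _ * _ = 16 * (1 + r) ^+ 2 * E * (expR (- 1 * k) * expR k)); last by rewrite -/E; ring.
rewrite -expRD mulN1r addNr expR0 mulr1 ler_wpM2r ?(ltW E0)//.
by move: r1; nra.
Qed.

Lemma ramp_major s : k <= s <= k + 1 ->
  ramp r k s ^+ 2 <= (C / k ^+ 2) * (s ^+ 2 * expR (- 1 * s)).
Proof.
move=> /andP[ks sk]; apply: (le_trans (sq_le (ramp_le ks))).
rewrite real_normK ?num_real// -/hh /C.
have e : 1 <= expR (k + 1) * expR (- 1 * s).
  by rewrite -expRD -[1 in X in X <= _]expR0 ler_expR; lra.
have e2 : 1 <= s ^+ 2 / k ^+ 2.
  by rewrite ler_pdivlMr ?exprn_gt0// mul1r lerXn2r// ?nnegrE ?(le_trans _ ks)// ltW.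
rewrite (_ : hh ^+ 2 * _ / _ * _ = hh ^+ 2 * (expR (k + 1) * expR (- 1 * s) * (s ^+ 2 / k ^+ 2))); last by ring.
by apply: ler_peMr; [exact: sqr_ge0 | exact: mulr_ege1].
Qed.

Lemma dramp_major s : k <= s <= k + 1 ->
  dramp s ^+ 2 <= (4 * C / k) * (s * expR (- 1 * s)).
Proof.
move=> /andP[ks sk]; apply: (le_trans (sq_le (dramp_le ks))).
rewrite exprMn real_normK ?num_real// -/hh /C.
have e : 1 <= expR (k + 1) * expR (- 1 * s).
  by rewrite -expRD -[1 in X in X <= _]expR0 ler_expR; lra.
have e2 : 1 <= s / k by rewrite ler_pdivlMr// mul1r.
rewrite (_ : 4 * _ / _ * _ = hh ^+ 2 * 2 ^+ 2 * (expR (k + 1) * expR (- 1 * s) * (s / k))); last by ring.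
by apply: ler_peMr; [rewrite mulr_ge0// sqr_ge0 | exact: mulr_ege1].
Qed.

Let bessel1 N a b (f m : R -> R) : 0 <= a <= b -> continuous f -> continuous m ->
  (forall s, a <= s <= b -> 0 <= m s) ->
  (forall s, a <= s <= b -> f s ^+ 2 <= m s * (s * expR (- 1 * s))) ->
  \sum_(j < N) itg a b (fun s => f s * lag1 s j.+1) ^+ 2 / j.+1%:R <= itg a b m.
Proof.
move=> ab cf cm m0 fm.
have h := @bessel_moment R N (fun j : 'I_N => (laguerre R j.+1)^`()) (fun j : 'I_N => j.+1%:R) 'X f m a b.
apply: h => // [x x0|i j|s sab]; rewrite ?hornerX//; last exact: fm.
rewrite moment_laguerre1 eqSS -[(i == j :> nat)]/(i == j).
by case: eqVneq => // _; rewrite !mul0r.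
Qed.

Let bessel2 N a b (f m : R -> R) : 0 <= a <= b -> continuous f -> continuous m ->
  (forall s, a <= s <= b -> 0 <= m s) ->
  (forall s, a <= s <= b -> f s ^+ 2 <= m s * (s ^+ 2 * expR (- 1 * s))) ->
  \sum_(j < N) itg a b (fun s => f s * lag2 s j.+2) ^+ 2 / (j.+2%:R * j.+1%:R) <= itg a b m.
Proof.
move=> ab cf cm m0 fm.
have h := @bessel_moment R N (fun j : 'I_N => (laguerre R j.+2)^`()^`())
  (fun j : 'I_N => j.+2%:R * j.+1%:R) ('X ^+ 2) f m a b.
apply: h => // [x x0|i j|s sab]; rewrite ?hornerXn ?sqr_ge0//; last exact: fm.
rewrite moment_laguerre2 !eqSS -[(i == j :> nat)]/(i == j) natrM.
by case: eqVneq => // _; rewrite !mul0r.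
Qed.

Let sqD_le (x y : R) : (x + y) ^+ 2 <= 2 * x ^+ 2 + 2 * y ^+ 2.
Proof. by have := sqr_ge0 (x - y); rewrite !expr2; lra. Qed.

Let C0 : 0 <= C. Proof. by rewrite mulr_ge0 ?sqr_ge0 ?expR_ge0. Qed.
Let kk : 0 <= k <= k + 1. Proof. by rewrite ltW//= lerDl. Qed.
Let k0k : (0 : R) <= 0 <= k. Proof. by rewrite lexx /= ltW. Qed.
Let ED : E <= E * D. Proof. by rewrite ler_peMr// ltW. Qed.

Let major1_ge0 s : 0 <= s <= k -> 0 <= major1 s.
Proof.
move=> _; apply: mulr_ge0; first by rewrite mulr_ge0// sqr_ge0.
apply: addr_ge0 => //; apply: mulr_ge0; last exact: expR_ge0.
by rewrite divr_ge0// ltW.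
Qed.

Let major2_ge0 s : 0 <= s <= k -> 0 <= major2 s.
Proof.
move=> _; apply: mulr_ge0; first by rewrite mulr_ge0// sqr_ge0.
apply: addr_ge0; apply: mulr_ge0.
- by rewrite divr_ge0// sqr_ge0.
- exact: expR_ge0.
- by rewrite mulr_ge0.
- by rewrite invr_ge0 addr_ge0// sqr_ge0.
Qed.

Lemma tail_sum1 N :
  \sum_(j < N) tail r k j.+1 ^+ 2 / j.+1%:R <= 552 * r ^+ 2 / k * (E * D).
Proof.
have b1 := @bessel1 N 0 k dprofile major1 k0k continuous_dprofile continuous_major1
  major1_ge0 dprofile_major.
have cc : continuous (fun _ : R => 4 * C / k) by exact: cst_continuous.
have b2 := @bessel1 N k (k + 1) dramp (fun=> 4 * C / k) kk continuous_dramp cc.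
rewrite itg_cst ?lerDl// in b2.
rewrite (_ : 4 * C / k * (k + 1 - k) = 4 * C / k) in b2; last by ring.
have {}b2 := b2 _ dramp_major.
have c4 : 0 <= 4 * C / k by apply: divr_ge0; [exact: mulr_ge0 | exact: ltW].
have {}b2 := b2 (fun _ _ => c4).
apply: (@le_trans _ _ (2 * (20 * r ^+ 2 / k * (E * D)) + 2 * (4 * C / k))).
  have hb1 := ler_wpM2l (ler0n R 2) (le_trans b1 itg_major1).
  have hb2 := ler_wpM2l (ler0n R 2) b2.
  apply: le_trans (lerD hb1 hb2).
  rewrite !mulr_sumr -big_split /=; apply: ler_sum => j _.
  rewrite !mulrA -mulrDl ler_wpM2r ?invr_ge0// tail_parts sqrrN.
  rewrite -!mulrA; exact: sqD_le.
have h : 4 * C / k <= 256 * r ^+ 2 / k * (E * D).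
  rewrite (_ : 256 * r ^+ 2 / k * (E * D) = 4 * (64 * r ^+ 2 * (E * D)) / k); last by ring.
  rewrite ler_wpM2r ?invr_ge0 ?(ltW k0)// ler_wpM2l// (le_trans ramp_const)//.
  by apply: ler_wpM2l => //; rewrite mulr_ge0// sqr_ge0.
apply: (le_trans (lerD (lexx _) (ler_wpM2l (ler0n R 2) h))).
by apply: le_of_eq; ring.
Qed.

Lemma tail_sum2 N :
  \sum_(j < N) tail r k j.+2 ^+ 2 / (j.+2%:R * j.+1%:R) <= 416 * r ^+ 2 / k ^+ 2 * (E * D).
Proof.
have b1 := @bessel2 N 0 k (profile r) major2 k0k continuous_profile continuous_major2
  major2_ge0 profile_major.
have cc : continuous (fun _ : R => C / k ^+ 2) by exact: cst_continuous.
have b2 := @bessel2 N k (k + 1) (ramp r k) (fun=> C / k ^+ 2) kk continuous_ramp cc.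
rewrite itg_cst ?lerDl// in b2.
rewrite (_ : C / k ^+ 2 * (k + 1 - k) = C / k ^+ 2) in b2; last by ring.
have {}b2 := b2 _ ramp_major.
have c4 : 0 <= C / k ^+ 2 by apply: divr_ge0; [exact: C0 | exact: sqr_ge0].
have {}b2 := b2 (fun _ _ => c4).
apply: (@le_trans _ _ (2 * (144 * r ^+ 2 / k ^+ 2 * (E * D)) + 2 * (C / k ^+ 2))).
  have hb1 := ler_wpM2l (ler0n R 2) (le_trans b1 itg_major2).
  have hb2 := ler_wpM2l (ler0n R 2) b2.
  apply: le_trans (lerD hb1 hb2).
  rewrite !mulr_sumr -big_split /=; apply: ler_sum => j _.
  rewrite !mulrA -mulrDl ler_wpM2r ?invr_ge0 ?mulr_ge0// tail_itg.
  rewrite -!mulrA; exact: sqD_le.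
have h : C / k ^+ 2 <= 64 * r ^+ 2 / k ^+ 2 * (E * D).
  rewrite (_ : 64 * r ^+ 2 / k ^+ 2 * (E * D) = 64 * r ^+ 2 * (E * D) / k ^+ 2); last by ring.
  rewrite ler_wpM2r ?invr_ge0 ?sqr_ge0// (le_trans ramp_const)//.
  by apply: ler_wpM2l => //; rewrite mulr_ge0// sqr_ge0.
apply: (le_trans (lerD (lexx _) (ler_wpM2l (ler0n R 2) h))).
by apply: le_of_eq; ring.
Qed.

Lemma laplag2_1 v u : 0 <= v -> 0 < u -> laplag2 v u 1 = 0 :> R.
Proof.
move=> v0 up; have := laplag2_rec u 0 v0.
rewrite laplag2_0 subr0 addr0 /lag1 laguerre0 derivC horner0 mulr0 addr0.
by move=> /eqP; rewrite mulf_eq0 (gt_eqF up) /= => /eqP.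
Qed.

Lemma tail1 : tail r k 1 = 0.
Proof.
have k10 : 0 <= k + 1 by rewrite addr_ge0// ltW.
by rewrite /tail !laplag2_1 ?(ltW k0)//; ring.
Qed.

Lemma sum_exp_le N x : 0 <= x -> \sum_(j < N) x ^+ j / j`!%:R <= expR x.
Proof.
move=> x0; rewrite /expR.
have := @nondecreasing_cvgn_le R (series (exp_coeff x)).
rewrite -(big_mkord xpredT (fun j => x ^+ j / j`!%:R)); apply.
  by apply: nondecreasing_series => i _ _; exact: exp_coeff_ge0.
exact: is_cvg_series_exp_coeff.
Qed.

(** By poisson_mass_le it suffices that 1 / sqrt (i + 1) is at most sqrt k / i if
i <= k and 1 / sqrt k otherwise. *)
Let term_bound j x : 0 <= x ->
  tail r k j.+1 ^+ 2 * (x ^+ j / j.+1`!%:R) <=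
  expR x * (Num.sqrt k * (tail r k j.+1 ^+ 2 / (j.+1%:R * j%:R))
    + (Num.sqrt k)^-1 * (tail r k j.+1 ^+ 2 / j.+1%:R)).
Proof.
move=> x0; case: j => [|j].
  by rewrite tail1 expr0n /= !mul0r !mulr0 addr0 mulr0.
set T := tail r k j.+2 ^+ 2.
have T0 : 0 <= T by exact: sqr_ge0.
have sk : 0 < Num.sqrt k by rewrite sqrtr_gt0.
have sj : 0 < Num.sqrt j.+2%:R :> R by rewrite sqrtr_gt0 ltr0n.
rewrite factS natrM invfM mulrA mulrA (_ : T * x ^+ j.+1 * _ * _ = T / j.+2%:R * (x ^+ j.+1 / j.+1`!%:R)); last by ring.
have TJ : 0 <= T / j.+2%:R by rewrite divr_ge0.
apply: (le_trans (ler_wpM2l TJ (poisson_mass_le j.+1 x0))).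
rewrite [leRHS](_ : _ = T / j.+2%:R * (expR x * (Num.sqrt k / j.+1%:R + (Num.sqrt k)^-1))); last first.
  by have : j.+1%:R != 0 :> R by []; have : j.+2%:R != 0 :> R by []; move: (j.+1%:R) (j.+2%:R) => a b a0 b0; field; rewrite b0 a0 gt_eqF.
apply: ler_wpM2l => //; apply: ler_wpM2l; first exact: expR_ge0.
have A : 0 <= Num.sqrt k / j.+1%:R by rewrite divr_ge0 ?sqrtr_ge0.
have B : 0 <= (Num.sqrt k)^-1 by rewrite invr_ge0 ltW.
case: (leP j.+1%:R k) => jk.
  apply: (@le_trans _ _ (Num.sqrt k / j.+1%:R)); last by rewrite lerDl.
  rewrite ler_pdivlMr// mulrC ler_pdivrMr// -sqrtrM ?(ltW k0)//.
  rewrite -[leLHS]ger0_norm// -sqrtr_sqr.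
  rewrite ler_sqrt ?mulr_ge0 ?(ltW k0)// expr2 ler_pM//.
  by rewrite ler_nat.
apply: (@le_trans _ _ (Num.sqrt k)^-1); last by rewrite lerDr.
rewrite lef_pV2 ?posrE// ler_sqrt//.
by rewrite (le_trans (ltW jk))// ler_nat.
Qed.

(** Apart from the harmless 2^-i part, term_bound reduces the sum to tail_sum1 and
tail_sum2, weighted so that both contribute k^(-3/2). *)
Lemma smoothed_second_moment N x : 0 <= x ->
  \sum_(j < N) smoothed r k j.+1 ^+ 2 * (x ^+ j / j.+1`!%:R) <=
  expR x * (2000 * r ^+ 2 / (k * Num.sqrt k) * (E * D)).
Proof.
move=> x0.
have sk : 0 < Num.sqrt k by rewrite sqrtr_gt0.
have skk : Num.sqrt k * Num.sqrt k = k by rewrite -expr2 sqr_sqrtr// ltW.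
have sk1 : 1 <= Num.sqrt k by rewrite -sqrtr1 ler_sqrt// ltW.
have t1 := tail_sum1 N.
have t2 : \sum_(j < N) tail r k j.+1 ^+ 2 / (j.+1%:R * j%:R) <= 416 * r ^+ 2 / k ^+ 2 * (E * D).
  apply: le_trans (tail_sum2 N.-1); case: N {t1} => [|N] /=; first by rewrite !big_ord0.
  by move: (tail r k) => T; rewrite big_ord_recl /= mulr0 invr0 mulr0 add0r.
have step j : smoothed r k j.+1 ^+ 2 * (x ^+ j / j.+1`!%:R) <=
   2 * r ^+ 2 * (x ^+ j / j`!%:R) + 2 * (tail r k j.+1 ^+ 2 * (x ^+ j / j.+1`!%:R)).
  have p0 : 0 <= x ^+ j / j.+1`!%:R by rewrite divr_ge0// exprn_ge0.
  have pp : x ^+ j / j.+1`!%:R <= x ^+ j / j`!%:R.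
    rewrite ler_wpM2l ?exprn_ge0// lef_pV2 ?posrE ?ltr0n ?fact_gt0// ler_nat factS.
    by rewrite leq_pmull.
  have e : smoothed r k j.+1 = r * 2^-1 ^+ j + - tail r k j.+1.
    by rewrite /smoothed !exprS; field.
  have h2 : (2^-1 ^+ j : R) ^+ 2 <= 1.
    by rewrite expr_le1 ?exprn_ge0// exprn_ile1// invf_le1// ler1n.
  rewrite e; apply: (le_trans (ler_wpM2r p0 (sqD_le _ _))).
  rewrite mulrDl sqrrN exprMn -!(mulrA 2) lerD// ler_pM2l//.
  rewrite -mulrA ler_wpM2l ?sqr_ge0//.
  by apply: le_trans pp; rewrite ler_piMl.
apply: le_trans; first by apply: ler_sum => j _; exact: step.
rewrite big_split /= -!mulr_sumr.
have h1 : 2 * r ^+ 2 * (\sum_(j < N) x ^+ j / j`!%:R) <= 2 * r ^+ 2 * expR x.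
  by apply: ler_wpM2l; [rewrite mulr_ge0// sqr_ge0 | exact: sum_exp_le].
have h2 : \sum_(j < N) tail r k j.+1 ^+ 2 * (x ^+ j / j.+1`!%:R) <=
   expR x * (Num.sqrt k * (416 * r ^+ 2 / k ^+ 2 * (E * D)) + (Num.sqrt k)^-1 * (552 * r ^+ 2 / k * (E * D))).
  apply: le_trans; first by apply: ler_sum => j _; exact: term_bound.
  rewrite -mulr_sumr big_split /= -!mulr_sumr ler_wpM2l ?expR_ge0//.
  by rewrite lerD// ler_wpM2l// ?invr_ge0 sqrtr_ge0.
have e2 : Num.sqrt k * (416 * r ^+ 2 / k ^+ 2 * (E * D)) + (Num.sqrt k)^-1 * (552 * r ^+ 2 / k * (E * D))
   = 968 * r ^+ 2 / (k * Num.sqrt k) * (E * D).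
  move: (E * D) (Num.sqrt k) sk skk => Q s s0 skk'.
  by rewrite -skk'; field; rewrite gt_eqF.
rewrite e2 in h2.
(* the hypothesis on rho makes the main term dominate the 2^-i part *)
have big : 1 <= (k * Num.sqrt k)^-1 * (E * D).
  rewrite ler_pdivlMl ?mulr_gt0// mulr1.
  apply: (@le_trans _ _ (k ^+ 2)).
    rewrite expr2 ler_pM2l// -[leRHS]skk ler_peMr// ltW//.
  apply: le_trans ED; apply: le_trans rhok; rewrite ler_peMr ?sqr_ge0//.
  by rewrite -[leLHS]expR0 ler_expR mulr_ge0 ?(ltW rho0)// divr_ge0// ltW.
have h3 : 2 * r ^+ 2 * expR x <= expR x * (2 * r ^+ 2 / (k * Num.sqrt k) * (E * D)).
  rewrite (_ : expR x * _ = 2 * r ^+ 2 * expR x * ((k * Num.sqrt k)^-1 * (E * D))); last by ring.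
  apply: ler_peMr => //; apply: mulr_ge0; last exact: expR_ge0.
  by rewrite mulr_ge0// sqr_ge0.
apply: (le_trans (lerD (le_trans h1 h3) (ler_wpM2l (ler0n R 2) h2))).
rewrite (_ : 2 * (expR x * _) = expR x * (1936 * r ^+ 2 / (k * Num.sqrt k) * (E * D))); last by ring.
rewrite -mulrDr ler_wpM2l ?expR_ge0//.
set Q := E * D in big *; set w := (k * Num.sqrt k)^-1 in big *.
have : 0 <= r ^+ 2 * (w * Q) by rewrite mulr_ge0 ?sqr_ge0// (le_trans ler01).
rewrite -!mulrA; lra.
Qed.
End SecondMoment.

(** * The functional G on geometrically bounded sequences *)

Section RiskFunctional.
Variable R : realType.
Implicit Types (r t x b V : R) (H : nat -> R).

Lemma geom_bounded_sqr H : geom_bounded H -> geom_bounded (fun i => H i ^+ 2).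
Proof.
move=> [A [B [A0 B0 h]]]; exists (A ^+ 2), (B ^+ 2).
split; rewrite ?sqr_ge0// => i.
rewrite normrX -exprM mulnC exprM -exprMn lerXn2r// ?nnegrE//.
by rewrite mulr_ge0// exprn_ge0.
Qed.

Lemma egf_egs H x : H 0%N = 0 -> egf H x = egs H x.
Proof.
move=> H0; rewrite /egf /egs; congr (limn _); apply/funext => n.
rewrite /pseries /series /=; case: n => [|n]; first by rewrite !big_geq.
by rewrite [RHS]big_ltn// H0 !mul0r add0r.
Qed.

Lemma egf_le H x c : geom_bounded H -> H 0%N = 0 ->
  (forall N, \sum_(j < N) H j.+1 * (x ^+ j / j.+1`!%:R) * x <= c) -> egf H x <= c.
Proof.
move=> gH H0 h; rewrite egf_egs//; apply: limr_le; first exact: cvg_egs.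
apply: nearW => n; rewrite /pseries /series /=.
case: n => [|n]; first by have := h 0%N; rewrite big_ord0 big_geq.
rewrite big_nat_recl//= H0 !mul0r add0r big_mkord.
apply: le_trans (h n); apply: ler_sum => j _.
by rewrite exprS; apply: le_of_eq; ring.
Qed.

Lemma one_sub_exp_le r x : 1 - expR (- r * x) <= r * x.
Proof. by have := @expR_ge1Dx R (- r * x); rewrite mulNr; lra. Qed.

Lemma G_le r t b V H : 1 < r -> 0 < t -> 0 <= b -> 0 <= V ->
  geom_bounded H -> H 0%N = 0 ->
  `|r - H 1%N| <= b ->
  (forall x, 0 <= x ->
    `|expR (- 1 * x) - expR (- (1 + r) * x) - pois_mean H x| <= b * x) ->
  (forall N x, 0 <= x ->
    \sum_(j < N) H j.+1 ^+ 2 * (x ^+ j / j.+1`!%:R) <= expR x * V) ->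
  (G r t H <= ((t * b) ^+ 2 + t * (r + V))%:E)%E.
Proof.
move=> r1 t0 b0 V0 gH H0 h1 hb hV; rewrite /G.
have gH2 := geom_bounded_sqr gH.
have H20 : H 0%N ^+ 2 = 0 by rewrite H0 expr0n.
have egfV x : 0 <= x -> egf (fun i => H i ^+ 2) x <= x * (expR x * V).
  move=> x0; apply: (@egf_le (fun i => H i ^+ 2)) => // N.
  by rewrite -mulr_suml mulrC ler_wpM2l// hV.
have -> : (\sum_(1 <= i <oo) (H i ^+ 2 * t ^+ i / i`!%:R)%:E == +oo)%E = false.
  apply/negbTE; rewrite -ltey.
  apply: (@le_lt_trans _ _ (t * (expR t * V))%:E); last exact: ltry.
  apply: lime_le.
    by apply: is_cvg_nneseries => i _ _; rewrite lee_fin divr_ge0// mulr_ge0 ?sqr_ge0// exprn_ge0// ltW.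
  apply: nearW => n /=; rewrite sumEFin lee_fin.
  case: n => [|n].
    by rewrite big_geq// !mulr_ge0// ?expR_ge0// ltW.
  rewrite big_add1 /= big_mkord.
  apply: le_trans (ler_wpM2l (ltW t0) (hV n t (ltW t0))).
  rewrite mulr_sumr; apply: ler_sum => j _.
  by rewrite (exprS t); apply: le_of_eq; ring.
have hbias p : 0 <= p <= 1 -> 0 <= bias_fun r t H p <= t * b.
  move=> /andP[p0 p1]; rewrite /bias_fun; case: eqVneq => [_|pn].
    by rewrite mulr_ge0 ?(ltW t0)//= ler_pM2l.
  have pp : 0 < p by rewrite lt_def pn.
  rewrite mulr_ge0 ?divr_ge0 ?expR_ge0//=.
  rewrite egf_egs//.
  have x0 : 0 <= p * t by rewrite mulr_ge0// ltW.
  have := hb _ x0; rewrite /pois_mean.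
  have -> : expR (- 1 * (p * t)) - expR (- (1 + r) * (p * t)) - expR (- 1 * (p * t)) * egs H (p * t)
     = expR (- (p * t)) * (1 - expR (- (r * p * t)) - egs H (p * t)).
    rewrite mulN1r !mulrBr mulr1 -expRD; congr (_ - expR _ - _); ring.
  rewrite normrM ger0_norm ?expR_ge0// => h.
  rewrite mulrAC ler_pdivrMr//; apply: le_trans h _.
  by apply: le_of_eq; ring.
have hvar q : 0 <= q <= 1 -> variance_fun r t H q <= t * (r + V).
  move=> /andP[q0 q1]; rewrite /variance_fun; case: eqVneq => [_|qn].
    have := hV 1%N 0 (lexx _); rewrite big_ord1 expr0 expR0 !mul1r invr1 mulr1 => h.
    by rewrite ler_pM2l// lerD2l.
  have qq : 0 < q by rewrite lt_def qn.
  have x0 : 0 <= q * t by rewrite mulr_ge0// ltW.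
  have e1 : expR (- (q * t)) * (1 - expR (- (r * q * t))) <= r * (q * t).
    have h := one_sub_exp_le r (q * t).
    rewrite (_ : - r * (q * t) = - (r * q * t)) in h; last by ring.
    have E1 : expR (- (q * t)) <= 1 by rewrite -[leRHS]expR0 ler_expR oppr_le0.
    have E0 := expR_ge0 (- (q * t)).
    apply: le_trans h; rewrite ler_piMl// subr_ge0 -[leRHS]expR0 ler_expR oppr_le0.
    by rewrite -mulrA mulr_ge0// (le_trans ler01)// ltW.
  have e2 : expR (- (q * t)) * egf (fun i => H i ^+ 2) (q * t) <= q * t * V.
    apply: le_trans (ler_wpM2l (expR_ge0 _) (egfV _ x0)) _.
    rewrite mulrCA (mulrA (expR _)) -expRD addNr expR0 mul1r//.
  rewrite mulrAC ler_pdivrMr// mulrDr.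
  apply: le_trans (lerD e1 e2) _.
  by apply: le_of_eq; ring.
rewrite EFinD; apply: leeD.
  rewrite /Yb expr2 EFinM; set M := ereal_sup _.
  have M0 : (0 <= M)%E.
    apply: (@le_trans _ _ (bias_fun r t H 0)%:E).
      by rewrite lee_fin; have := hbias 0; rewrite lexx ler01 => /(_ isT)/andP[].
    by apply: ereal_sup_ubound; exists 0 => //=; rewrite in_itv/= lexx ler01.
  have M1 : (M <= (t * b)%:E)%E.
    apply: ge_ereal_sup => _ [p /= +] <-; rewrite in_itv/= => /hbias /andP[_ h].
    by rewrite lee_fin.
  by apply: lee_pmul.
apply: ge_ereal_sup => _ [p /= +] <-; rewrite in_itv/= => /hvar h.
by rewrite lee_fin.
Qed.

Lemma smoothed1 r k : 1 < r -> 1 <= k -> smoothed r k 1 = r.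
Proof.
by move=> r1 k1; rewrite /smoothed tail1// !expr1; field.
Qed.

Lemma G_zero_le r t : 1 < r -> 0 < t ->
  (G r t (fun=> 0%R) <= ((t * r) ^+ 2 + t * r)%:E)%E.
Proof.
move=> r1 t0; have r0 : 0 <= r by rewrite ltW// (lt_trans ltr01).
have h := @G_le r t r 0 (fun=> 0); rewrite addr0 in h; apply: h => //.
- exact: (geom_bounded_cst 0).
- by rewrite subr0 ger0_norm.
- move=> x x0; have -> : pois_mean (fun=> 0) x = 0 :> R.
    rewrite (@eq_pois_mean _ _ (fun i => 0 * 1)); last by move=> i; rewrite mul0r.
    by rewrite pois_meanZ ?mul0r//; exact: geom_bounded_cst.
  have -> : expR (- (1 + r) * x) = expR (- 1 * x) * expR (- r * x).
    by rewrite -expRD; congr expR; ring.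
  have h := one_sub_exp_le r x.
  have E0 := expR_ge0 (- 1 * x).
  have E1 : expR (- 1 * x) <= 1 by rewrite -[leRHS]expR0 ler_expR mulN1r oppr_le0.
  have E2 : expR (- r * x) <= 1 by rewrite -[leRHS]expR0 ler_expR mulNr oppr_le0 mulr_ge0.
  rewrite subr0 -[X in X - _]mulr1 -mulrBr ger0_norm ?mulr_ge0 ?subr_ge0//.
  by apply: le_trans h; rewrite ler_piMl// subr_ge0.
- move=> N x x0; rewrite mulr0 big1// => j _.
  by rewrite expr0n mul0r.
Qed.

End RiskFunctional.

(** * The minimum of G *)

Section Rate.
Variable R : realType.
Implicit Types (r t L k : R).

(** The right-hand side of the risk bound without the factor B^2. *)
Definition rate r t : R :=
  Num.min 1 ((1 + r) ^+ 2 / (r * ln t)) ^+ 2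
  * Kfactor r t `^ (2 / (1 + r)) * t `^ (- (2 / (1 + r))).

Lemma Kfactor_ge1 r t : 1 < r -> 1 <= ln t -> 1 <= Kfactor r t.
Proof.
move=> r1 L1; rewrite /Kfactor.
have s1 : 1 <= Num.sqrt (ln t) by rewrite -sqrtr1 ler_sqrt// (le_trans ler01).
set M := Num.min _ _.
have rM : 1 <= (r + 1) * M.
  rewrite /M minEle; case: ifP => _.
    by rewrite ler_pdivlMr ?subr_gt0//; lra.
  by apply: mulr_ege1 => //; lra.
rewrite (_ : (r + 1) * (r + 3) * _ * M = (r + 1) * M * ((r + 3) * Num.sqrt (ln t))); last by ring.
by apply: mulr_ege1 => //; apply: mulr_ege1 => //; lra.
Qed.

Lemma Kfactor_le r t : 1 < r -> r <= ln t -> Kfactor r t <= 8 * ln t ^+ 4.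
Proof.
move=> r1 rL; rewrite /Kfactor; set L := ln t in rL *.
have L1 : 1 < L := lt_le_trans r1 rL.
have sL : Num.sqrt L <= L.
  rewrite -[leRHS]ger0_norm ?(le_trans ler01 (ltW L1))// -sqrtr_sqr ler_sqrt ?sqr_ge0//.
  by rewrite expr2 ler_peMl ?(ltW L1)// (le_trans ler01 (ltW L1)).
set M := Num.min _ _.
have ML : M <= L by rewrite ge_min lexx orbT.
have M0 : 0 <= M.
  by rewrite le_min invr_ge0 subr_ge0 (ltW r1) (le_trans ler01 (ltW L1)).
have s0 := sqrtr_ge0 L.
have -> : 8 * L ^+ 4 = 2 * L * (4 * L) * L * L by ring.
have h1 : (r + 1) * (r + 3) <= 2 * L * (4 * L).
  by apply: ler_pM; lra.
apply: ler_pM => //; first by rewrite mulr_ge0// mulr_ge0//; lra.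
by apply: ler_pM => //; rewrite mulr_ge0//; lra.
Qed.

Lemma pow4_le_exp L : 10 ^+ 6 <= L -> 8 * L ^+ 4 <= expR (L / 4).
Proof.
move=> hL; have L0 : 0 <= L by apply: le_trans hL; rewrite exprn_ge0.
have h := @expR_ge1Dxn R (L / 4) 4 (divr_ge0 L0 (ler0n R 4)).
apply: (@le_trans _ _ ((L / 4) ^+ 5 / 5`!%:R)); last by apply: le_trans h; rewrite lerDr.
rewrite ler_pdivlMr ?ltr0n ?fact_gt0//.
rewrite expr_div_n (_ : 5`! = 120)%N//.
rewrite ler_pdivlMr ?exprn_gt0//.
rewrite [leRHS]exprS (_ : _ * _ * _ = 8 * 120 * 4 ^+ 5 * L ^+ 4); last by ring.
rewrite ler_wpM2r ?exprn_ge0//; apply: le_trans hL.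
lra.
Qed.
(** The three terms bound, in this order, the squared bias, the variance and the
contribution of the unseen species. *)
Let rate_c : R := 3200 + 2000 * 32 + 32.

Lemma ln_div_K r t : 1 < r -> r <= ln t -> 10 ^+ 6 <= ln t -> 0 < t ->
  3 / 4 * ln t <= ln (t / Kfactor r t) <= ln t.
Proof.
move=> r1 rL hL t0.
have L1 : 1 <= ln t := le_trans (ltW r1) rL.
have K1 := Kfactor_ge1 r1 L1.
have K0 : 0 < Kfactor r t := lt_le_trans ltr01 K1.
rewrite ln_div ?posrE// gerBl ln_ge0// andbT.
have : ln (Kfactor r t) <= ln t / 4.
  rewrite -[leRHS]expRK ler_ln ?posrE ?expR_gt0//.
  exact: le_trans (Kfactor_le r1 rL) (pow4_le_exp hL).
lra.
Qed.

(** The parameter k = ln (t / K) turns e^(-2k/(1+r)) into (K / t)^(2/(1+r)). *)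
Lemma rate_ge r t : 1 < r -> r <= ln t -> 0 < t ->
  (1 + r) ^+ 4 / (16 * ln t ^+ 2) * expR (- (1 + r)^-1 * ln (t / Kfactor r t)) ^+ 2
  <= r ^+ 2 * rate r t.
Proof.
move=> r1 rL t0; set L := ln t.
have L1 : 1 <= L := le_trans (ltW r1) rL.
have L0 : 0 < L := lt_le_trans ltr01 L1.
have K0 : 0 < Kfactor r t := lt_le_trans ltr01 (Kfactor_ge1 r1 L1).
have r0 : 0 < r := lt_trans ltr01 r1.
have rp : 0 < 1 + r by rewrite addr_gt0.
rewrite /rate.
have -> : Num.min 1 ((1 + r) ^+ 2 / (r * ln t)) ^+ 2 * Kfactor r t `^ (2 / (1 + r)) * t `^ (- (2 / (1 + r)))
  = Num.min 1 ((1 + r) ^+ 2 / (r * ln t)) ^+ 2 * expR (- (1 + r)^-1 * ln (t / Kfactor r t)) ^+ 2.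
  rewrite /powR (gt_eqF K0) (gt_eqF t0) -mulrA -expRD -expRM_natl.
  congr (_ * expR _); rewrite ln_div ?posrE//; field; exact: lt0r_neq0.
rewrite [leRHS]mulrA; apply: ler_wpM2r; first exact: sqr_ge0.
set y := _ / (r * ln t).
have y0 : 0 <= y by rewrite divr_ge0 ?sqr_ge0// mulr_ge0 ?(ltW r0) ?(ltW L0).
have y4 : y / 4 <= 1.
  rewrite ler_pdivrMr// mul1r /y ler_pdivrMr ?mulr_gt0//.
  have : r * r <= r * L by rewrite ler_pM2l.
  rewrite -/L expr2; nra.
have ym : y / 4 <= Num.min 1 y by rewrite le_min y4 /=; lra.
have y40 : 0 <= y / 4 by rewrite divr_ge0.
have : (y / 4) ^+ 2 <= Num.min 1 y ^+ 2.
  by rewrite lerXn2r// ?nnegrE// (le_trans y40).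
move=> /(ler_wpM2l (sqr_ge0 r)); apply: le_trans.
by apply: le_of_eq; rewrite /y -/L; field; rewrite !gt_eqF.
Qed.

(** If r > ln t then t^(-2/(1+r)) >= e^-2 and every other factor is at least 1. *)
Lemma rate_trivial r t : 1 < r -> ln t < r -> 1 <= ln t -> 0 < t ->
  16^-1 <= rate r t.
Proof.
move=> r1 rL L1 t0; rewrite /rate; set L := ln t.
have L0 : 0 < L := lt_le_trans ltr01 L1.
have r0 : 0 < r := lt_trans ltr01 r1.
have K1 := Kfactor_ge1 r1 L1.
have -> : Num.min 1 ((1 + r) ^+ 2 / (r * L)) = 1.
  apply: min_l; rewrite ler_pdivlMr ?mulr_gt0// mul1r.
  have : r * L <= r * r by rewrite ler_pM2l// ltW.
  by rewrite expr2; nra.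
have hK : 1 <= Kfactor r t `^ (2 / (1 + r)).
  rewrite -[leLHS](powRr0 (Kfactor r t)); apply: ler_powR => //.
  by rewrite divr_ge0// addr_ge0// ltW.
rewrite expr1n mul1r; apply: (@le_trans _ _ (t `^ (- (2 / (1 + r))))); last first.
  by rewrite ler_peMl// powR_ge0.
rewrite /powR (gt_eqF t0).
have e := expR1_le R.
apply: (@le_trans _ _ (expR (- 2))).
  have e2 : expR 2 = expR 1 ^+ 2 :> R by rewrite -expRM_natl mulr1.
  rewrite expRN lef_pV2 ?posrE ?expR_gt0// e2 expr2.
  by have := expR_ge0 (1 : R); nra.
rewrite ler_expR mulNr lerN2 -/L mulrAC ler_pdivrMr; last by lra.
by move: rL; rewrite -/L; lra.
Qed.

(** For r <= ln t the sequence smoothed with k = ln (t / K) is used; the factors of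
K absorb growth_time and the powers of r and ln t in the variance. *)
Lemma exists_good_estimator r t : 1 < r -> 10 ^+ 6 <= ln t -> 0 < t ->
  4 * ln (ln t) <= (r - 1) / (r + 1) * ln t ->
  exists H : nat -> R, (G r t H <= (rate_c * (r ^+ 2 * t ^+ 2 * rate r t))%:E)%E.
Proof.
move=> r1 hL t0 hr; set L := ln t.
have L1 : 1 <= L by apply: le_trans hL; rewrite exprn_ege1// ler1n.
have L0 : 0 < L := lt_le_trans ltr01 L1.
have r0 : 0 < r := lt_trans ltr01 r1.
have t1 : 1 <= t.
  by rewrite -(@ler_ln R) ?posrE// ln1 ltW.
case: (leP r L) => rL; last first.
  exists (fun=> 0); apply: (le_trans (G_zero_le r1 t0)); rewrite lee_fin.
  have h := rate_trivial r1 rL L1 t0.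
  have tr : t * r <= (t * r) ^+ 2.
    by rewrite expr2 ler_peMr ?mulr_ge0 ?(ltW t0) ?(ltW r0)//; apply: mulr_ege1 => //; exact: ltW.
  rewrite (_ : rate_c * _ = rate_c * rate r t * (t * r) ^+ 2); last by ring.
  have : 2 <= rate_c * rate r t by rewrite /rate_c; lra.
  move=> /(ler_wpM2r (sqr_ge0 (t * r))); lra.
have /andP[kL kL'] := ln_div_K r1 rL hL t0.
have K1 := Kfactor_ge1 r1 L1.
have K0 : 0 < Kfactor r t := lt_le_trans ltr01 K1.
have hrate := rate_ge r1 rL t0.
set k := ln (t / Kfactor r t) in kL kL' hrate.
have k1 : 1 <= k.
  by apply: le_trans kL; rewrite -/L; have : 10 ^+ 6 <= L := hL; lra.
have k0 : 0 < k := lt_le_trans ltr01 k1.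
have ek : expR k = t / Kfactor r t by rewrite lnK// posrE divr_gt0.
set rho := (r - 1) / (r + 1) in hr.
have rho0 : 0 < rho by rewrite divr_gt0; lra.
have lnL0 : 0 <= ln L by rewrite ln_ge0.
have rk : 3 * ln L <= rho * k.
  have : rho * (3 / 4 * L) <= rho * k by rewrite ler_pM2l.
  rewrite -/L in hr; lra.
(* the growth condition on r enters here: e^(3 rho k / 4) >= (ln t)^2 *)
have L2 : L ^+ 2 <= expR (3 / 4 * (rho * k)).
  rewrite -{1}(lnK (L0 : L \in Num.pos)) -expRM_natl ler_expR; lra.
have k2 : k ^+ 2 <= L ^+ 2 by rewrite lerXn2r// nnegrE ltW.
have rhok : k ^+ 2 * expR (rho * (k / 4)) <= expR (rho * k).
  apply: (@le_trans _ _ (expR (3 / 4 * (rho * k)) * expR (rho * (k / 4)))).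
    by rewrite ler_wpM2r ?expR_ge0// (le_trans k2).
  by rewrite -expRD ler_expR; apply: le_of_eq; field.
exists (smoothed r k).
set e := expR (- (1 + r)^-1 * k) in hrate.
have e0 : 0 < e by exact: expR_gt0.
have rp : 0 < 1 + r by rewrite addr_gt0.
pose b := 10 * ((1 + r) ^+ 2 / k * e).
pose D := growth_time r k.
pose V := 2000 * r ^+ 2 / (k * Num.sqrt k) * (expR (rho * k) * D).
have sk : 0 < Num.sqrt k by rewrite sqrtr_gt0.
have b0 : 0 <= b by rewrite !mulr_ge0 ?sqr_ge0 ?invr_ge0 ?ltW.
have D0 : 0 <= D.
  rewrite /D /growth_time le_min (ltW k0) /=.
  by apply: divr_ge0; [move: r0 | move: r1]; clear; lra.
have V0 : 0 <= V.
  apply: mulr_ge0; last by rewrite mulr_ge0// expR_ge0.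
  apply: divr_ge0; first by apply: mulr_ge0; [exact: ler0n | exact: sqr_ge0].
  by apply: ltW; exact: mulr_gt0.
apply: (@le_trans _ _ ((t * b) ^+ 2 + t * (r + V))%:E).
  apply: G_le => //.
  - exact: geom_bounded_smoothed (ltW r1) k1.
  - exact: smoothed0.
  - by rewrite smoothed1// subrr normr0.
  - move=> x x0; apply: (le_trans (smoothed_bias (ltW r1) k1 x0)).
    by rewrite -/e /b; apply: le_of_eq; ring.
  - by move=> N x x0; exact: smoothed_second_moment.
rewrite lee_fin.
pose T := (1 + r) ^+ 4 / (16 * L ^+ 2) * e ^+ 2.
have T0 : 0 <= T.
  by rewrite mulr_ge0 ?sqr_ge0// divr_ge0 ?exprn_ge0 ?mulr_ge0 ?sqr_ge0// ltW.
apply: (@le_trans _ _ (rate_c * (t ^+ 2 * T))); last first.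
  have rc0 : 0 <= rate_c by rewrite /rate_c; lra.
  rewrite (_ : r ^+ 2 * t ^+ 2 * _ = t ^+ 2 * (r ^+ 2 * rate r t)); last by ring.
  by apply: ler_wpM2l => //; apply: ler_wpM2l; [exact: sqr_ge0 | exact: hrate].
have kL2 : (k^-1) ^+ 2 <= 2 * (L^-1) ^+ 2.
  rewrite !exprVn -[leLHS]mul1r ler_pdivrMr ?exprn_gt0// mulrAC ler_pdivlMr ?exprn_gt0// mul1r.
  have : (3 / 4 * L) ^+ 2 <= k ^+ 2 by rewrite lerXn2r// nnegrE ?mulr_ge0// ltW.
  have := sqr_ge0 L; rewrite exprMn; lra.
have hbias : (t * b) ^+ 2 <= 3200 * (t ^+ 2 * T).
  have -> : (t * b) ^+ 2 = 100 * (t ^+ 2 * (1 + r) ^+ 4 * e ^+ 2) * (k^-1) ^+ 2.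
    by rewrite /b; ring.
  have -> : 3200 * (t ^+ 2 * T) = 100 * (t ^+ 2 * (1 + r) ^+ 4 * e ^+ 2) * (2 * (L^-1) ^+ 2).
    by rewrite /T; field; rewrite gt_eqF.
  apply: ler_wpM2l => //; apply: mulr_ge0 => //; apply: mulr_ge0; last exact: sqr_ge0.
  by rewrite mulr_ge0 ?sqr_ge0// exprn_ge0// ltW.
have Ee : expR (rho * k) = t / Kfactor r t * e ^+ 2.
  rewrite -ek /e -expRM_natl -expRD; congr expR; rewrite /rho (addrC r 1); field.
  by rewrite gt_eqF.
have e2k : k ^+ 2 <= expR (rho * k).
  apply: le_trans rhok; rewrite ler_peMr ?sqr_ge0// -[leLHS]expR0 ler_expR.
  by apply: mulr_ge0; [exact: ltW | apply: divr_ge0 => //; exact: ltW].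
have te : k ^+ 2 <= t * e ^+ 2.
  apply: (le_trans e2k); rewrite Ee ler_wpM2r ?sqr_ge0// ler_pdivrMr//.
  by rewrite ler_peMr// ltW.
have hr1 : t * r <= 32 * (t ^+ 2 * T).
  have -> : 32 * (t ^+ 2 * T) = t * ((1 + r) ^+ 4 * (2 * (L^-1) ^+ 2) * (t * e ^+ 2)).
    by rewrite /T; field; rewrite gt_eqF.
  rewrite ler_pM2l//.
  have r4 : r <= (1 + r) ^+ 4.
    apply: (@le_trans _ _ (1 + r)); first by rewrite lerDr.
    by rewrite -[leLHS]expr1 ler_weXn2l// lerDl ltW.
  apply: (@le_trans _ _ ((1 + r) ^+ 4 * (k^-1 ^+ 2 * k ^+ 2))).
    by rewrite -exprMn mulVf ?gt_eqF// expr1n mulr1.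
  rewrite -mulrA ler_wpM2l ?exprn_ge0 ?(ltW rp)//.
  by apply: ler_pM => //; rewrite ?sqr_ge0.
pose M := Num.min (r - 1)^-1 L.
have KE : Kfactor r t = (r + 1) * (r + 3) * Num.sqrt L * M by [].
have M0 : 0 < M by rewrite /M lt_min invr_gt0 subr_gt0 r1 L0.
have DM : D <= (r + 1) * M.
  rewrite /D /growth_time /M minEle; case: (leP (r - 1)^-1 L) => h.
    rewrite -minEle ge_min lexx orbT//.
  rewrite -minEle ge_min; apply/orP; left; apply: (le_trans kL').
  rewrite -/L; apply: ler_peMl; first exact: ltW.
  by move: r0; clear; lra.
have sL : 0 < Num.sqrt L by rewrite sqrtr_gt0.
have sLL : Num.sqrt L * Num.sqrt L = L by rewrite -expr2 sqr_sqrtr// ltW.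
have hk : (k * Num.sqrt k)^-1 <= 2 * (L * Num.sqrt L)^-1.
  have h : 2 / 3 * Num.sqrt L <= Num.sqrt k.
    have -> : 2 / 3 * Num.sqrt L = Num.sqrt ((2 / 3) ^+ 2 * L).
      by rewrite sqrtrM ?sqr_ge0// sqrtr_sqr ger0_norm// divr_ge0.
    rewrite ler_sqrt; last exact: ltW.
    by move: kL L0; rewrite -/L; clear; lra.
  have h2 : 3 / 4 * L * (2 / 3 * Num.sqrt L) <= k * Num.sqrt k.
    by apply: ler_pM => //; rewrite mulr_ge0// ltW.
  have p1 : 0 < L * Num.sqrt L by rewrite mulr_gt0.
  rewrite -[leLHS]mul1r ler_pdivrMr ?mulr_gt0// mulrAC ler_pdivlMr// mul1r.
  by move: h2; clear; lra.
have hV : t * V <= 2000 * 32 * (t ^+ 2 * T).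
  have -> : t * V = 2000 * (r ^+ 2 * t ^+ 2 * e ^+ 2) * ((k * Num.sqrt k)^-1 * (D / Kfactor r t)).
    by rewrite /V Ee; field; rewrite !gt_eqF.
  (* the factor min (1 / (r - 1)) (ln t) of K is there to absorb D *)
  have DK : D / Kfactor r t <= (Num.sqrt L)^-1.
    rewrite ler_pdivrMr// KE.
    rewrite (_ : _^-1 * _ = (r + 3) * ((r + 1) * M)); last by field; rewrite gt_eqF.
    apply: (le_trans DM); apply: ler_peMl; last by move: r0; clear; lra.
    by apply: mulr_ge0; [move: r0; clear; lra | exact: ltW].
  have DK0 : 0 <= D / Kfactor r t by rewrite divr_ge0// ltW.
  have -> : 2000 * 32 * (t ^+ 2 * T) =
      2000 * (t ^+ 2 * e ^+ 2) * ((1 + r) ^+ 4 * (2 * (L * Num.sqrt L)^-1 * (Num.sqrt L)^-1)).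
    rewrite -(mulrA 2) -invfM -(mulrA L) sLL /T.
    by field; rewrite gt_eqF.
  rewrite (_ : 2000 * (r ^+ 2 * t ^+ 2 * e ^+ 2) * _ =
    2000 * (t ^+ 2 * e ^+ 2) * (r ^+ 2 * ((k * Num.sqrt k)^-1 * (D / Kfactor r t)))); last by ring.
  apply: ler_wpM2l.
    by apply: mulr_ge0; [exact: ler0n | apply: mulr_ge0; exact: sqr_ge0].
  have kk0 : 0 <= (k * Num.sqrt k)^-1 by rewrite invr_ge0 mulr_ge0// ltW.
  have kd0 := mulr_ge0 kk0 DK0.
  apply: ler_pM => //; [exact: sqr_ge0 | | exact: ler_pM].
  apply: (@le_trans _ _ ((1 + r) ^+ 2)).
    by rewrite lerXn2r// ?nnegrE ?(ltW r0) ?(ltW rp)// lerDr.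
  by rewrite ler_weXn2l// lerDl ltW.
by rewrite mulrDr; move: hbias hr1 hV; rewrite /rate_c; clear; lra.
Qed.
End Rate.

(** * A variance inequality under bounded influence *)

Section Influence.
Variable R : realType.

(** A variance is half the mean squared difference of two independent copies; the
weights may have any total mass. *)
Lemma variance_double_sum (I : finType) (w x : I -> R) :
  2 * ((\sum_i w i) * (\sum_i w i * x i ^+ 2) - (\sum_i w i * x i) ^+ 2) =
  \sum_i \sum_j w i * w j * (x i - x j) ^+ 2.
Proof.
have -> : \sum_i \sum_j w i * w j * (x i - x j) ^+ 2 =
   \sum_i \sum_j ((w i * x i ^+ 2) * w j + w i * (w j * x j ^+ 2)
      - 2 * ((w i * x i) * (w j * x j))).
  by apply: eq_bigr => i _; apply: eq_bigr => j _; ring.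
have dist (a b : I -> R) : (\sum_i a i) * (\sum_j b j) = \sum_i \sum_j a i * b j.
  by rewrite mulr_suml; apply: eq_bigr => i _; rewrite mulr_sumr.
under [RHS]eq_bigr do rewrite sumrB big_split /=.
rewrite sumrB big_split /= -!dist.
have -> : \sum_i \sum_j 2 * ((w i * x i) * (w j * x j)) =
    2 * ((\sum_i w i * x i) * (\sum_j w j * x j)).
  by rewrite dist mulr_sumr; apply: eq_bigr => i _; rewrite mulr_sumr.
by ring.
Qed.

Lemma sqr_sum_le (I : finType) (A : {set I}) (x : I -> R) :
  (\sum_(i in A) x i) ^+ 2 <= #|A|%:R * \sum_(i in A) x i ^+ 2.
Proof.
have h := @variance_double_sum I (fun i => (i \in A)%:R) x.
have e (y : I -> R) : \sum_(i in A) y i = \sum_i (i \in A)%:R * y i.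
  by rewrite big_mkcond; apply: eq_bigr => i _; case: (i \in A); rewrite ?mul1r ?mul0r.
have c : #|A|%:R = \sum_i (i \in A)%:R :> R.
  by rewrite -sum1_card natr_sum big_mkcond; apply: eq_bigr => i _; case: (i \in A).
rewrite !e c -subr_ge0 -(pmulr_rge0 _ (ltr0n R 2)) h.
by apply: sumr_ge0 => i _; apply: sumr_ge0 => j _; rewrite mulr_ge0 ?sqr_ge0// mulr_ge0.
Qed.

Variable M : nat.

(** Integration against a product of weights, one coordinate after the other, as the
induction on coordinates requires. *)
Fixpoint prod_int (ws : seq (nat -> R)) (F : seq nat -> R) : R :=
  if ws is w :: ws' then
    \sum_(v < M) w v * prod_int ws' (fun z => F ((v : nat) :: z))
  else F [::].

Lemma prod_int_sum ws (I : finType) (F : I -> seq nat -> R) :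
  prod_int ws (fun z => \sum_i F i z) = \sum_i prod_int ws (F i).
Proof.
elim: ws F => [//|w ws IH] F /=; rewrite exchange_big /=.
by apply: eq_bigr => v _; rewrite -mulr_sumr -IH.
Qed.

(** The alternative of a weight concentrated at 0 is meant for the types containing
more than B species, which are almost surely not observed. *)
Fixpoint bounded_influence (I : finType) (B : nat) (ws : seq (nat -> R))
    (f : I -> seq nat -> R) : Prop :=
  if ws is w :: ws' then
    ((forall v, (0 < v)%N -> w v = 0) \/
     exists2 A : {set I}, (#|A| <= B)%N &
       forall i, i \notin A -> forall v v' z, f i (v :: z) = f i (v' :: z)) /\
    forall v, bounded_influence B ws' (fun i z => f i (v :: z))
  else True.

(** Induction on the coordinates.  Conditioning on the first coordinate splits the
variance into a mean of conditional variances, handled by induction, and the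
variance of a conditional mean.  In the double sum for the latter, at most B of
the summands differ, so Cauchy-Schwarz costs a factor B.  The inequality is
homogeneous in the masses because truncated Poisson weights do not sum to 1. *)
Lemma prod_int_variance (I : finType) B ws (f : I -> seq nat -> R) :
  (forall w, List.In w ws -> forall v, 0 <= w v) -> bounded_influence B ws f ->
  prod_int ws (fun=> 1) * prod_int ws (fun z => (\sum_i f i z) ^+ 2)
    - (prod_int ws (fun z => \sum_i f i z)) ^+ 2
  <= B%:R * \sum_i (prod_int ws (fun=> 1) * prod_int ws (fun z => f i z ^+ 2)
       - (prod_int ws (f i)) ^+ 2).
Proof.
elim: ws f => [|w ws IH] f w0 inf /=.
  by rewrite mul1r subrr big1 ?mulr0// => i _; rewrite mul1r subrr.
have {}IH v := IH (fun i z => f i (v :: z)) (fun w' h => w0 w' (or_intror h)) (inf.2 v).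
have wv v : 0 <= w v by apply: w0; left.
set m := prod_int ws (fun=> 1) in IH *.
have m0 : 0 <= m.
  rewrite /m; elim: (ws) (fun w' h => w0 w' (or_intror h)) => [//|w' ws' IH'] h' /=.
  apply: sumr_ge0 => v _; rewrite mulr_ge0//; first by apply: h'; left.
  by apply: IH' => w'' h''; apply: h'; right.
pose e i (v : 'I_M) := prod_int ws (fun z => f i ((v : nat) :: z)).
pose q i (v : 'I_M) := prod_int ws (fun z => f i ((v : nat) :: z) ^+ 2).
pose S (v : 'I_M) := \sum_i e i v.
pose Q (v : 'I_M) := prod_int ws (fun z => (\sum_i f i ((v : nat) :: z)) ^+ 2).
have SE (v : 'I_M) : prod_int ws (fun z => \sum_i f i ((v : nat) :: z)) = S v.
  by rewrite prod_int_sum.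
under [X in _ - X ^+ 2]eq_bigr do rewrite SE.
rewrite -mulr_suml.
set a := \sum_(v < M) w v.
have a0 : 0 <= a by apply: sumr_ge0.
have h1 : a * (m * (\sum_(v < M) w v * Q v) - \sum_(v < M) w v * S v ^+ 2) <=
   a * (B%:R * \sum_i (m * (\sum_(v < M) w v * q i v) - \sum_(v < M) w v * e i v ^+ 2)).
  apply: ler_wpM2l => //.
  have -> : m * (\sum_(v < M) w v * Q v) - \sum_(v < M) w v * S v ^+ 2 = \sum_(v < M) w v * (m * Q v - S v ^+ 2).
    by rewrite mulr_sumr -sumrB; apply: eq_bigr => v _; ring.
  have -> : B%:R * (\sum_i (m * (\sum_(v < M) w v * q i v) - \sum_(v < M) w v * e i v ^+ 2)) =
     \sum_(v < M) w v * (B%:R * \sum_i (m * q i v - e i v ^+ 2)).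
    under [RHS]eq_bigr do rewrite mulrCA mulr_sumr.
    rewrite -[RHS]mulr_sumr exchange_big /=; congr (_ * _); apply: eq_bigr => i _.
    by rewrite mulr_sumr -sumrB; apply: eq_bigr => v _; ring.
  apply: ler_sum => v _; apply: ler_wpM2l => //.
  by have := IH v; rewrite SE.
have h2 : a * (\sum_(v < M) w v * S v ^+ 2) - (\sum_(v < M) w v * S v) ^+ 2 <=
   B%:R * \sum_i (a * (\sum_(v < M) w v * e i v ^+ 2) - (\sum_(v < M) w v * e i v) ^+ 2).
  rewrite -(ler_pM2l (ltr0n R 2)) [leRHS]mulrCA [X in _ <= _ * X]mulr_sumr.
  have vds (x : 'I_M -> R) : 2 * (a * (\sum_(v < M) w v * x v ^+ 2) - (\sum_(v < M) w v * x v) ^+ 2)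
     = \sum_(v < M) \sum_(v' < M) w v * w v' * (x v - x v') ^+ 2.
    exact: (variance_double_sum (fun v : 'I_M => w v)).
  rewrite vds; under [X in _ <= _ * X]eq_bigr do rewrite vds.
  rewrite [X in _ <= _ * X]exchange_big /= [leRHS]mulr_sumr; apply: ler_sum => v _.
  rewrite [X in _ <= _ * X]exchange_big /= [leRHS]mulr_sumr; apply: ler_sum => v' _.
  rewrite -mulr_sumr [leRHS]mulrCA.
  case: inf.1 => [deg|[A AB indep]].
    have [->|vv'] := eqVneq v v'.
      rewrite (subrr (S v')) expr0n /= mulr0 mulr_ge0 ?mulr_ge0 ?sumr_ge0// => i _.
      exact: sqr_ge0.
    have -> : w v * w v' = 0.
      have [v0|v0] := posnP v; last by rewrite deg ?mul0r.
      rewrite mulrC deg ?mul0r// lt0n; apply: contra vv' => /eqP v0'.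
      by apply/eqP/val_inj; rewrite /= v0 v0'.
    by rewrite !mul0r.
  apply: ler_wpM2l; first by rewrite mulr_ge0.
  have eA i : i \notin A -> e i v - e i v' = 0.
    move=> iA; rewrite /e (_ : (fun z => f i ((v : nat) :: z)) = (fun z => f i ((v' : nat) :: z))) ?subrr//.
    by apply/funext => z; exact: indep.
  have -> : S v - S v' = \sum_(i in A) (e i v - e i v').
    rewrite /S -sumrB [LHS](bigID (mem A)) /= [X in _ + X]big1 ?addr0// => i; exact: eA.
  apply: (le_trans (sqr_sum_le _ _)); apply: ler_pM => //.
  - by apply: sumr_ge0 => i _; exact: sqr_ge0.
  - by rewrite ler_nat.
  - rewrite [leRHS](bigID (mem A)) /= lerDl.
    by apply: sumr_ge0 => i _; exact: sqr_ge0.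
rewrite (_ : a * m * _ - _ = a * (m * (\sum_(v < M) w v * Q v) - \sum_(v < M) w v * S v ^+ 2)
   + (a * (\sum_(v < M) w v * S v ^+ 2) - (\sum_(v < M) w v * S v) ^+ 2)); last by ring.
apply: (le_trans (lerD h1 h2)).
rewrite mulrCA -mulrDr; apply: ler_wpM2l => //.
rewrite mulr_sumr -big_split /=; apply: ler_sum => i _.
by apply: le_of_eq; rewrite /q /e; ring.
Qed.
End Influence.

(** * Poisson splitting *)

Section FinitePartition.
Context (R : realType) (d : measure_display) (T : measurableType d)
  (P : {measure set T -> \bar R}).

Lemma measure_split_fin (I : finType) (f : T -> I) (B : set T) :
  measurable B -> (forall i, measurable (f @^-1` [set i])) ->
  P B = (\sum_i P (B `&` f @^-1` [set i]))%E.
Proof.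
move=> mB mf.
have {1}-> : B = \bigcup_(i in [set` index_enum I]) (B `&` f @^-1` [set i]).
  apply/seteqP; split => [w Bw|w [i _ []]//].
  by exists (f w) => //=; exact: mem_index_enum.
rewrite measure_fin_bigcup//.
- by rewrite -fsbig_seq ?index_enum_uniq.
- apply/trivIsetP => i j _ _ /eqP ij; apply/seteqP; split => // w [[_ /= fi] [_ /= fj]].
  by apply: ij; rewrite -fi -fj.
- by move=> i _; exact: measurableI.
Qed.

Lemma measure_split_nat (f : T -> nat) (B : set T) :
  measurable B -> (forall i, measurable (f @^-1` [set i])) ->
  P B = (\sum_(0 <= i <oo) P (B `&` f @^-1` [set i]))%E.
Proof.
move=> mB mf.
have {1}-> : B = \bigcup_i (B `&` f @^-1` [set i]).
  apply/seteqP; split => [w Bw|w [i _ []]//].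
  by exists (f w).
apply: measure_semi_bigcup.
- by move=> i; exact: measurableI.
- apply/trivIsetP => i j _ _ /eqP ij; apply/seteqP; split => // w [[_ /= fi] [_ /= fj]].
  by apply: ij; rewrite -fi -fj.
- by apply: bigcupT_measurable => i; exact: measurableI.
Qed.
End FinitePartition.

Section PoissonSplitting.
Context (R : realType) (S : countType) (mu : probability {fset S} R) (t t' : R)
  (d : measure_display) (Omega : measurableType d) (P : probability Omega R)
  (X : nat -> {RV P >-> {fset S}}) (n m : {RV P >-> nat}).
Hypotheses (t0 : 0 < t) (t0' : 0 < t') (he : expeditions mu t t' X n m).
Variables (I : finType) (tau : {fset S} -> I).
Implicit Types (a b k : nat) (c : I -> nat) (E : nat -> set {fset S}).

Definition type_prob (i : I) : R := fine (mu (tau @^-1` [set i])).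

Let mX a (E : set {fset S}) : measurable (X a @^-1` E).
Proof. exact: measurable_funPTI. Qed.

Let mN (f : {RV P >-> nat}) (F : set nat) : measurable (f @^-1` F).
Proof. exact: measurable_funPTI. Qed.

Let mu_fin (E : set {fset S}) : mu E = (fine (mu E))%:E.
Proof. by rewrite fineK// fin_num_measure. Qed.

Lemma type_prob_ge0 i : 0 <= type_prob i.
Proof. exact: fine_ge0. Qed.

Lemma type_prob_sum : \sum_i type_prob i = 1.
Proof.
apply: EFin_inj; rewrite -sumEFin.
under eq_bigr do rewrite -mu_fin.
rewrite -(@probability_setT _ _ _ mu).
rewrite (@measure_split_fin R _ _ mu I tau setT measurableT (fun _ => Logic.I)).
by apply: eq_bigr => i _; rewrite setTI.
Qed.

(** Independence of the draws from index a on, with the probability alpha recorded, so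
that a block of draws can be adjoined to A. *)
Definition free_from (a : nat) (A : set Omega) (alpha : R) : Prop :=
  measurable A /\ forall k E,
    P (A `&` \bigcap_(j in `I_k) X (a + j)%N @^-1` E j) =
    (alpha * \prod_(j < k) fine (mu (E j)))%:E.

Definition block_count a b (w : Omega) (i : I) : nat :=
  \sum_(j < b) (tau (X (a + j)%N w) == i).

(** The probability that a block of i.i.d. draws has the type counts c. *)
Definition multinomial c : R :=
  (\sum_i c i)`!%:R * \prod_i (type_prob i ^+ c i / (c i)`!%:R).

(** The recurrence on the type of the last draw. *)
Lemma multinomial_rec c b : (\sum_i c i)%N = b.+1 ->
  multinomial c = \sum_(i | (0 < c i)%N)
     type_prob i * multinomial (fun j => c j - (j == i))%N.
Proof.
move=> cb; rewrite /multinomial cb factS natrM.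
have cbR : b.+1%:R = \sum_i (c i)%:R :> R by rewrite -cb natr_sum.
rewrite cbR -mulrA mulr_suml [RHS]big_mkcond /=; apply: eq_bigr => i _.
case: (posnP (c i)) => [->|ci]; first by rewrite mul0r.
have sumE : (\sum_j (c j - (j == i)))%N = b.
  apply/eqP; rewrite -(eqn_add2r 1) (addn1 b) -cb (bigD1 i)//= [X in _ == X](bigD1 i)//= eqxx.
  rewrite addnAC subnK//; apply/eqP; congr addn; apply: eq_bigr => j ji.
  by rewrite (negbTE ji) subn0.
rewrite sumE mulrCA [RHS]mulrCA; congr (_ * _).
rewrite (bigD1 i)//= [X in _ = _ * X](bigD1 i)//= eqxx.
rewrite !mulrA; congr (_ * _); last first.
  by apply: eq_bigr => j ji; rewrite (negbTE ji) subn0.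
case: (c i) ci => // k _; rewrite subn1 /= factS natrM exprS.
have f0 : k`!%:R != 0 :> R by rewrite pnatr_eq0 -lt0n fact_gt0.
have k0 : k.+1%:R != 0 :> R by rewrite pnatr_eq0.
by move: (k.+1%:R) k0 (k`!%:R) f0 => x x0 y y0; field; rewrite x0 y0.
Qed.

Lemma measurable_block_count a b i v : measurable [set w | block_count a b w i = v].
Proof.
elim: b v => [|b IH] v.
  have [->|v0] := eqVneq v 0%N.
    rewrite (_ : [set w | _] = setT)//; apply/seteqP; split => // w _ /=.
    by rewrite /block_count big_ord0.
  rewrite (_ : [set w | _] = set0)//; apply/seteqP; split => // w /=.
  by rewrite /block_count big_ord0 => e; move: v0; rewrite -e eqxx.
pose A := X (a + b)%N @^-1` (tau @^-1` [set i]).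
have mA : measurable A by exact: mX.
have bcS w : block_count a b.+1 w i = (block_count a b w i + (tau (X (a + b)%N w) == i))%N.
  by rewrite /block_count big_ord_recr.
rewrite (_ : [set w | _] = (A `&` [set w | (block_count a b w i).+1 = v]) `|`
   (~` A `&` [set w | block_count a b w i = v])); last first.
  apply/seteqP; split => w /=; rewrite bcS.
    case: eqVneq => [e|/eqP ne]; rewrite ?addn1 ?addn0 => h; first by left.
    by right.
  by move=> [[/= -> <-]|[/= /eqP/negbTE -> <-]]; rewrite ?eqxx ?addn1 ?addn0.
apply: measurableU; apply: measurableI => //.
  case: v => [|v]; first by rewrite (_ : [set w | _] = set0)//; apply/seteqP; split.
  rewrite (_ : [set w | _] = [set w | block_count a b w i = v]); first exact: IH.
  by apply/seteqP; split => w /=; [move=> [] | move=> ->].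
exact: measurableC.
Qed.

(** Induction on the length of the block, splitting on the type of its last draw. *)
Lemma free_from_block a b c A alpha : free_from a A alpha -> (\sum_i c i)%N = b ->
  free_from (a + b) (A `&` [set w | forall i, block_count a b w i = c i])
    (alpha * multinomial c).
Proof.
move=> [mA hA].
have mB a' b' (c' : I -> nat) : measurable [set w | forall i, block_count a' b' w i = c' i].
  rewrite (_ : [set w | _] = \bigcap_(i in [set: I]) [set w | block_count a' b' w i = c' i]).
    by apply: fin_bigcap_measurable => // i _; exact: measurable_block_count.
  by apply/seteqP; split => [w h i _|w h i] //=; exact: h.
elim: b c => [|b IH] c cb.
  split; first exact: measurableI.
  move=> k E; rewrite addn0.
  have c0 i : c i = 0%N by apply/eqP; move/eqP: cb; rewrite sum_nat_eq0 => /forallP/(_ i).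
  have -> : A `&` [set w | forall i, block_count a 0 w i = c i] = A.
    by apply/seteqP; split => [w []//|w Aw]; split => // i; rewrite /block_count big_ord0 c0.
  rewrite hA; congr (_ * _)%:E; rewrite /multinomial cb fact0 mul1r big1 ?mulr1// => i _.
  by rewrite c0 expr0 fact0 divr1.
split; first exact: measurableI.
move=> k E.
have bcS w i : block_count a b.+1 w i = (block_count a b w i + (tau (X (a + b)%N w) == i))%N.
  by rewrite /block_count big_ord_recr.
set Z := (A `&` _ `&` _).
have mZ : measurable Z.
  apply: measurableI; first exact: measurableI.
  by apply: fin_bigcap_measurable; [exact: finite_II | move=> j _].
rewrite (@measure_split_fin _ _ _ P I (fun w => tau (X (a + b)%N w)))//; last first.
  by move=> i; exact: (mX _ (tau @^-1` [set i])).
pose E' i j := if j is j'.+1 then E j' else tau @^-1` [set i].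
have term i : P (Z `&` (fun w => tau (X (a + b)%N w)) @^-1` [set i]) =
    (if (0 < c i)%N then alpha * (\prod_(j < k) fine (mu (E j))) *
       (type_prob i * multinomial (fun j => c j - (j == i))%N) else 0)%:E.
  case: posnP => ci.
    rewrite (_ : _ `&` _ = set0) ?measure0//; apply/seteqP; split => // w [[[_ /= h] _] /= ti].
    by have := h i; rewrite bcS ti eqxx addn1 ci.
  have sumE : (\sum_j (c j - (j == i)))%N = b.
    apply/eqP; rewrite -(eqn_add2r 1) (addn1 b) -cb (bigD1 i)//= [X in _ == X](bigD1 i)//= eqxx.
    rewrite addnAC subnK//; apply/eqP; congr addn; apply: eq_bigr => j ji.
    by rewrite (negbTE ji) subn0.
  have [_ /(_ k.+1 (E' i))] := IH _ sumE.
  rewrite big_ord_recl /= => h.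
  rewrite (_ : _ `&` _ = A `&` [set w | forall j, block_count a b w j = (c j - (j == i))%N]
     `&` \bigcap_(j in `I_k.+1) X (a + b + j)%N @^-1` E' i j).
    rewrite h /E' -/(type_prob i); congr (_%:E).
    by ring.
  apply/seteqP; split => w.
    move=> [[[Aw /= hc] hE] /= ti]; split; first split=> //= j.
      by rewrite -hc bcS ti eq_sym; case: eqVneq => // _; rewrite ?addn1 ?subn1 ?addn0 ?subn0.
    move=> [|j] /= jk; first by rewrite addn0.
    by have := hE j jk; rewrite addnS -addSn addnS.
  move=> [[Aw /= hc] hE].
  have ti : tau (X (a + b)%N w) = i by have := hE 0%N (ltn0Sn k); rewrite /= addn0.
  split=> //; split; first split=> //= j.
    rewrite bcS ti hc eq_sym; case: eqVneq => [<-|_]; rewrite ?subn0 ?addn0//.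
    by rewrite subn1 addn1 prednK.
  move=> j /= jk; have := hE j.+1; rewrite /= ltnS => /(_ jk).
  by rewrite addnS -addSn addnS.
rewrite [LHS](eq_bigr _ (fun i _ => term i)).
rewrite sumEFin -big_mkcond /= -mulr_sumr -(multinomial_rec cb).
by congr (_%:E); ring.
Qed.

Definition pois (x : R) j : R := expR (- x) * (x ^+ j / j`!%:R).

Definition counts (xs : seq {fset S}) (i : I) : nat := count (fun A => tau A == i) xs.

Lemma sum_counts xs : (\sum_i counts xs i)%N = size xs.
Proof.
elim: xs => [|A xs IH]; first by rewrite big1.
rewrite /= -IH /counts /= big_split /= (bigD1 (tau A))//= eqxx big1 ?addn0// => i.
by rewrite eq_sym => /negbTE ->.
Qed.

Lemma counts_block a b w i : counts [seq X j w | j <- iota a b] i = block_count a b w i.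
Proof.
elim: b => [|b IH]; first by rewrite /block_count big_ord0.
rewrite -addn1 iotaD map_cat /counts count_cat -/(counts _ i) IH /=.
by rewrite addn0 /block_count [in RHS]addn1 big_ord_recr.
Qed.

(** Poisson splitting.  Given the sizes of the two samples the counts are
multinomial, and the Poisson factor t^k e^-t / k! distributes over the types
because the type probabilities add up to 1. *)
Lemma joint_counts c c' :
  P [set w | (forall i, counts (first_sample X n w) i = c i) /\
             (forall i, counts (second_sample X n m w) i = c' i)] =
  (\prod_i (pois (t * type_prob i) (c i) * pois (t' * type_prob i) (c' i)))%:E.
Proof.
pose k := (\sum_i c i)%N; pose l := (\sum_i c' i)%N.
have f0 : free_from 0 (n @^-1` [set k] `&` m @^-1` [set l]) (poisson_pmf t k * poisson_pmf t' l).
  split; first exact: measurableI.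
  move=> K E; rewrite (indep he) (law_n he) (law_m he) [RHS]EFinM EFinM.
  congr (_ * _)%E.
  rewrite -prodEFin; apply: eq_bigr => j _.
  by rewrite (law_X he) -mu_fin.
have f1 := free_from_block f0 (erefl k).
have [mf2 f2] := free_from_block f1 (erefl l).
have := f2 0%N (fun=> setT); rewrite II0 bigcap_set0 setIT big_ord0 mulr1.
rewrite (_ : (_ `&` [set w | forall i, block_count _ l w i = _]) = [set w | (forall i, counts (first_sample X n w) i = c i) /\
             (forall i, counts (second_sample X n m w) i = c' i)]); last first.
  apply/seteqP; split => w.
    move=> [[[/= nk ml] h] h']; split; move=> i.
      by rewrite /first_sample nk counts_block h.
    by rewrite /second_sample nk ml -/k -[X in iota X _]add0n counts_block h'.
  move=> [h h'].
  have nk : n w = k.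
    rewrite -[LHS](size_iota 0) -(size_map (fun j => X j w)) -sum_counts.
    by apply: eq_bigr => i _; exact: h.
  have ml : m w = l.
    rewrite -[LHS](size_iota (n w)) -(size_map (fun j => X j w)) -sum_counts.
    by apply: eq_bigr => i _; exact: h'.
  split; first split => //= i.
    by rewrite -h /first_sample nk counts_block.
  by move=> i; rewrite -h' /second_sample nk ml -[X in iota X _]add0n counts_block.
move=> ->; congr (_%:E).
have split_pois (x : R) (x0 : 0 < x) (b : I -> nat) :
    poisson_pmf x (\sum_i b i) * multinomial b = \prod_i pois (x * type_prob i) (b i).
  rewrite /poisson_pmf x0 /multinomial.
  have f0' : (\sum_i b i)`!%:R != 0 :> R by rewrite pnatr_eq0 -lt0n fact_gt0.
  rewrite (_ : x ^+ _ * _ * _ * _ = expR (- x) * (x ^+ (\sum_i b i) * \prod_i (type_prob i ^+ b i / (b i)`!%:R))); last first.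
    rewrite [LHS]mulrA.
    by move: (_`!%:R) f0' => y y0; move: (\prod_i _) (x ^+ _) (expR _) => p1 p2 p3; field.
  rewrite [RHS]big_split /=; congr (_ * _).
    rewrite -expR_sum; congr expR.
    by rewrite sumrN -mulr_sumr type_prob_sum mulr1.
  rewrite -prodrXr -big_split /=; apply: eq_bigr => i _.
  by rewrite exprMn mulrA.
by rewrite big_split /= -!split_pois// -/k -/l; ring.
Qed.

(** Every event about the two samples is a countable union of cylinders. *)
Lemma measurable_sample (U : set (seq {fset S} * seq {fset S})) :
  measurable [set w | U (first_sample X n w, second_sample X n m w)].
Proof.
pose F w := (first_sample X n w, second_sample X n m w).
rewrite (_ : [set w | _] = \bigcup_z (F @^-1` [set z] `&` [set _ | U z])); last first.
  by apply/seteqP; split => [w Uw|w [z _ [/= <-]]//]; exists (F w).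
apply: countable_bigcupT_measurable => [|[xs ys]]; first exact: countableP.
have [Uz|nUz] := pselect (U (xs, ys)); last first.
  by rewrite (_ : _ `&` _ = set0)//; apply/seteqP; split => // w [].
rewrite (_ : [set _ | _] = setT) ?setIT; last by apply/seteqP; split.
rewrite (_ : F @^-1` _ = n @^-1` [set size xs] `&` m @^-1` [set size ys] `&`
  \bigcap_(j in `I_(size xs + size ys)) X j @^-1` [set nth fset0 (xs ++ ys) j]).
  by apply: measurableI; [exact: measurableI | apply: fin_bigcap_measurable => //; exact: finite_II].
apply/seteqP; split => w.
  rewrite /F /= => -[xsE ysE].
  have nE : size xs = n w by rewrite -xsE size_map size_iota.
  have mE : size ys = m w by rewrite -ysE size_map size_iota.
  split => // j /= jl.
  rewrite -xsE -ysE -map_cat -iotaD (nth_map 0%N) ?size_iota -?nE -?mE//.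
  by rewrite nth_iota.
move=> [[/= nE mE] h]; rewrite /F; congr pair.
  apply: (@eq_from_nth _ fset0); rewrite size_map size_iota// => j jn.
  rewrite (nth_map 0%N) ?size_iota// nth_iota// add0n.
  have := h j; rewrite /= nth_cat -nE jn; apply.
  by apply: (leq_trans jn); exact: leq_addr.
apply: (@eq_from_nth _ fset0); rewrite size_map size_iota// => j jm.
rewrite (nth_map 0%N) ?size_iota// nth_iota//.
have := h (n w + j)%N; rewrite /= nth_cat nE [(_ + j < size xs)%N]ltnNge leq_addr /= addKn; apply.
by rewrite ltn_add2l -mE.
Qed.
End PoissonSplitting.

(** * Second moments of sums of dependent errors *)

Section Truncation.
Context (R : realType) (d : measure_display) (Omega : measurableType d)
  (P : probability Omega R) (Z : Type) (z : Omega -> Z).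
Hypothesis mz : forall U : set Z, measurable (z @^-1` U).

Lemma measurable_sample_fun d' (Y : sigmaRingType d') (F : Z -> Y) (D : set Omega) :
  measurable D -> measurable_fun D (fun w => F (z w)).
Proof. by move=> mD _ A _; apply: measurableI => //; exact: (mz (F @^-1` A)). Qed.

Lemma expectation_cst (c : R) : (\int[P]_w c%:E = c%:E)%E.
Proof.
transitivity (c%:E * P setT)%E; first exact: integral_cst.
by rewrite probability_setT mule1.
Qed.

Variables (J : Type) (cnt : J -> Z -> nat) (wt : J -> nat -> R).
Implicit Types (js : seq J) (M : nat).

Definition count_profile js (x : Z) : seq nat := [seq cnt j x | j <- js].

(** On this event only finitely many values occur, and expectations are finite sums. *)
Definition below M js : set Omega := [set w | all (fun j => cnt j (z w) < M)%N js].

(** The joint law of the counts, relative to an event A of probability alpha so that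
the coordinates can be peeled off one at a time. *)
Definition product_law js (A : set Omega) (alpha : R) : Prop :=
  measurable A /\ forall vs, size vs = size js ->
    P (A `&` [set w | count_profile js (z w) = vs]) =
    (alpha * \prod_(jv <- zip js vs) wt jv.1 jv.2)%:E.

Lemma measurable_below M js : measurable (below M js).
Proof. exact: (mz (fun x => all (fun j => cnt j x < M)%N js)). Qed.

Lemma truncated_integral M js A alpha (phi : seq nat -> R) : product_law js A alpha ->
  (\int[P]_(w in A `&` below M js) (phi (count_profile js (z w)))%:E =
   (alpha * prod_int M (map wt js) phi)%:E)%E.
Proof.
elim: js A alpha phi => [|j js IH] A alpha phi [mA hA].
  have := hA [::] erefl; rewrite big_nil mulr1.
  rewrite (_ : [set w | _] = setT); last by apply/seteqP; split.
  rewrite setIT => PA.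
  rewrite (_ : _ `&` _ = A); last by apply/seteqP; split => [w []|w Aw].
  transitivity ((phi [::])%:E * P A)%E; first exact: (integral_cst P mA (phi [::])%:E).
  by rewrite PA /= -EFinM mulrC.
pose Av (v : nat) := A `&` [set w | cnt j (z w) = v] `&` below M js.
have mv (v : nat) : measurable (A `&` [set w | cnt j (z w) = v]).
  by apply: measurableI => //; exact: (mz (fun x => cnt j x = v)).
have -> : A `&` below M (j :: js) = \big[setU/set0]_(v <- iota 0 M) Av v.
  rewrite -bigcup_seq; apply/seteqP; split => w.
    move=> [Aw /= /andP[jM jsM]]; exists (cnt j (z w)) => //=.
    by rewrite mem_iota.
  move=> [v /=]; rewrite mem_iota add0n /= => vM [[Aw /= jv] jsM]; split => //=.
  by apply/andP; split=> //; rewrite jv.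
rewrite integral_bigsetU_EFin.
- rewrite /= mulr_sumr -sumEFin -(big_mkord xpredT (fun v => (alpha * (wt j v * prod_int M (map wt js) (fun z0 => phi (v :: z0))))%:E)) /index_iota subn0.
  apply: eq_bigr => v _.
  rewrite mulrA -(IH (A `&` [set w | cnt j (z w) = v])).
    apply: eq_integral => w; rewrite inE => -[[_ /= <-] _]; by [].
  split => // vs svs.
  have := hA (v :: vs); rewrite /= svs => /(_ erefl).
  rewrite big_cons /= mulrA => <-; congr (P _).
  by apply/seteqP; split => w /=; [move=> [[Aw <-] <-] | move=> [Aw [<- <-]]].
- by move=> v; apply: measurableI => //; exact: measurable_below.
- exact: iota_uniq.
- apply/trivIsetP => v v' _ _ /eqP vv'; apply/seteqP; split => // w [[[_ /= e] _] [[_ /= e'] _]].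
  by apply: vv'; rewrite -e -e'.
- rewrite (_ : EFin \o _ = fun w => (phi (count_profile (j :: js) (z w)))%:E)//.
  apply: (measurable_sample_fun (fun x => (phi (count_profile (j :: js) x))%:E)).
  apply: bigsetU_measurable => v _.
  by apply: measurableI => //; exact: measurable_below.
Qed.

Lemma cvg_below js (g : Omega -> \bar R) w :
  (g \_ (below M js)) w @[M --> \oo] --> g w.
Proof.
apply: cvg_near_cst.
exists (\sum_(j <- js) (cnt j (z w))).+1 => // M /= hM.
rewrite patchE mem_set//= /below /=.
elim: js hM => [//|j js IH]; rewrite big_cons => hM /=; apply/andP; split.
  by apply: leq_trans hM; rewrite ltnS leq_addr.
by apply: IH; apply: leq_trans hM; rewrite ltnS leq_addl.
Qed.

(** prod_int_variance on the event that all the counts are below M, then M tends to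
infinity.  The mass and the first moments converge by domination, the second
moment of the sum by monotonicity, which also covers an infinite limit. *)
Lemma second_moment_le (I : finType) B js (f : I -> seq nat -> R) (a e : I -> R) :
  (forall j v, 0 <= wt j v) -> product_law js setT 1 ->
  bounded_influence B (map wt js) f ->
  (forall i, \int[P]_w ((f i (count_profile js (z w))) ^+ 2)%:E = (a i)%:E)%E ->
  (forall i, \int[P]_w (f i (count_profile js (z w)))%:E = (e i)%:E)%E ->
  (\int[P]_w ((\sum_i f i (count_profile js (z w))) ^+ 2)%:E <=
   (B%:R * (\sum_i a i) + (\sum_i e i) ^+ 2)%:E)%E.
Proof.
move=> wt0 law inf ha he.
have mS (F : Z -> \bar R) : measurable_fun setT (fun w => F (z w)).
  exact: measurable_sample_fun.
have trunc M phi : (\int[P]_w ((fun w => (phi (count_profile js (z w)))%:E) \_ (below M js)) w =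
    (prod_int M (map wt js) phi)%:E)%E.
  by rewrite -integral_mkcond -[X in integral _ X]setTI (truncated_integral M phi law) mul1r.
have mP M (phi : seq nat -> R) : measurable_fun setT ((fun w => (phi (count_profile js (z w)))%:E) \_ (below M js)).
  apply/(measurable_restrictT _ (measurable_below _ _)).
  by apply: (@measurable_sample_fun _ _ (fun x => (phi (count_profile js x))%:E)); exact: measurable_below.
have dom (phi : seq nat -> R) b l : (\int[P]_w ((phi (count_profile js (z w))) ^+ 2)%:E = b%:E)%E ->
   (\int[P]_w (phi (count_profile js (z w)))%:E = l%:E)%E ->
   prod_int M (map wt js) phi @[M --> \oo] --> l.
  move=> hb hl.
  have int2 : P.-integrable setT (fun w => (1 + (phi (count_profile js (z w))) ^+ 2)%:E).
    apply/integrableP; split; first exact: (mS (fun x => (1 + phi (count_profile js x) ^+ 2)%:E)).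
    under eq_integral do rewrite gee0_abs ?lee_fin ?addr_ge0 ?sqr_ge0// EFinD.
    rewrite ge0_integralD//; last 2 first.
    - by move=> w _; rewrite lee_fin sqr_ge0.
    - exact: (mS (fun x => (phi (count_profile js x) ^+ 2)%:E)).
    by rewrite hb expectation_cst -EFinD ltry.
  have [] := @dominated_convergence _ _ _ P setT measurableT
    (fun M => (fun w => (phi (count_profile js (z w)))%:E) \_ (below M js))
    (fun w => (phi (count_profile js (z w)))%:E) _ _ _ _ int2 _ => //.
  - exact: (mS (fun x => (phi (count_profile js x))%:E)).
  - by apply: aeW => w _; exact: cvg_below.
  - apply: aeW => w M _; rewrite patchE; case: ifP => _; last first.
      by rewrite abse0 lee_fin addr_ge0// sqr_ge0.
    rewrite lee_fin; move: (phi _) => x.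
    rewrite ler_norml; have := sqr_ge0 (x + 1/2); have := sqr_ge0 (x - 1/2); lra.
  move=> _ _; rewrite hl (_ : (fun M => _) = EFin \o (fun M => prod_int M (map wt js) phi)).
    by move/fine_cvgP => [].
  by apply/funext => M; rewrite trunc.
have mono M (phi : seq nat -> R) b : (\int[P]_w ((phi (count_profile js (z w))) ^+ 2)%:E = b%:E)%E ->
   prod_int M (map wt js) (fun v => phi v ^+ 2) <= b.
  move=> hb; rewrite -lee_fin -hb -(trunc M (fun v => phi v ^+ 2)) -integral_mkcond.
  apply: ge0_subset_integral => //; first exact: measurable_below.
    exact: (mS (fun x => (phi (count_profile js x) ^+ 2)%:E)).
  by move=> w _; rewrite lee_fin sqr_ge0.
pose ws := map wt js.
have one : (\int[P]_w (((fun=> 1 : R) (count_profile js (z w))) ^+ 2)%:E = 1%:E)%E.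
  by rewrite expr1n expectation_cst.
have m1c : prod_int M ws (fun=> 1) @[M --> \oo] --> (1 : R).
  by apply: (dom (fun=> 1) 1 1 one); rewrite expectation_cst.
pose s M := prod_int M ws (fun v => \sum_i f i v).
have sc : s @ \oo --> \sum_i e i.
  rewrite /s; under eq_fun do rewrite prod_int_sum.
  elim: (index_enum I) => [|i l IH].
    rewrite big_nil (_ : (fun M => _) = fun=> 0); first exact: cvg_cst.
    by apply/funext => M; rewrite big_nil.
  rewrite big_cons (_ : (fun M => _) =
     (fun M => prod_int M ws (f i)) \+ (fun M => \sum_(j <- l) prod_int M ws (f j))).
    by apply: cvgD => //; exact: dom (ha i) (he i).
  by apply/funext => M; rewrite big_cons.
have main M : prod_int M ws (fun=> 1) * prod_int M ws (fun v => (\sum_i f i v) ^+ 2) <=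
    B%:R * (\sum_i a i) + s M ^+ 2.
  have wsp w : List.In w ws -> forall v, 0 <= w v.
    rewrite /ws; elim: (js) => [//|j l IH] /= [<-|]; last exact: IH.
    exact: wt0.
  have := prod_int_variance M wsp inf.
  rewrite -lerBlDr => /le_trans; apply; apply: ler_wpM2l => //.
  apply: ler_sum => i _; rewrite lerBlDr; apply: ler_wpDr; first exact: sqr_ge0.
  have m1 : prod_int M ws (fun=> 1) <= 1.
    by have := mono M (fun=> 1) _ one; rewrite expr1n.
  have a1 := mono M _ _ (ha i).
  have a0 : 0 <= prod_int M ws (fun v => f i v ^+ 2).
    rewrite -lee_fin -(trunc M (fun v => f i v ^+ 2)) -integral_mkcond.
    by apply: integral_ge0 => w _; rewrite lee_fin sqr_ge0.
  by apply: le_trans a1; rewrite -[leRHS]mul1r; exact: ler_wpM2r.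
pose F w := ((\sum_i f i (count_profile js (z w))) ^+ 2)%:E.
have F0 w : (0 <= F w)%E by rewrite lee_fin sqr_ge0.
have Fc : ((prod_int M ws (fun v => (\sum_i f i v) ^+ 2))%:E @[M --> \oo] --> \int[P]_w F w)%E.
  rewrite (_ : (fun M => _) = fun M => \int[P]_w (F \_ (below M js)) w)%E; last first.
    by apply/funext => M; rewrite -(trunc M (fun v => (\sum_i f i v) ^+ 2)).
  rewrite (_ : (\int[P]_w F w)%E = (\int[P]_w limn (fun M => (F \_ (below M js)) w))%E); last first.
    by apply: eq_integral => w _; rewrite (cvg_lim _ (@cvg_below js F w)).
  apply: cvg_monotone_convergence => //.
  - by move=> M; exact: (mP M (fun v => (\sum_i f i v) ^+ 2)).
  - by move=> M w _; rewrite patchE; case: ifP.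
  - move=> w _ M M' MM'; rewrite !patchE; case: ifP => [|_]; last by case: ifP.
    rewrite !inE => b; rewrite mem_set//.
    move: b; rewrite /below /=; apply: sub_all => j /leq_trans; exact.
have lhsc : ((prod_int M ws (fun=> 1))%:E * (prod_int M ws (fun v => (\sum_i f i v) ^+ 2))%:E
    @[M --> \oo] --> 1 * \int[P]_w F w)%E.
  apply: cvgeM => //.
    by rewrite /mule_def; case: (\int[P]_w F w)%E => [x| |] //; exact: oner_neq0.
  by apply: cvg_EFin => //; exact: nearW.
have rhsc : ((B%:R * (\sum_i a i) + s M ^+ 2)%:E @[M --> \oo] -->
    (B%:R * (\sum_i a i) + (\sum_i e i) ^+ 2)%:E)%E.
  apply: cvg_EFin; first exact: nearW.
  apply: cvgD; first exact: cvg_cst.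
  by rewrite expr2; under eq_fun do rewrite expr2; apply: cvgM.
rewrite -[leLHS]mul1e -(cvg_lim _ lhsc)// -(cvg_lim _ rhsc)//.
apply: lee_lim; [by apply/cvg_ex; eexists; exact: lhsc| by apply/cvg_ex; eexists; exact: rhsc|].
by apply: nearW => M; rewrite -EFinM lee_fin.
Qed.
End Truncation.

(** * Counts of sets by type and by species *)

Section Tally.
Variables (R : realType) (k : nat).
Local Notation J := (bool * {set 'I_k})%type.
Implicit Types (i : 'I_k) (b : bool) (js : seq J) (vs : seq nat).

(** The number of sets containing species i in sample b, read off the counts vs of
the types js. *)
Definition species_tally b i js vs : nat :=
  (\sum_(jv <- zip js vs | (jv.1.1 == b) && (i \in jv.1.2)) jv.2)%N.

Lemma species_tally_cons b i (j : J) js v vs :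
  species_tally b i (j :: js) (v :: vs) =
  ((if (j.1 == b) && (i \in j.2) then v else 0) + species_tally b i js vs)%N.
Proof. by rewrite /species_tally /= big_cons; case: ifP. Qed.

(** The count of a type only enters the tallies of the species that it contains. *)
Lemma species_tally_influence (D : nat -> nat -> R) B js (wt : J -> nat -> R) (a a' : 'I_k -> nat) :
  (forall (j : J) v, (B < #|j.2|)%N -> (0 < v)%N -> wt j v = 0) ->
  bounded_influence B (map wt js)
    (fun i vs => D (a i + species_tally false i js vs)%N (a' i + species_tally true i js vs)%N).
Proof.
move=> wt0; elim: js a a' => [//|j js IH] a a' /=; split.
  have [jB|jB] := ltnP B #|j.2|; first by left => v; exact: wt0.
  right; exists j.2 => // i ij v v' vs.
  by rewrite !species_tally_cons (negbTE ij) !andbF.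
move=> v.
rewrite (_ : (fun _ _ => _) = fun i vs =>
  D ((a i + (if (j.1 == false) && (i \in j.2) then v else 0)) + species_tally false i js vs)%N
    ((a' i + (if (j.1 == true) && (i \in j.2) then v else 0)) + species_tally true i js vs)%N).
  exact: IH.
by apply/funext => i; apply/funext => vs; rewrite !species_tally_cons !addnA.
Qed.

Lemma species_tally_profile (S : countType) (tau : {fset S} -> {set 'I_k}) (xs : bool -> seq {fset S}) b i :
  species_tally b i (enum {: J}) [seq counts tau (xs j.1) j.2 | j <- enum {: J}] =
  count (fun A => i \in tau A) (xs b).
Proof.
rewrite /species_tally -{1}(map_id (enum {: J})) zip_map big_map big_enum_cond /=.
rewrite -(pair_big_dep (fun b' => b' == b) (fun b' (T : {set 'I_k}) => i \in T) (fun b' (T : {set 'I_k}) => counts tau (xs b') T)) /=.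
rewrite big_pred1_eq; elim: (xs b) => [|A l IH]; first by rewrite big1.
rewrite /counts /= big_split /= -/(counts _ _) IH; congr addn.
case: (boolP (i \in tau A)) => iA.
  rewrite (bigD1 (tau A))//= eqxx big1 // => T /andP[_]; by rewrite eq_sym => /negbTE ->.
by rewrite big1// => T iT; case: eqVneq => // e; rewrite e iT in iA.
Qed.
End Tally.

Section PoissonTransfer.
Context (R : realType) (S : countType) (mu : probability {fset S} R) (t t' : R)
  (d : measure_display) (Omega : measurableType d) (P : probability Omega R)
  (X : nat -> {RV P >-> {fset S}}) (n m : {RV P >-> nat}).
Hypotheses (t0 : 0 < t) (t0' : 0 < t') (he : expeditions mu t t' X n m).

Definition sample (w : Omega) : bool -> seq {fset S} :=
  fun b => if b then second_sample X n m w else first_sample X n w.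

Lemma measurable_samples (U : set (bool -> seq {fset S})) : measurable (sample @^-1` U).
Proof.
exact: (measurable_sample X n m (fun z => U (fun b => if b then z.2 else z.1))).
Qed.

Section Types.
Variables (I : finType) (tau : {fset S} -> I).

Definition type_count (j : bool * I) (x : bool -> seq {fset S}) := counts tau (x j.1) j.2.

Definition type_weight (j : bool * I) : nat -> R :=
  pois ((if j.1 then t' else t) * type_prob mu tau j.2).

Lemma sample_product_law :
  product_law P sample type_count type_weight (enum {: bool * I}) setT 1.
Proof.
split => // vs svs; rewrite setTI mul1r.
pose c j := nth 0%N vs (index j (enum {: bool * I})).
have vsE : vs = map c (enum {: bool * I}).
  apply: (@eq_from_nth _ 0%N) => [|i]; first by rewrite size_map.
  rewrite svs => li.
  have [j0] : exists j0 : bool * I, true.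
    by case: (enum _) li => // j0; exists j0.
  by rewrite (nth_map j0)// /c index_uniq// enum_uniq.
rewrite [in RHS]vsE -[X in zip X _]map_id zip_map big_map big_enum /=.
rewrite -(pair_big xpredT xpredT (fun b T => type_weight (b, T) (c (b, T)))) /=.
rewrite big_bool /= mulrC -big_split /=.
have := joint_counts t0 t0' he tau (fun i => c (false, i)) (fun i => c (true, i)).
move=> <-; congr (P _); apply/seteqP; split => w /=.
  rewrite vsE => /eq_in_map h; split => i.
    exact: (h (false, i) (mem_enum _ _)).
  exact: (h (true, i) (mem_enum _ _)).
move=> [h h']; rewrite vsE; apply: eq_map => -[[] i]; rewrite /type_count /=; [exact: h'|exact: h].
Qed.
End Types.

Lemma pois_ge0 (x : R) j : 0 <= x -> 0 <= pois x j.
Proof. by move=> x0; rewrite mulr_ge0 ?expR_ge0// divr_ge0 ?exprn_ge0. Qed.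

Lemma series_pois (x : R) : series (pois x) @ \oo --> (1 : R).
Proof.
rewrite (_ : series _ = fun N => expR (- x) * series (exp_coeff x) N); last first.
  apply/funext => N; rewrite /series /= mulr_sumr; apply: eq_bigr => i _; by rewrite /pois /exp_coeff.
rewrite -(expRxMexpNx_1 x) mulrC; apply: cvgMr; exact: is_cvg_series_exp_coeff.
Qed.

(** Summing out a Poisson coordinate. *)
Lemma marginal (A : set Omega) (f : Omega -> nat) (x alpha : R) : 0 <= x -> 0 <= alpha ->
  measurable A -> (forall v, measurable (f @^-1` [set v])) ->
  (forall v, P (A `&` f @^-1` [set v]) = (alpha * pois x v)%:E) -> P A = alpha%:E.
Proof.
move=> x0 a0 mA mf h; rewrite (measure_split_nat P mA mf).
rewrite (@eq_eseriesr _ _ (fun v => (alpha * pois x v)%:E)); last by move=> v _; exact: h.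
have c : series (fun v => alpha * pois x v) @ \oo --> alpha.
  rewrite (_ : series _ = fun N => alpha * series (pois x) N).
    by rewrite -[X in _ --> X]mulr1; apply: cvgMr; exact: series_pois.
  by apply/funext => N; rewrite /series /= mulr_sumr.
rewrite -[RHS]/(EFin alpha); apply: cvg_lim => //.
rewrite (_ : (fun N => _) = EFin \o series (fun v => alpha * pois x v)).
  by apply: cvg_EFin => //; exact: nearW.
by apply/funext => N; rewrite /= /series /= sumEFin.
Qed.

Section Predicate.
Variable h : pred {fset S}.

Definition pred_prob : R := fine (mu [set A | h A]).

Local Notation N w := (count h (sample w false)).
Local Notation N' w := (count h (sample w true)).

Let mz (U : set (bool -> seq {fset S})) : measurable [set w | U (sample w)].
Proof. exact: measurable_samples. Qed.

Lemma pred_prob_ge0 : 0 <= pred_prob.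
Proof. exact: fine_ge0. Qed.

(** Poisson splitting into the sets satisfying h and the others, the latter being
summed out. *)
Lemma joint_counts_pred a b :
  P [set w | N w = a /\ N' w = b] = (pois (t * pred_prob) a * pois (t' * pred_prob) b)%:E.
Proof.
pose q := type_prob mu h false.
have q0 : 0 <= q by exact: type_prob_ge0.
have p0 := pred_prob_ge0.
have pE : type_prob mu h true = pred_prob by [].
have tp x : 0 <= x -> 0 <= t * x by apply: mulr_ge0; exact: ltW.
have tp' x : 0 <= x -> 0 <= t' * x by apply: mulr_ge0; exact: ltW.
apply: (@marginal _ (fun w => counts h (sample w false) false) (t * q)).
- exact: tp.
- by do ?[exact: tp | exact: tp' | apply: pois_ge0 | apply: mulr_ge0].
- exact: (mz (fun x => count h (x false) = a /\ count h (x true) = b)).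
- by move=> v; exact: (mz (fun x => counts h (x false) false = v)).
move=> c; apply: (@marginal _ (fun w => counts h (sample w true) false) (t' * q)).
- exact: tp'.
- by do ?[exact: tp | exact: tp' | apply: pois_ge0 | apply: mulr_ge0].
- exact: (mz (fun x => (count h (x false) = a /\ count h (x true) = b) /\ counts h (x false) false = c)).
- by move=> v; exact: (mz (fun x => counts h (x true) false = v)).
move=> e.
have := joint_counts t0 t0' he h (fun i => if i then a else c) (fun i => if i then b else e).
rewrite big_bool /= pE -/q => H.
transitivity ((pois (t * pred_prob) a * pois (t' * pred_prob) b * (pois (t * q) c * pois (t' * q) e))%:E); last by congr (_%:E); ring.
rewrite -H; congr (P _).
have cE (xs : seq {fset S}) : counts h xs true = count h xs.
  by apply: eq_count => A; rewrite eqb_id.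
apply/seteqP; split => w /=.
  by rewrite -!cE => -[[[<- <-] <-] <-]; split; case.
move=> [H1 H2]; rewrite -!cE; split; last exact: (H2 false).
by split; [split; [exact: (H1 true) | exact: (H2 true)] | exact: (H1 false)].
Qed.

Lemma first_count_pred a : P [set w | N w = a] = (pois (t * pred_prob) a)%:E.
Proof.
have p0 := pred_prob_ge0.
apply: (@marginal _ (fun w => N' w) (t' * pred_prob)).
- by rewrite mulr_ge0// ltW.
- by rewrite pois_ge0// mulr_ge0// ltW.
- exact: (mz (fun x => count h (x false) = a)).
- by move=> v; exact: (mz (fun x => count h (x true) = v)).
by move=> b; rewrite -joint_counts_pred.
Qed.

Lemma new_pred : P [set w | N w = 0%N /\ (0 < N' w)%N] =
  (expR (- (t * pred_prob)) * (1 - expR (- (t' * pred_prob))))%:E.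
Proof.
have e1 : P [set w | N w = 0%N /\ N' w = 0%N] = (expR (- (t * pred_prob)) * expR (- (t' * pred_prob)))%:E.
  by rewrite joint_counts_pred /pois !expr0 fact0 divr1 !mulr1.
have e2 : P [set w | N w = 0%N] = (expR (- (t * pred_prob)))%:E.
  by rewrite first_count_pred /pois expr0 fact0 divr1 mulr1.
have : P [set w | N w = 0%N] = (P [set w | N w = 0%N /\ N' w = 0%N] +
    P [set w | N w = 0%N /\ (0 < N' w)%N])%E.
  rewrite -measureU; last 3 first.
  - exact: (mz (fun x => count h (x false) = 0%N /\ count h (x true) = 0%N)).
  - exact: (mz (fun x => count h (x false) = 0%N /\ (0 < count h (x true))%N)).
  - by apply/seteqP; split => // w [[_ /= e] [_]]; rewrite e.
  congr (P _); apply/seteqP; split => w /=; last by move=> [[]|[]].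
  by case: (posnP (N' w)) => e ->; [left|right].
rewrite e1 e2; set x := P _; case: x => [x| |] // [] e.
by congr (_%:E); move: e; move: (expR _) (expR _) => y y' e; rewrite mulrBr mulr1 {1}e; ring.
Qed.

Lemma pois_expectation (phi : nat -> R) :
  cvgn (series (fun a => `|phi a| * pois (t * pred_prob) a)) ->
  P.-integrable setT (fun w => (phi (N w))%:E) /\
  (\int[P]_w (phi (N w))%:E = (limn (series (fun a => phi a * pois (t * pred_prob) a)))%:E)%E.
Proof.
have p0 : 0 <= t * pred_prob by rewrite mulr_ge0 ?pred_prob_ge0// ltW.
move=> cv.
have setE : [set: Omega] = \bigcup_a [set w | N w = a].
  by apply/seteqP; split => // w _; exists (N w).
have mN a : measurable [set w | N w = a] by exact: (mz (fun x => count h (x false) = a)).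
have tr : trivIset [set: nat] (fun a => [set w | N w = a]).
  by apply/trivIsetP => a b _ _ /eqP ab; apply/seteqP; split => // w [/= e e']; apply: ab; rewrite -e -e'.
have piece (psi : nat -> R) a : (\int[P]_(w in [set w | N w = a]) (psi (N w))%:E =
    (psi a * pois (t * pred_prob) a)%:E)%E.
  transitivity (\int[P]_(w in [set w | N w = a]) (psi a)%:E)%E.
    by apply: eq_integral => w; rewrite inE /= => ->.
  transitivity ((psi a)%:E * P [set w | N w = a])%E; first exact: integral_cst.
  by rewrite first_count_pred -EFinM.
have mfun (psi : nat -> R) : measurable_fun setT (fun w => (psi (N w))%:E).
  exact: (measurable_sample_fun mz (fun x => (psi (count h (x false)))%:E)).
have EFin_series (u : nat -> R) : cvgn (series u) -> (\sum_(0 <= a <oo) (u a)%:E = (limn (series u))%:E)%E.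
  move=> cu; apply: cvg_lim => //.
  rewrite (_ : (fun N => _) = EFin \o series u).
    by apply: cvg_EFin => //; exact: nearW.
  by apply/funext => N; rewrite /= /series /= sumEFin.
have int : P.-integrable setT (fun w => (phi (N w))%:E).
  apply/integrableP; split; first exact: mfun.
  rewrite (_ : (\int[P]_w _)%E = (\int[P]_(w in \bigcup_a [set w | N w = a]) (`|phi (N w)|)%:E)%E); last by rewrite -setE.
  rewrite ge0_integral_bigcup//; last first.
    by rewrite -setE; exact: (mfun (fun a => `|phi a|)).
  rewrite (@eq_eseriesr _ _ (fun a => (`|phi a| * pois (t * pred_prob) a)%:E)); last first.
    by move=> a _; exact: (piece (fun a => `|phi a|)).
  by rewrite EFin_series// ltry.
split => //; rewrite setE integral_bigcup -?setE//.
rewrite -EFin_series; last first.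
  apply: normed_cvg.
  have -> : [normed series (fun a => phi a * pois (t * pred_prob) a)] =
      series (fun a => `|phi a| * pois (t * pred_prob) a); last exact: cv.
  by congr series; apply/funext => a; rewrite /= normrM (ger0_norm (pois_ge0 _ p0)).
by apply: eq_eseriesr => a _; exact: (piece phi).
Qed.
End Predicate.
End PoissonTransfer.

(** * The error made on one species *)

Section EGF.
Variable R : realType.
Implicit Types (F H : nat -> R) (r t x c : R).

Lemma limn_series_pois F x : F 0%N = 0 -> cvgn (series (fun a => F a * pois x a)) ->
  limn (series (fun a => F a * pois x a)) = expR (- x) * egf F x.
Proof.
move=> F0 cv.
have -> : egf F x = limn (fun N => expR x * series (fun a => F a * pois x a) N).
  rewrite /egf; congr (limn _); apply/funext => N; rewrite /series /= mulr_sumr.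
  case: N => [|N]; first by rewrite !big_geq.
  rewrite [RHS]big_ltn// F0 mul0r mulr0 add0r; apply: eq_bigr => i _.
  rewrite /pois [RHS](_ : _ = (expR x * expR (- x)) * (F i / i`!%:R * x ^+ i)); last by ring.
  by rewrite expRxMexpNx_1 mul1r.
by rewrite limZr// mulrA (mulrC (expR _)) expRxMexpNx_1 mul1r.
Qed.

Lemma egf_zero F : egf F 0 = 0 :> R.
Proof.
rewrite /egf (_ : (fun N => _) = fun=> 0); first exact: lim_cst.
apply/funext => N; rewrite big_nat big1// => i /andP[i1 _].
by rewrite expr0n gtn_eqF// mulr0.
Qed.

Lemma cvg_sqr_series H t x : H 0%N = 0 -> 0 <= x <= t ->
  ((\sum_(1 <= i <oo) (H i ^+ 2 * t ^+ i / i`!%:R)%:E < +oo)%E) ->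
  cvgn (series (fun a => H a ^+ 2 * pois x a)).
Proof.
move=> H0 /andP[x0 xt] fin.
have t0 : 0 <= t by exact: le_trans xt.
have u0 i : 0 <= H i ^+ 2 * t ^+ i / i`!%:R.
  by rewrite divr_ge0// mulr_ge0 ?sqr_ge0 ?exprn_ge0.
apply: (@series_le_cvg _ _ (fun i => H i ^+ 2 * t ^+ i / i`!%:R)) => //.
- by move=> i; rewrite mulr_ge0 ?sqr_ge0 ?pois_ge0.
- move=> i; rewrite -mulrA; apply: ler_wpM2l; first exact: sqr_ge0.
  apply: (@le_trans _ _ (1 * (x ^+ i / i`!%:R))).
    apply: ler_wpM2r; first by rewrite divr_ge0 ?exprn_ge0.
    by rewrite -[leRHS]expR0 ler_expR oppr_le0.
  by rewrite mul1r ler_wpM2r// ?invr_ge0// lerXn2r.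
- apply: nnseries_is_cvg => //.
  rewrite nneseries_recl//; last by move=> i _; rewrite lee_fin.
  by rewrite H0 expr0n /= !mul0r add0e.
Qed.

Lemma cvg_abs_series H x : 0 <= x -> cvgn (series (fun a => H a ^+ 2 * pois x a)) ->
  cvgn (series (fun a => `|H a| * pois x a)).
Proof.
move=> x0 cv.
apply: (@series_le_cvg _ _ (fun a => (1 + H a ^+ 2) * pois x a)).
- by move=> i; rewrite mulr_ge0 ?pois_ge0.
- by move=> i; rewrite mulr_ge0 ?addr_ge0 ?sqr_ge0 ?pois_ge0.
- move=> i; apply: ler_wpM2r; first exact: pois_ge0.
  rewrite ler_norml; have := sqr_ge0 (H i + 1/2); have := sqr_ge0 (H i - 1/2); lra.
rewrite (_ : series _ = (series (pois x) \+ series (fun a => H a ^+ 2 * pois x a))).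
  by apply: is_cvgD => //; apply: cvgP; exact: series_pois.
apply/funext => N; rewrite /series /= -big_split /=; apply: eq_bigr => i _.
by rewrite mulrDl mul1r.
Qed.

(** Yb is the square of the extended supremum of bias_fun; finiteness of G makes
both suprema real. *)
Lemma G_bounds r t H c : 0 < r -> 0 < t -> (G r t H <= c%:E)%E ->
  (\sum_(1 <= i <oo) (H i ^+ 2 * t ^+ i / i`!%:R)%:E < +oo)%E /\
  exists b v, [/\ 0 <= b, 0 <= v, b ^+ 2 + v <= c &
    forall p, 0 <= p <= 1 -> bias_fun r t H p <= b /\ variance_fun r t H p <= v].
Proof.
move=> r0 t0; rewrite /G; case: ifPn => [_|fin].
  by rewrite leye_eq.
move=> Gc; split; first by rewrite ltey.
move: Gc; rewrite /Yb; set M := ereal_sup _ => /=.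
rewrite /Yv; set V := ereal_sup _.
have Mp (p : R) : 0 <= p <= 1 -> ((bias_fun r t H p)%:E <= M)%E.
  by move=> p01; apply: ereal_sup_ubound; exists p => //=; rewrite in_itv.
have Vp (p : R) : 0 <= p <= 1 -> ((variance_fun r t H p)%:E <= V)%E.
  by move=> p01; apply: ereal_sup_ubound; exists p => //=; rewrite in_itv.
have i0 : ((0 : R) <= 0) && ((0 : R) <= 1) by rewrite lexx ler01.
have M0 : (0 <= M)%E.
  apply: le_trans (Mp 0 i0); rewrite lee_fin /bias_fun eqxx.
  by rewrite mulr_ge0// ltW.
have V0 : (0 <= V)%E.
  apply: le_trans (Vp 0 i0); rewrite lee_fin /variance_fun eqxx.
  by rewrite mulr_ge0 ?addr_ge0 ?sqr_ge0// ltW.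
case: M M0 Mp => [b| |]; rewrite ?lee_fin// => b0 Mp; last first.
  by rewrite mulyy; case: V V0 Vp.
case: V V0 Vp => [v| |]; rewrite ?lee_fin// => v0 Vp.
move=> h; exists b, v; split => // p p01.
by have := Mp p p01; have := Vp p p01; rewrite !lee_fin.
Qed.
End EGF.

Section SpeciesError.
Context (R : realType) (S : countType) (mu : probability {fset S} R) (r t : R)
  (d : measure_display) (Omega : measurableType d) (P : probability Omega R)
  (X : nat -> {RV P >-> {fset S}}) (n m : {RV P >-> nat}).
Hypotheses (r0 : 0 < r) (t0 : 0 < t) (he : expeditions mu t (r * t) X n m).
Variable H : nat -> R.
Hypothesis H0 : H 0%N = 0.
Hypothesis Hfin : (\sum_(1 <= i <oo) (H i ^+ 2 * t ^+ i / i`!%:R)%:E < +oo)%E.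

(** H(N_s) - 1{N_s = 0 < N'_s}, the contribution of one species to the error. *)
Definition count_error (a a' : nat) : R := H a - ((a == 0%N) && (0 < a')%N)%:R.

Variable h : pred {fset S}.
Local Notation N w := (count h (sample X n m w false)).
Local Notation N' w := (count h (sample X n m w true)).
Let p := pred_prob mu h.
Let p0 : 0 <= p. Proof. exact: pred_prob_ge0. Qed.
Let p1 : p <= 1.
Proof. by rewrite -lee_fin fineK ?fin_num_measure// probability_le1. Qed.
Let t0' : 0 < r * t. Proof. exact: mulr_gt0. Qed.
Let x0 : 0 <= t * p. Proof. by rewrite mulr_ge0// ltW. Qed.

Let mz (U : set (bool -> seq {fset S})) : measurable [set w | U (sample X n m w)].
Proof. exact: measurable_samples. Qed.

Let cv2 : cvgn (series (fun a => H a ^+ 2 * pois (t * p) a)).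
Proof. by apply: (cvg_sqr_series H0 _ Hfin); rewrite x0 ler_piMr// ltW. Qed.

Let cv1 := cvg_abs_series x0 cv2.

Let new : set Omega := [set w | N w = 0%N /\ (0 < N' w)%N].
Let mnew : measurable new.
Proof. exact: (mz (fun x => count h (x false) = 0%N /\ (0 < count h (x true))%N)). Qed.

Let newE w : ((N w == 0%N) && (0 < N' w)%N)%:R = \1_new w :> R.
Proof.
rewrite indicE; congr (_%:R); congr nat_of_bool.
by apply/andP/idP => [[/eqP a b]|]; rewrite inE /new /=; [split|move=> [-> ->]].
Qed.

Let int_new : (\int[P]_w (\1_new w)%:E = (expR (- (t * p)) * (1 - expR (- (r * t * p))))%:E)%E.
Proof. by rewrite integral_indic// setIT; exact: (new_pred t0 t0' he h). Qed.

Lemma count_error_mean :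
  (\int[P]_w (count_error (N w) (N' w))%:E =
   (expR (- (t * p)) * (egf H (t * p) - (1 - expR (- (r * t * p)))))%:E)%E.
Proof.
have [int1 E1] := pois_expectation t0 t0' he cv1.
under eq_integral do rewrite /count_error newE EFinB.
rewrite integralB_EFin//; last first.
  apply: integrable_indic => //; by rewrite setIT.
rewrite E1 int_new limn_series_pois//; last first.
  apply: normed_cvg.
  have -> : [normed series (fun a => H a * pois (t * p) a)] =
      series (fun a => `|H a| * pois (t * p) a); last exact: cv1.
  by congr series; apply/funext => a; rewrite /= normrM (ger0_norm (pois_ge0 _ x0)).
by rewrite -EFinB -mulrBr.
Qed.

(** The cross term vanishes because H(0) = 0. *)
Lemma count_error_sqr :
  (\int[P]_w ((count_error (N w) (N' w)) ^+ 2)%:E =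
   (expR (- (t * p)) * (1 - expR (- (r * t * p)) + egf (fun i => H i ^+ 2) (t * p)))%:E)%E.
Proof.
have cv2' : cvgn (series (fun a => `|H a ^+ 2| * pois (t * p) a)).
  by under eq_fun do rewrite ger0_norm ?sqr_ge0//.
have [int2 E2] := @pois_expectation _ _ _ _ _ _ _ _ _ _ _ t0 t0' he h (fun a => H a ^+ 2) cv2'.
transitivity (\int[P]_w (((H (N w)) ^+ 2)%:E + (\1_new w)%:E))%E.
  apply: eq_integral => w _; rewrite -EFinD -newE /count_error; congr (_%:E).
  case: eqVneq => [-> /=|_]; last by rewrite subr0 addr0.
  by case: (0 < N' w)%N; rewrite H0 ?expr0n /= ?subr0 ?sub0r ?sqrrN ?expr1n ?add0r ?addr0 ?expr0n.
rewrite ge0_integralD//; last 3 first.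
- by move=> w _; rewrite lee_fin sqr_ge0.
- exact: (measurable_sample_fun mz (fun x => ((H (count h (x false))) ^+ 2)%:E)).
- by apply/measurable_EFinP; exact: measurable_indic.
rewrite E2 int_new limn_series_pois ?H0 ?expr0n// -EFinD.
by congr (_%:E); rewrite [RHS]mulrDr addrC.
Qed.

(** Both moments carry a factor p; they vanish with p, where bias_fun and
variance_fun take their limiting values. *)
Lemma species_moments b v : 0 <= b -> 0 <= v ->
  (forall q, 0 <= q <= 1 -> bias_fun r t H q <= b /\ variance_fun r t H q <= v) ->
  exists a e, [/\ (\int[P]_w ((count_error (N w) (N' w)) ^+ 2)%:E = a%:E)%E,
    (\int[P]_w (count_error (N w) (N' w))%:E = e%:E)%E, a <= v * p & `|e| <= b * p].
Proof.
move=> b0 v0 hbv.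
eexists; eexists; split; [exact: count_error_sqr|exact: count_error_mean| |].
  have [pE|pn] := eqVneq p 0.
    by rewrite pE !mulr0 oppr0 expR0 egf_zero subrr addr0 mulr0.
  have [_] := hbv p (introT andP (conj p0 p1)).
  have pp : 0 < p by rewrite lt_def pn.
  rewrite /variance_fun (negbTE pn) -(ler_pM2r pp); apply: le_trans.
  have -> : r * t * p = r * p * t by rewrite mulrAC.
  have -> : t * p = p * t by exact: mulrC.
  apply: le_of_eq.
  by rewrite [RHS]mulrAC mulfVK.
have [pE|pn] := eqVneq p 0.
  by rewrite pE !mulr0 oppr0 expR0 egf_zero subrr subrr mulr0 normr0.
have [+ _] := hbv p (introT andP (conj p0 p1)).
have pp : 0 < p by rewrite lt_def pn.
rewrite /bias_fun (negbTE pn) -(ler_pM2r pp); apply: le_trans.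
have -> : r * t * p = r * p * t by rewrite mulrAC.
have -> : t * p = p * t by exact: mulrC.
apply: le_of_eq.
by rewrite [RHS]mulrAC mulfVK// normrM (ger0_norm (expR_ge0 _)) distrC.
Qed.
End SpeciesError.

(** * Enumerating the species *)

Section SpeciesEnumeration.
Context (R : realType) (S : countType) (mu : probability {fset S} R) (B : nat).
Hypothesis muB : size_bounded mu B.
Implicit Types (i k : nat) (A : {fset S}).

(** Species are numbered by their codes; a number coding no species is contained in
no set, and contributes no error. *)
Definition contains i : pred {fset S} :=
  fun A => if choice.pickle_inv i is Some s then s \in A else false.

Definition species_type k A : {set 'I_k} := [set i : 'I_k | contains i A].

Lemma card_species_type k A : (#|species_type k A| <= #|` A|)%N.
Proof.
pose f (i : 'I_k) := choice.pickle_inv (T := S) i.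
rewrite cardE -(size_map f).
have -> : #|` A| = size (map Some (enum_fset A)) by rewrite size_map.
apply: uniq_leq_size.
  rewrite map_inj_in_uniq ?enum_uniq// => i j; rewrite !mem_enum !inE /contains /f.
  move=> + _ e; have := @choice.pickle_invK S i; have := @choice.pickle_invK S j; rewrite -e.
  case: (choice.pickle_inv _) => // s /= ej ei _; by apply/val_inj; rewrite /= -ei -ej.
move=> _ /mapP[i + ->]; rewrite mem_enum inE /contains /f.
by case: (choice.pickle_inv _) => // s sA; apply: map_f.
Qed.

Lemma large_sets_null (U : set {fset S}) : (forall A, U A -> (B < #|` A|)%N) -> mu U = 0%E.
Proof.
move=> UB; rewrite (@measure_split_nat _ _ _ mu choice.pickle)//.
apply: eseries0 => i _ _.
have [[A [UA /= Ai]]|nU] := pselect (exists A, U A /\ choice.pickle A = i).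
  apply/eqP; rewrite eq_le measure_ge0 andbT -(muB (UB A UA)) le_measure ?inE//.
  by move=> A' [_ /= A'i]; apply: (pcan_inj (@choice.pickleK {fset S})); rewrite A'i Ai.
rewrite (_ : _ `&` _ = set0) ?measure0//; apply/seteqP; split => // A [UA /= Ai].
by apply: nU; exists A.
Qed.

Lemma large_type_prob k (T : {set 'I_k}) : (B < #|T|)%N ->
  type_prob mu (@species_type k) T = 0.
Proof.
move=> BT; rewrite /type_prob large_sets_null// => A /= AT.
by apply: leq_trans (card_species_type k A); rewrite AT.
Qed.

(** The sum is the mean number of species, among the first k, in a random set. *)
Lemma sum_contains_prob k : \sum_(i < k) pred_prob mu (contains i) <= B%:R.
Proof.
have pE (i : 'I_k) : pred_prob mu (contains i) =
    \sum_(T : {set 'I_k}) (i \in T)%:R * type_prob mu (@species_type k) T.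
  apply: EFin_inj; rewrite /pred_prob fineK ?fin_num_measure// -sumEFin.
  rewrite (@measure_split_fin _ _ _ mu _ (@species_type k))//; apply: eq_bigr => T _.
  case: (boolP (i \in T)) => iT.
    rewrite mul1r /type_prob fineK ?fin_num_measure//; congr (mu _).
    apply/seteqP; split => [A []//|A /= AT]; split => //.
    by move: iT; rewrite -AT inE.
  rewrite mul0r (_ : _ `&` _ = set0) ?measure0//; apply/seteqP; split => // A [/= iA AT].
  by move: iT; rewrite -AT inE iA.
under eq_bigr do rewrite pE.
rewrite exchange_big /=.
have -> : B%:R = \sum_T B%:R * type_prob mu (@species_type k) T :> R.
  by rewrite -mulr_sumr type_prob_sum mulr1.
apply: ler_sum => T _; rewrite -mulr_suml.
have [BT|BT] := ltnP B #|T|; first by rewrite large_type_prob// !mulr0.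
apply: ler_wpM2r; first exact: type_prob_ge0.
by rewrite -natr_sum ler_nat; apply: leq_trans BT; rewrite -sum1_card [leqRHS]big_mkcond.
Qed.
End SpeciesEnumeration.

Section RiskBound.
Context (R : realType) (S : countType) (mu : probability {fset S} R) (r t : R)
  (d : measure_display) (Omega : measurableType d) (P : probability Omega R)
  (X : nat -> {RV P >-> {fset S}}) (n m : {RV P >-> nat}) (B : nat) (H : nat -> R) (c : R).
Hypotheses (r0 : 0 < r) (t0 : 0 < t) (he : expeditions mu t (r * t) X n m)
  (muB : size_bounded mu B) (H0 : H 0%N = 0) (Gc : (G r t H <= c%:E)%E).

Definition enum_error (i : nat) (x : bool -> seq {fset S}) : R :=
  count_error H (count (@contains S i) (x false)) (count (@contains S i) (x true)).

(** second_moment_le for the counts of the 2^k types in the two samples. *)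
Lemma partial_error_le k :
  (\int[P]_w ((\sum_(i < k) enum_error i (sample X n m w)) ^+ 2)%:E <= (B%:R ^+ 2 * c)%:E)%E.
Proof.
have [fin [b [v [b0 v0 bvc hbv]]]] := G_bounds r0 t0 Gc.
have rt0 : 0 < r * t by exact: mulr_gt0.
have mom (i : 'I_k) := species_moments r0 t0 he H0 fin (@contains S i) b0 v0 hbv.
pose a i := projT1 (cid (mom i)); pose e i := projT1 (cid (projT2 (cid (mom i)))).
have ae (i : 'I_k) : [/\ (\int[P]_w ((enum_error i (sample X n m w)) ^+ 2)%:E = (a i)%:E)%E,
    (\int[P]_w (enum_error i (sample X n m w))%:E = (e i)%:E)%E,
    a i <= v * pred_prob mu (@contains S i) & `|e i| <= b * pred_prob mu (@contains S i)].
  by rewrite /e /a; case: cid => a' /= h; case: cid.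
pose tau := @species_type S k.
pose js := enum {: bool * {set 'I_k}}.
pose f (i : 'I_k) vs := count_error H (species_tally false i js vs) (species_tally true i js vs).
have fE i w : f i (count_profile (type_count tau) js (sample X n m w)) = enum_error i (sample X n m w).
  rewrite /f /count_profile /type_count !(species_tally_profile tau (sample X n m w)) /enum_error.
  by congr (count_error H _ _); apply: eq_count => A; rewrite inE.
have wt0 (j : bool * {set 'I_k}) vv : 0 <= type_weight mu t (r * t) tau j vv.
  apply: pois_ge0; rewrite mulr_ge0 ?type_prob_ge0//.
  by case: ifP => _; exact: ltW.
have inf : bounded_influence B (map (type_weight mu t (r * t) tau) js) f.
  apply: (@species_tally_influence R k (count_error H) B js _ (fun=> 0%N) (fun=> 0%N)) => j vv jB vv0.
  by rewrite /type_weight (large_type_prob muB jB) mulr0 /pois expr0n gtn_eqF// mul0r mulr0.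
have := @second_moment_le R d Omega P _ (sample X n m) _ _ (type_count tau) (type_weight mu t (r * t) tau)
  _ B js f a e wt0 _ inf.
move=> /(_ (@measurable_samples _ _ _ _ _ X n m)).
move=> /(_ (sample_product_law t0 rt0 he tau)).
have E2 i : (\int[P]_w ((f i (count_profile (type_count tau) js (sample X n m w))) ^+ 2)%:E = (a i)%:E)%E.
  by under eq_integral do rewrite fE; have [] := ae i.
have E1 i : (\int[P]_w (f i (count_profile (type_count tau) js (sample X n m w)))%:E = (e i)%:E)%E.
  by under eq_integral do rewrite fE; have [] := ae i.
move=> /(_ E2 E1) h.
have -> : (\int[P]_w ((\sum_(i < k) enum_error i (sample X n m w)) ^+ 2)%:E =
   \int[P]_w ((\sum_i f i (count_profile (type_count tau) js (sample X n m w))) ^+ 2)%:E)%E.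
  apply: eq_integral => w _; congr ((_ ^+ 2)%:E); apply: eq_bigr => i _; by rewrite fE.
apply: (le_trans h); rewrite lee_fin.
have pB := sum_contains_prob muB k.
have sa : \sum_i a i <= v * B%:R.
  apply: le_trans (ler_wpM2l v0 pB); rewrite mulr_sumr; apply: ler_sum => i _.
  by have [] := ae i.
have se : `|\sum_i e i| <= b * B%:R.
  apply: le_trans (ler_norm_sum _ _ _) _.
  apply: le_trans (ler_wpM2l b0 pB); rewrite mulr_sumr; apply: ler_sum => i _.
  by have [] := ae i.
have se2 : (\sum_i e i) ^+ 2 <= (b * B%:R) ^+ 2.
  by rewrite -real_normK ?num_real// lerXn2r ?nnegrE// mulr_ge0.
have B2 : B%:R * (\sum_i a i) <= B%:R * (v * B%:R) by apply: ler_wpM2l.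
apply: (le_trans (lerD B2 se2)).
apply: (@le_trans _ _ (B%:R ^+ 2 * (b ^+ 2 + v))).
  by apply: le_of_eq; ring.
by apply: ler_wpM2l => //; exact: sqr_ge0.
Qed.
End RiskBound.

(** * The risk and the functional G *)

Section ErrorAsSum.
Context (R : realType) (S : countType) (H : nat -> R) (x : bool -> seq {fset S}).
Hypothesis H0 : H 0%N = 0.

Let U : {fset S} := [fset s in flatten (map (@enum_fset S) (x false ++ x true))]%fset.

Let occ_U zs s : {subset zs <= x false ++ x true} -> (0 < occ zs s)%N -> s \in U.
Proof.
move=> sub; rewrite /occ -has_count => /hasP[A Azs sA]; rewrite inE /=.
by apply/flattenP; exists (enum_fset A) => //; apply: map_f; exact: sub.
Qed.

Let nspecies_U zs : {subset zs <= x false ++ x true} ->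
  (nspecies zs)%:R = \sum_(s <- U) (0 < occ zs s)%N%:R :> R.
Proof.
move=> sub.
have fin : finite_set [set s | (0 < occ zs s)%N].
  by apply: (@sub_finite_set _ _ [set` U]) => [s /= /(occ_U sub)//|]; exact: finite_fset.
have -> : nspecies zs = #|` [fset s in U | (0 < occ zs s)%N]%fset|.
  rewrite /nspecies; congr (#|` _|); apply/fsetP => s.
  rewrite in_fset_set// !inE /=; apply/idP/andP => [|[_ h]]; rewrite inE //=.
  by move=> h; split => //; have := occ_U sub h; rewrite inE.
rewrite card_fset_sum1 -big_fset_condE /= natr_sum [LHS]big_mkcond /=.
by apply: eq_bigr => s _; case: (0 < _)%N.
Qed.

Let D s := count_error H (occ (x false) s) (occ (x true) s).

Let D_sum : \sum_(s <- U) D s = linear_estimator H (x false) -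
  ((nspecies (x false ++ x true))%:R - (nspecies (x false))%:R).
Proof.
have subl : {subset x false <= x false ++ x true} by move=> A; rewrite mem_cat => ->.
rewrite (nspecies_U subl) (nspecies_U (fun _ h => h)) /linear_estimator.
rewrite (@fsbigTE _ _ _ _ U); last first.
  move=> s; apply: contraNeq => Hs; apply: (occ_U subl).
  by rewrite lt0n; apply: contra Hs => /eqP ->; rewrite H0.
rewrite -!sumrB; apply: eq_bigr => s _; rewrite /D /count_error /occ count_cat.
case: (count _ (x false)) => [|a] /=; rewrite ?add0n ?subr0 ?subrr ?subr0//.
Qed.

(** Only the species in the union of the observed sets contribute, and this union
is finite. *)
Lemma sum_enum_error : \forall k \near \oo,
  \sum_(i < k) enum_error H i x = linear_estimator H (x false) -
    ((nspecies (x false ++ x true))%:R - (nspecies (x false))%:R).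
Proof.
exists (\max_(s <- U) (choice.pickle s).+1)%N => // k /= kU.
rewrite -D_sum.
have pk s : s \in U -> (choice.pickle s < k)%N.
  by move=> sU; apply: leq_trans kU; exact: (@leq_bigmax_seq _ (enum_fset U) xpredT (fun s => (choice.pickle s).+1) s sU isT).
have errE i : enum_error H i x = oapp D 0 (choice.pickle_inv i).
  rewrite /enum_error /contains /D /occ; case: (choice.pickle_inv i) => [s|] //=.
  by rewrite !count_pred0 /count_error H0 subrr.
rewrite -(big_mkord xpredT (fun i => enum_error H i x)) (bigID (mem (map choice.pickle U))) /=.
rewrite [X in _ + X]big1 ?addr0; last first.
  move=> i; rewrite errE; have := @choice.pickle_invK S i; case: (choice.pickle_inv i) => //= s <-.
  rewrite mem_map; last exact: (pcan_inj (@choice.pickleK S)).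
  apply: contraNeq => Ds; move: Ds; rewrite /D.
  case: (posnP (occ (x false) s)) => [->|h _]; last first.
    by apply: occ_U h => A; rewrite mem_cat => ->.
  case: (posnP (occ (x true) s)) => [->|h _]; last first.
    by apply: occ_U h => A; rewrite mem_cat orbC => ->.
  by rewrite /count_error H0 subrr eqxx.
rewrite -big_filter (perm_big (map choice.pickle U)) /=.
  rewrite big_map; apply: eq_bigr => s _.
  by rewrite errE choice.pickleK_inv.
apply: uniq_perm; first by rewrite filter_uniq ?iota_uniq.
  by rewrite map_inj_uniq ?fset_uniq//; exact: (pcan_inj (@choice.pickleK S)).
move=> i; rewrite mem_filter mem_index_iota /=; apply/andP/idP => [[]//|iU]; split => //.
by case/mapP: iU => s sU ->; exact: pk.
Qed.
End ErrorAsSum.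

Section Risk.
Context (R : realType).

Lemma limn_einf_le (u : nat -> \bar R) (c : \bar R) : (forall k, (u k <= c)%E) -> (limn_einf u <= c)%E.
Proof.
move=> uc; rewrite limn_einf_lim; apply: lime_le; first exact: is_cvg_einfs.
apply: nearW => k; apply: le_trans (uc k); apply: ereal_inf_lbound.
by exists k => /=.
Qed.

(** Fatou's lemma for the partial sums over the species. *)
Lemma mean_square_error_le (S : countType) (mu : probability {fset S} R) (r t : R)
  (d : measure_display) (Omega : measurableType d) (P : probability Omega R)
  (X : nat -> {RV P >-> {fset S}}) (n m : {RV P >-> nat}) (B : nat) (H : nat -> R) (c : R) :
  0 < r -> 0 < t -> expeditions mu t (r * t) X n m -> size_bounded mu B ->
  H 0%N = 0 -> (G r t H <= c%:E)%E ->
  (mean_square_error X n m (linear_estimator H) <= (B%:R ^+ 2 * c)%:E)%E.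
Proof.
move=> r0 t0 he muB H0 Gc.
have mz := @measurable_samples _ _ _ _ _ X n m.
pose E k w := ((\sum_(i < k) enum_error H i (sample X n m w)) ^+ 2)%:E.
have mE k : measurable_fun setT (E k).
  exact: (measurable_sample_fun mz (fun x => ((\sum_(i < k) enum_error H i x) ^+ 2)%:E)).
have E0 k w : setT w -> (0 <= E k w)%E by rewrite lee_fin sqr_ge0.
have h := fatou P measurableT mE E0.
have {}h := le_trans h (limn_einf_le (partial_error_le r0 t0 he muB H0 Gc)).
apply: le_trans h; rewrite /mean_square_error unlock.
apply: le_of_eq; apply: eq_integral => w _.
have lim : E k w @[k --> \oo] --> ((linear_estimator H (sample X n m w false) -
    ((nspecies (sample X n m w false ++ sample X n m w true))%:R
      - (nspecies (sample X n m w false))%:R)) ^+ 2)%:E.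
  apply: cvg_near_cst; near=> k; rewrite /E; congr ((_ ^+ 2)%:E).
  by near: k; exact: sum_enum_error.
by rewrite (cvg_limn_einf_sup lim) real_normK ?num_real.
Unshelve. all: by end_near. Qed.

Lemma risk_le (B : nat) (r t : R) (H : nat -> R) (c : R) :
  0 < r -> 0 < t -> H 0%N = 0 -> (G r t H <= (r ^+ 2 * t ^+ 2 * c)%:E)%E ->
  (risk B r t (linear_estimator H) <= (B%:R ^+ 2 * c)%:E)%E.
Proof.
move=> r0 t0 H0 Gc; apply: ge_ereal_sup => _ [S] [mu] [d] [W] [P] [X] [n] [m] [muB he ->].
have rt : 0 < r ^+ 2 * t ^+ 2 by rewrite mulr_gt0 ?exprn_gt0.
rewrite lee_pdivrMr// -EFinM.
apply: le_trans (mean_square_error_le r0 t0 he muB H0 Gc) _.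
by rewrite lee_fin; apply: le_of_eq; ring.
Qed.
End Risk.

(** * The risk of the optimal linear estimator *)

Unset Implicit Arguments.

Theorem theorem23 (R : realType) :
  exists C : R, 0 < C /\
  forall (B : nat) (r : R -> R) (Hstar : R -> nat -> R),
    (1 <= B)%N ->
    (forall t, 0 < t -> 1 < r t) ->
    (\forall t \near +oo,
       4 * ln (ln t) <= (r t - 1) / (r t + 1) * ln t) ->
    (forall t, 0 < t -> minimizer (r t) t (Hstar t)) ->
    \forall t \near +oo,
      (risk B (r t) t (linear_estimator (Hstar t)) <=
       (C * (B%:R ^+ 2
             * Num.min 1 ((1 + r t) ^+ 2 / (r t * ln t)) ^+ 2
             * Kfactor (r t) t `^ (2 / (1 + r t))
             * t `^ (- (2 / (1 + r t)))))%:E)%E.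
Proof.
pose C : R := 3200 + 2000 * 32 + 32.
exists C; split; first by rewrite /C; lra.
move=> B r Hstar _ r1 hr hmin.
near=> t.
have t0 : 0 < t by near: t; exact: nbhs_pinfty_gt.
have lt : 10 ^+ 6 <= ln t.
  have h : expR (10 ^+ 6) <= t by near: t; exact: nbhs_pinfty_ge.
  by rewrite -[10 ^+ 6]expRK ler_ln ?posrE ?expR_gt0.
have hrt : 4 * ln (ln t) <= (r t - 1) / (r t + 1) * ln t by near: t.
have [H GH] := exists_good_estimator (r1 t t0) lt t0 hrt.
have [H0 Hmin] := hmin t t0.
have r0 : 0 < r t := lt_trans ltr01 (r1 t t0).
have G' : (G (r t) t (Hstar t) <= ((r t) ^+ 2 * t ^+ 2 * (C * rate (r t) t))%:E)%E.
  apply: le_trans (Hmin H) _; apply: le_trans GH _.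
  by rewrite lee_fin; apply: le_of_eq; rewrite -/C; ring.
apply: le_trans (risk_le B r0 t0 H0 G') _.
rewrite lee_fin; apply: le_of_eq; rewrite /rate.
by rewrite mulrCA !mulrA.
Unshelve. all: by end_near.
Qed.
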